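(* Given a probability measure $\mu_0$ on $\mathbb R$, there exists a unique viscosity solution $F$ of $$\partial_tF+(\partial_xF)\,\tilde H[F]=0\quad\text{in }(0,\infty)\times\mathbb R$$ which satisfies $F(0,x)=\mu_0((-\infty,x])$.
   Context: The operator $\tilde H$ is defined on bounded functions $\phi:\mathbb R\to\mathbb R$ with bounded second order derivative by $\tilde H[\phi](x)=\int_{\mathbb R}\frac{\phi(x)-\phi(y)}{(x-y)^2}\,dy$, understood in the sense of principal value. Write $a_+=\max(a,0)$. $\mathcal C^{1,1}_b$ is the space of bounded functions with bounded second order derivatives. Viscosity solutions. Consider the equation (E+): $\partial_tF+(\partial_xF)_+\tilde H[F]=0$ in $(0,\infty)\times\mathbb R$, for functions $F:[0,\infty)\times\mathbb R\to\mathbb R$. - An upper semicontinuous (usc) $F$ is a viscosity subsolution of (E+) if for every smooth $\phi\in\mathcal C^{1,1}_b$ and every point $(t_0,x_0)\in(0,\infty)\times\mathbb R$ of strict maximum of $F-\phi$, $\partial_t\phi(t_0,x_0)+(\partial_x\phi(t_0,x_0))_+\tilde H[\phi(t_0)](x_0)\le0$. - A lower semicontinuous (lsc) $F$ is a viscosity supersolution of (E+) if for every smooth $\phi\in\mathcal C^{1,1}_b$ and every point $(t_0,x_0)\in(0,\infty)\times\mathbb R$ of strict minimum of $F-\phi$, the same expression is $\ge0$. - A viscosity solution of (E+) is a usc viscosity subsolution $F$ such that $F_*$ is a viscosity supersolution, where $F_*(t,x)=\liminf_{0\le s\to t,\,y\to x}F(s,y)$. - A function $F$ such that $F(t)=F(t,\cdot)$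 is non-decreasing for all $t\ge0$ is a viscosity solution of $\partial_tF+(\partial_xF)\tilde H[F]=0$ if it is a viscosity solution of (E+).
   Formalization: Solutions are required to be bounded on [0,∞)×ℝ and to satisfy also F_*(0,x)=μ₀((-∞,x)); without either condition uniqueness fails (e.g. F=0 for t>0, or F=μ₀((-∞,x])+tx). *)

(* Defs.v *)
(* MathComp-Analysis. *)
From HB Require Import structures.
From mathcomp Require Import all_boot all_order all_algebra.
From mathcomp Require Import all_classical all_reals all_analysis.

Set Implicit Arguments.
Unset Strict Implicit.
Unset Printing Implicit Defensive.

Import Order.TTheory GRing.Theory Num.Theory.
Import numFieldNormedType.Exports.

Local Open Scope classical_set_scope.
Local Open Scope ring_scope.

(* A function on [0, +oo) x R is represented by a total function R * R -> R,
   p = (t, x), of which only the values on this set are ever used. *)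
Definition halfplane (R : realType) : set (R * R) := [set p | 0 <= p.1].

(* The principal value. *)
Definition Htilde (R : realType) (phi : R -> R) (x : R) : R :=
  lim ((\int[lebesgue_measure]_(y in [set y | (e < `|x - y|)%R])
          ((phi x - phi y) / (x - y) ^+ 2)) @[e --> 0^'+]).

(* C^oo: the iterated directional derivatives of all orders are (Frechet)
   differentiable everywhere. *)
Definition smooth (R : realType) (V W : normedModType R) (f : V -> W) : Prop :=
  forall (vs : seq V) (x : V),
    differentiable (foldr (fun v g => 'D_v g) f vs) x.

Definition C11b (R : realType) (phi : R * R -> R) : Prop :=
  [bounded phi p | p in setT] /\
  forall v w : R * R, [bounded 'D_v ('D_w phi) p | p in setT].

Definition operatorE (R : realType) (phi : R * R -> R) (p : R * R) : R :=
  'D_(1, 0) phi p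
  + Num.max ('D_(0, 1) phi p) 0 * Htilde (fun y => phi (p.1, y)) p.2.

(* The maximum is global: Htilde being nonlocal, touching at p must be tested
   on the whole domain. *)
Definition strict_max (R : realType) (f : R * R -> R) (p : R * R) : Prop :=
  forall q, halfplane q -> q != p -> f q < f p.

Definition strict_min (R : realType) (f : R * R -> R) (p : R * R) : Prop :=
  forall q, halfplane q -> q != p -> f p < f q.

(* Semicontinuity on the half-plane for its induced topology; the points outside it
   are isolated in the subspace topology. *)
Definition lsc (R : realType) (F : R * R -> R) : Prop :=
  lower_semicontinuous (fun p : subspace (@halfplane R) => (F p)%:E).

Definition usc (R : realType) (F : R * R -> R) : Prop :=
  lower_semicontinuous (fun p : subspace (@halfplane R) => (- F p)%:E).

Definition subsolution (R : realType) (F : R * R -> R) : Prop :=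
  usc F /\
  forall (phi : R * R -> R) (p : R * R), smooth phi -> C11b phi ->
    0 < p.1 -> strict_max (F \- phi) p -> operatorE phi p <= 0.

Definition supersolution (R : realType) (F : R * R -> R) : Prop :=
  lsc F /\
  forall (phi : R * R -> R) (p : R * R), smooth phi -> C11b phi ->
    0 < p.1 -> strict_min (F \- phi) p -> 0 <= operatorE phi p.

(* F_*.  The neighbourhoods are not punctured; the value is a genuine real
   number at the points of the half-plane as soon as F is locally bounded. *)
Definition lower_env (R : realType) (F : R * R -> R) (p : R * R) : R :=
  fine (limf_einf (EFin \o F) (within (@halfplane R) (nbhs p))).

Definition viscosity_solution_plus (R : realType) (F : R * R -> R) : Prop :=
  subsolution F /\ supersolution (lower_env F).

Definition viscosity_solution (R : realType) (F : R * R -> R) : Prop :=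
  (forall t, 0 <= t -> {homo (fun x => F (t, x)) : x y / x <= y}) /\
  viscosity_solution_plus F.

(* The initial condition of a discontinuous viscosity solution: F and F_* start
   from the upper and the lower semicontinuous envelope of the distribution
   function of mu0.  The condition on F alone leaves F_* free on {t = 0} and does
   not exclude a jump at time 0: the F with F(0, x) = mu0 `]-oo, x] and
   F(t, x) = 0 for t > 0 is a viscosity solution for every mu0. *)
Definition initial_condition (R : realType)
    (mu0 : probability (measurableTypeR R) R) (F : R * R -> R) : Prop :=
  (forall x, (F (0, x))%:E = mu0 `]-oo, x]%classic) /\
  (forall x, (lower_env F (0, x))%:E = mu0 `]-oo, x[%classic).

(* Htilde acts on bounded functions, so solutions are sought among these.
   Without the bound, F(t, x) = mu0 `]-oo, x] + t * x would be a solution, as it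
   admits no bounded test function at any point with t > 0. *)
Definition cauchy_solution (R : realType)
    (mu0 : probability (measurableTypeR R) R) (F : R * R -> R) : Prop :=
  [/\ [bounded F p | p in @halfplane R],
      viscosity_solution F &
      initial_condition mu0 F].

(* Main.v *)
(* Existence is Perron's method.  The upper semicontinuous envelope of the supremum of
   all subsolutions lying below the initial distribution function is the largest
   subsolution, and where its lower envelope failed to be a supersolution one could
   lift it by a smooth bump.  The initial values are read off explicit barriers
   c +- 4M q((x - x0)/d) +- 8M (q(Ct + 1) - 1/2), with q(y) = y^2/(1 + y^2), whose
   constant C does not depend on x0.

   Uniqueness: the initial data are discontinuous, so one solution is first shifted to
   the right by d > 0; its initial value F0(x - d) then lies below the lower envelope
   F0(x-) of the other, a comparison principle orders the shifted solution and the
   other one, and right-continuity (monotonicity and semicontinuity) lets d tend to 0.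
   Comparison is proved by doubling variables with bounded penalisations.  The
   translation-invariant barriers keep the maximum away from t = 0 uniformly in x, so
   the localisation in x can be removed with the doubling parameters fixed.  Since test
   functions are smooth, the nonlocal term of the subsolution itself is reached by
   blending, with weight q((x - x0)/r), the penalisation with a smooth majorant of the
   subsolution; the majorant comes from monotonicity in x.

   All estimates on the nonlocal operator go through one kernel: a second difference
   bounded by K z^2/(r^2 + z^2) contributes at most K pi/(2r). *)
Require Import Defs.
From mathcomp Require Import all_boot all_order all_algebra.
From mathcomp Require Import all_classical all_reals all_analysis.
From mathcomp Require Import measurable_realfun ring lra.
Set Implicit Arguments.
Unset Strict Implicit.
Unset Printing Implicit Defensive.
Import Order.TTheory GRing.Theory Num.Theory.
Import numFieldNormedType.Exports.
Local Open Scope classical_set_scope.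
Local Open Scope ring_scope.

(** * The nonlocal operator as an absolutely convergent integral *)

Section Htilde_theory.
Variable R : realType.
Notation mu := (@lebesgue_measure R).

(** The equation is nonlocal, so a test function enters through all its values and has to be
    bounded: squared distances and linear time penalties are replaced by the saturating profile q.
    The coefficients 4M and 8M are tuned to the oscillation 2M: where a difference beats its
    penalisation, every argument of q lies in a fixed range. This gives compactness in spite of the
    saturation, and in that range the time profile keeps a slope bounded below. The other obstacle
    is the product of slope and nonlocal term. After doubling, the nonlocal term of a single test
    function is only O(1/r). Comparison closes for two separate reasons: the difference of the two
    nonlocal terms is O(r) and is multiplied by a slope that stays bounded while the doubling
    parameters are fixed; and the two slopes differ through the localisation alone, by O(b) with b
    at most r^2. The fixed gain M l in time would then be at most A r for every small r. Estimates
    for supersolutions come from those for subsolutions by f(t, x) -> - f(t, - x), which preserves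
    monotonicity in x. *)

Definition sdiff (f : R -> R) (x z : R) : R := f x *+ 2 - f (x + z) - f (x - z).

(** * Change of variables by translation and reflection *)

Lemma measurable_translation (a : R) :
  measurable_fun setT ((fun z => a + z) : measurableTypeR R -> measurableTypeR R).
Proof. by apply: continuous_measurable_fun => x; apply: cvgD; [exact: cvg_cst|exact: cvg_id]. Qed.

Lemma measurable_reflection (a : R) :
  measurable_fun setT ((fun z => a - z) : measurableTypeR R -> measurableTypeR R).
Proof. by apply: continuous_measurable_fun => x; apply: cvgB; [exact: cvg_cst|exact: cvg_id]. Qed.

Lemma lebesgue_measure_translation (a : R) (A : set R) : measurable A ->
  pushforward mu ((fun z => a + z) : measurableTypeR R -> measurableTypeR R) A = mu A.
Proof.
move=> mA; apply/esym/(@lebesgue_measure_unique R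
   (pushforward mu ((fun z => a + z) : measurableTypeR R -> measurableTypeR R))) => //.
  exact: measurable_translation.
move=> ? _ [[b c]] _ <- /=.
rewrite /pushforward.
have -> : (fun z => a + z) @^-1` `]b, c] = `]b - a, c - a]%classic.
  by apply/seteqP; split => z /=; rewrite !in_itv /= => /andP[? ?]; apply/andP; split; lra.
rewrite !lebesgue_measure_itv /= !lte_fin ltrD2r; case: ifP => // _.
by rewrite -!EFinB; congr (_%:E); lra.
Qed.

Lemma lebesgue_measure_reflection (a : R) (A : set R) : measurable A ->
  pushforward mu ((fun z => a - z) : measurableTypeR R -> measurableTypeR R) A = mu A.
Proof.
move=> mA.
have := @lebesgue_measureN R ((fun z => a + z) @^-1` A).
have := lebesgue_measure_translation a mA; rewrite /pushforward => <- -> //.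
rewrite -[X in measurable X]setTI; exact: measurable_translation.
Qed.

(** Integrability over [D] is returned rather than assumed, so that only the recentred integrand, in
    which the kernel is visible, has to be dominated. *)
Lemma integral_translation (f : R -> R) (a : R) (D : set R) : measurable D ->
    measurable_fun setT f ->
    mu.-integrable ((fun z => a + z) @^-1` D) (EFin \o (fun z => f (a + z))) ->
  \int[mu]_(y in D) f y = \int[mu]_(z in (fun z => a + z) @^-1` D) f (a + z) /\
  mu.-integrable D (EFin \o f).
Proof.
move=> mD mf intf.
have mf' := (measurable_EFinP _ _).2 mf.
have E := integral_pushforward (measurable_translation a) mf' intf mD.
have I := integrable_pushforward (measurable_translation a) mf' intf mD.
have eqm (A : set (measurableTypeR R)) : measurable A -> A `<=` D ->
    pushforward mu ((fun z => a + z) : measurableTypeR R -> measurableTypeR R) A = mu A.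
  by move=> mA _; exact: lebesgue_measure_translation.
split.
  rewrite /Rintegral -[X in _ = fine X]E; congr fine.
  by apply: eq_measure_integral => [|? A mA AD];
    [exact: measurable_translation|exact/esym/eqm].
case/integrableP : I => mI I; apply/integrableP; split => //.
apply: le_lt_trans I.
by rewrite le_eqVlt; apply/orP; left; apply/eqP; apply: eq_measure_integral => [|? A mA AD];
  [exact: measurable_translation|exact/esym/eqm].
Qed.

Lemma integral_reflection (f : R -> R) (a : R) (D : set R) : measurable D ->
    measurable_fun setT f ->
    mu.-integrable ((fun z => a - z) @^-1` D) (EFin \o (fun z => f (a - z))) ->
  \int[mu]_(y in D) f y = \int[mu]_(z in (fun z => a - z) @^-1` D) f (a - z) /\
  mu.-integrable D (EFin \o f).
Proof.
move=> mD mf intf.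
have mf' := (measurable_EFinP _ _).2 mf.
have E := integral_pushforward (measurable_reflection a) mf' intf mD.
have I := integrable_pushforward (measurable_reflection a) mf' intf mD.
have eqm (A : set (measurableTypeR R)) : measurable A -> A `<=` D ->
    pushforward mu ((fun z => a - z) : measurableTypeR R -> measurableTypeR R) A = mu A.
  by move=> mA _; exact: lebesgue_measure_reflection.
split.
  rewrite /Rintegral -[X in _ = fine X]E; congr fine.
  by apply: eq_measure_integral => [|? A mA AD];
    [exact: measurable_reflection|exact/esym/eqm].
case/integrableP : I => mI I; apply/integrableP; split => //.
apply: le_lt_trans I.
by rewrite le_eqVlt; apply/orP; left; apply/eqP; apply: eq_measure_integral => [|? A mA AD];
  [exact: measurable_reflection|exact/esym/eqm].
Qed.

(** * The Cauchy kernel and the principal value *)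

Lemma integral_cauchy_kernel (r : R) : 0 < r ->
  (\int[mu]_(z in `[0%R, +oo[) (r ^+ 2 + z ^+ 2)^-1%:E)%E = (r^-1 * (pi / 2))%:E.
Proof.
move=> r0.
have rn0 : r != 0 by rewrite gt_eqF.
have d0 z : 0 < r ^+ 2 + z ^+ 2 by rewrite ltr_pwDl ?exprn_gt0 ?sqr_ge0.
have cf : continuous (fun z : R => (r ^+ 2 + z ^+ 2)^-1).
  move=> z; apply: cvgV; first by rewrite gt_eqF.
  by apply: cvgD; [exact: cvg_cst|exact: exprn_continuous].
pose F z := r^-1 * atan (r^-1 * z).
have dF (z : R) : is_derive z 1 F (r ^+ 2 + z ^+ 2)^-1.
  have h : is_derive z 1 (fun z => r^-1 * z) r^-1.
    have h0 := @is_deriveZ R R R id r^-1 z 1 1 (is_derive_id z 1).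
    by rewrite /GRing.scale /= mulr1 in h0.
  have := is_derive1_comp (is_derive1_atan (r^-1 * z)) h.
  move=> h2; have h3 := @is_deriveZ _ _ _ _ r^-1 _ _ _ h2.
  apply: (is_derive_eq h3).
  rewrite /GRing.scale /=; field.
  by rewrite rn0 /= gt_eqF // addrC.
have cF : continuous F.
  by move=> z; apply: differentiable_continuous; apply/derivable1_diffP; case: (dF z).
rewrite (@ge0_continuous_FTC2y _ _ F 0 (r^-1 * (pi / 2))).
- by rewrite /F mulr0 atan0 mulr0 sube0.
- by move=> z _; rewrite invr_ge0 ltW.
- by apply: continuous_subspaceT.
- apply: cvgM; first exact: cvg_cst.
  apply: (cvg_comp _ _ _ (@cvgy_atan R)).
  by apply: gt0_cvgMry => //; rewrite invr_gt0.
- by move=> z _; case: (dF z).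
- by apply: cvg_at_right_filter; exact: cF.
- by move=> z _; rewrite derive1E; case: (dF z).
Qed.

(** By this scaling an error [O(r^2)] carried by the kernel of width [r] integrates to [O(r)]. *)
Definition kint (r : R) : R := r^-1 * (pi / 2).

Lemma integrable_cauchy_kernel (r : R) : 0 < r ->
  mu.-integrable `[0%R, +oo[ (fun z => (r ^+ 2 + z ^+ 2)^-1%:E).
Proof.
move=> r0.
have d0 z : 0 < r ^+ 2 + z ^+ 2 by rewrite ltr_pwDl ?exprn_gt0 ?sqr_ge0.
apply/integrableP; split.
  apply/measurable_EFinP; apply: measurable_funTS.
  apply: continuous_measurable_fun => z; apply: cvgV; first by rewrite gt_eqF.
  by apply: cvgD; [exact: cvg_cst|exact: exprn_continuous].
under eq_integral do rewrite gee0_abs ?lee_fin ?invr_ge0 ?(ltW (d0 _))//.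
by rewrite integral_cauchy_kernel // ltry.
Qed.

Lemma Rintegral_cauchy_kernel (r : R) : 0 < r ->
  \int[mu]_(z in `[0%R, +oo[) (r ^+ 2 + z ^+ 2)^-1 = kint r.
Proof. by move=> r0; rewrite /Rintegral integral_cauchy_kernel. Qed.

Lemma kernel_le (z e : R) : 0 < e -> e < z -> (z ^+ 2)^-1 <= (1 + e ^- 2) * (1 ^+ 2 + z ^+ 2)^-1.
Proof.
move=> e0 ez; have z0 : 0 < z by lra.
have z2 : 0 < z ^+ 2 by rewrite exprn_gt0.
have d0 : 0 < 1 ^+ 2 + z ^+ 2 by rewrite expr1n; lra.
rewrite ler_pdivlMr // mulrDr mulVf ?gt_eqF // expr1n mulr1 [leRHS]addrC lerD2r.
by rewrite lef_pV2 ?posrE ?exprn_gt0 //; rewrite ler_sqr ?nnegrE; lra.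
Qed.

(** Inversion takes the default value 0 at 0, where it is discontinuous; the line is split there. *)
Lemma measurable_funV : measurable_fun setT (@GRing.inv R).
Proof.
have -> : [set: R] = [set~ 0] `|` [set 0] by rewrite setUC setUv.
apply/measurable_funU => //; first exact: measurableC.
split; last exact: measurable_fun_set1.
apply: open_continuous_measurable_fun => [|z /set_mem z0].
  by rewrite openC; exact: closed_eq.
by apply: inv_continuous; apply/eqP.
Qed.

(** The two half-lines beyond distance [e] are folded onto one by y = x + z and y = x - z. Off the
    singularity each half converges on its own because [f] is bounded; the cancellation at the
    origin appears only in the sum, as a second difference. *)
Lemma Htilde_truncated (f : R -> R) (x M e : R) :
    continuous f -> (forall y, `|f y| <= M) -> 0 < e ->
  \int[mu]_(y in [set y | (e < `|x - y|)%R]) ((f x - f y) / (x - y) ^+ 2) =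
  \int[mu]_(z in `]e, +oo[) (sdiff f x z / z ^+ 2).
Proof.
move=> cf fM e0.
set g := fun y => (f x - f y) / (x - y) ^+ 2.
have mg : measurable_fun setT g.
  apply: measurable_funM.
    by apply: measurable_funB => //; exact: continuous_measurable_fun.
  by apply: (measurableT_comp measurable_funV); apply: measurable_funX; exact: measurable_funB.
have cfl a : continuous (fun z => f (a + z)).
  by move=> z; apply: continuous_comp; [apply: cvgD; [exact: cvg_cst|exact: cvg_id]|exact: cf].
have cfr a : continuous (fun z => f (a - z)).
  by move=> z; apply: continuous_comp; [apply: cvgB; [exact: cvg_cst|exact: cvg_id]|exact: cf].
have M0 : 0 <= M by rewrite (le_trans _ (fM 0)).
have int_aux (h : R -> R) : continuous h -> (forall y, `|h y| <= M) ->
    mu.-integrable `]e, +oo[ (EFin \o (fun z => (f x - h z) / z ^+ 2)).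
  move=> ch hM.
  apply: (@le_integrable _ _ _ mu _ _ _
     (fun z => ((2 * M * (1 + e ^- 2))%:E * (1 ^+ 2 + z ^+ 2)^-1%:E)%E)) => //.
  - apply/measurable_EFinP; apply: measurable_funTS; apply: measurable_funM.
      by apply: measurable_funB => //; exact: continuous_measurable_fun.
    by apply: (measurableT_comp measurable_funV); exact: measurable_funX.
  - move=> z /=; rewrite in_itv /= andbT => ez.
    have d0 : 0 < 1 ^+ 2 + z ^+ 2 by rewrite expr1n ltr_pwDl ?ltr01 ?sqr_ge0.
    have e2 : 0 <= e ^- 2 by rewrite invr_ge0 sqr_ge0.
    rewrite lee_fin normrM [leRHS]ger0_norm; last first.
      by apply: mulr_ge0; [apply: mulr_ge0; lra|rewrite invr_ge0 ltW].
    rewrite -[leRHS]mulrA ler_pM // ?normr_ge0 //.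
      by rewrite (le_trans (ler_normB _ _)) //; have := fM x; have := hM z; lra.
    by rewrite ger0_norm ?invr_ge0 ?sqr_ge0 // kernel_le.
  - apply: integrableZl => //.
    apply: (integrableS _ _ _ (integrable_cauchy_kernel ltr01)) => //.
    by move=> z /=; rewrite !in_itv /= !andbT; lra.
have domE : [set y | (e < `|x - y|)%R] = `]x + e, +oo[%classic `|` `]-oo, x - e[%classic.
  apply/seteqP; split => y /=; rewrite !in_itv /= !andbT ltr_normr.
    by move=> /orP[?|?]; [right|left]; lra.
  by move=> [?|?]; apply/orP; [right|left]; lra.
have preA : (fun z => x + z) @^-1` `]x + e, +oo[%classic = `]e, +oo[%classic.
  by apply/seteqP; split => y /=; rewrite !in_itv /= !andbT; lra.
have preB : (fun z => x - z) @^-1` `]-oo, x - e[%classic = `]e, +oo[%classic.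
  by apply/seteqP; split => y /=; rewrite !in_itv /= ?andbT; lra.
have gA : (fun z => g (x + z)) = (fun z => (f x - f (x + z)) / z ^+ 2).
  by apply/funext => z; rewrite /g; congr (_ / _); ring.
have gB : (fun z => g (x - z)) = (fun z => (f x - f (x - z)) / z ^+ 2).
  by apply/funext => z; rewrite /g; congr (_ / _); ring.
have iA : mu.-integrable `]e, +oo[ (EFin \o (fun z => (f x - f (x + z)) / z ^+ 2)).
  by apply: (int_aux (fun z => f (x + z))).
have iB : mu.-integrable `]e, +oo[ (EFin \o (fun z => (f x - f (x - z)) / z ^+ 2)).
  by apply: (int_aux (fun z => f (x - z))).
have [] := @integral_translation g x `]x + e, +oo[%classic; rewrite ?preA ?gA // => EA IA.
have [] := @integral_reflection g x `]-oo, x - e[%classic; rewrite ?preB ?gB // => EB IB.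
have dAB : [disjoint `]x + e, +oo[%classic & `]-oo, x - e[%classic].
  by apply/disj_set2P; rewrite -subset0 => y /= []; rewrite !in_itv /= !andbT; lra.
rewrite domE Rintegral_setU //=; last first.
  apply/integrableP; split.
    by apply/measurable_EFinP; exact: measurable_funTS.
  rewrite ge0_integral_setU //=; last first.
    by apply/measurable_EFinP; apply: measurableT_comp => //; exact: measurable_funTS.
  case/integrableP : IA => _ IA; case/integrableP : IB => _ IB.
  by rewrite lte_add_pinfty.
rewrite EA EB -RintegralD //; apply: eq_Rintegral => z _.
by rewrite -mulrDl /sdiff; congr (_ / _); ring.
Qed.

(** The last bound merges [O(z^2)] at the origin with boundedness at infinity; divided by [z ^+ 2],
    it is a multiple of the Cauchy kernel of width 1. *)
Definition Hregular (f : R -> R) (x : R) : Prop :=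
  [/\ continuous f, exists M : R, forall y, `|f y| <= M
    & exists K : R, forall z, `|sdiff f x z| <= K * (z ^+ 2 / (1 + z ^+ 2))].

Lemma sdiff_integrable f x : Hregular f x ->
  mu.-integrable `[0%R, +oo[ (EFin \o (fun z => sdiff f x z / z ^+ 2)).
Proof.
move=> [cf _ [K fK]].
apply: (@le_integrable _ _ _ mu _ _ _
   (fun z => (K%:E * (1 ^+ 2 + z ^+ 2)^-1%:E)%E)) => //.
- apply/measurable_EFinP; apply: measurable_funTS; apply: measurable_funM.
    apply: measurable_funB; first apply: measurable_funB => //.
      by apply: continuous_measurable_fun => z; apply: continuous_comp;
        [apply: cvgD; [exact: cvg_cst|exact: cvg_id]|exact: cf].
    by apply: continuous_measurable_fun => z; apply: continuous_comp;
      [apply: cvgB; [exact: cvg_cst|exact: cvg_id]|exact: cf].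
  by apply: (measurableT_comp measurable_funV); exact: measurable_funX.
- move=> z _ /=.
  have d0 : 0 < 1 + z ^+ 2 by rewrite ltr_pwDl ?ltr01 ?sqr_ge0.
  (* At [z = 0] the quotient is 0, the inverse of 0 being 0. *)
  have [->|z0] := eqVneq z 0.
    by rewrite lee_fin expr0n /= invr0 mulr0 normr0.
  have z2 : 0 < z ^+ 2 by rewrite exprn_even_gt0.
  have K0 : 0 <= K.
    have := le_trans (normr_ge0 _) (fK z).
    by rewrite pmulr_lge0 // divr_gt0.
  rewrite lee_fin normrM [leRHS]ger0_norm; last by rewrite mulr_ge0 // invr_ge0 expr1n ltW.
  rewrite [X in _ * X <= _]ger0_norm ?invr_ge0 ?sqr_ge0 // ler_pdivrMr // expr1n.
  by rewrite -mulrA [_^-1 * _]mulrC.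
- by apply: integrableZl => //; exact: integrable_cauchy_kernel.
Qed.

(** Once the second difference quotient is integrable on the half-line, the truncated integrals are
    its integral minus the one over [[0, e]], which vanishes in the limit: the principal value is an
    ordinary integral. *)
Lemma HtildeE f x : Hregular f x ->
  Htilde f x = \int[mu]_(z in `[0%R, +oo[) (sdiff f x z / z ^+ 2).
Proof.
move=> fx; have [cf [M fM] _] := fx.
have ifx := sdiff_integrable fx.
set g := fun z => sdiff f x z / z ^+ 2; rewrite -/g in ifx *.
pose I := \int[mu]_(z in `[0%R, +oo[) g z.
rewrite /Htilde; apply: cvg_lim => //.
have E : \forall e \near 0^'+,
    (\int[mu]_(z in `[0%R, +oo[) g z) - parameterized_integral mu 0 e g =
    \int[lebesgue_measure]_(y in [set y | (e < `|x - y|)%R]) ((f x - f y) / (x - y) ^+ 2).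
  near=> e.
  have e0 : 0 < e by [].
  rewrite (Htilde_truncated x cf fM e0) /parameterized_integral.
  by rewrite Rintegral_itvB // bnd_simp ltW.
apply: cvg_trans; first exact: (near_eq_cvg E).
have H : (I - parameterized_integral mu 0 e g) @[e --> 0^'+] --> I - 0.
  apply: cvgB; first exact: cvg_cst.
  apply: cvg_at_right_filter.
  apply: (@parameterized_integral_cvg_left R 0 1) => //.
  by apply: (integrableS _ _ _ ifx) => //; exact: subset_itvl.
by rewrite subr0 in H.
Unshelve. all: by end_near. Qed.

(** The base points may differ, as they do after doubling, and two widths are allowed at once: one
    for the region of the singularity and one for a perturbation living at its own scale. *)
Lemma Htilde_le f g x y K L r s : Hregular f x -> Hregular g y ->
    0 < r -> 0 < s -> 0 <= K -> 0 <= L ->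
    (forall z, 0 < z -> sdiff f x z <= sdiff g y z +
       K * (z ^+ 2 / (r ^+ 2 + z ^+ 2)) + L * (z ^+ 2 / (s ^+ 2 + z ^+ 2))) ->
  Htilde f x <= Htilde g y + K * kint r + L * kint s.
Proof.
move=> fx gy r0 s0 K0 L0 fg.
have ifx := sdiff_integrable fx; have igy := sdiff_integrable gy.
have ir := integrable_cauchy_kernel r0; have is_ := integrable_cauchy_kernel s0.
have iKr : mu.-integrable `[0%R, +oo[ (EFin \o (fun z => K * (r ^+ 2 + z ^+ 2)^-1)).
  exact: (integrableZl _ K ir).
have iLs : mu.-integrable `[0%R, +oo[ (EFin \o (fun z => L * (s ^+ 2 + z ^+ 2)^-1)).
  exact: (integrableZl _ L is_).
have igK : mu.-integrable `[0%R, +oo[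
    (EFin \o (fun z => sdiff g y z / z ^+ 2 + K * (r ^+ 2 + z ^+ 2)^-1)).
  exact: (integrableD _ igy iKr).
rewrite (HtildeE fx) (HtildeE gy) -!Rintegral_cauchy_kernel //.
rewrite -!RintegralZl // -!RintegralD //.
apply: le_Rintegral => //.
  exact: (integrableD _ igK iLs).
move=> z /=; rewrite in_itv /= andbT le_eqVlt => /predU1P[<-|z0].
  rewrite !expr0n /= invr0 !mulr0 !addr0 add0r.
  by rewrite addr_ge0 // mulr_ge0 // invr_ge0 sqr_ge0.
have z2 : 0 < z ^+ 2 by rewrite exprn_gt0.
rewrite ler_pdivrMr //; apply: le_trans (fg z z0) _.
rewrite le_eqVlt; apply/orP; left; apply/eqP.
by move: (sdiff g y z) => S; field; rewrite !gt_eqF // ltr_pwDl ?exprn_gt0 ?sqr_ge0.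
Qed.

End Htilde_theory.

(** * Test functions *)

Section test_functions.
Variable R : realType.
Implicit Types (f g phi psi : R * R -> R) (p q v w : R * R).

Lemma bounded_onP (T : Type) (f : T -> R) (A : set T) :
  [bounded f x | x in A] <-> exists M : R, forall x, A x -> `|f x| <= M.
Proof.
split.
  move=> [M [Mreal HM]]; exists (M + 1) => x Ax; apply: (HM (M + 1)) => //.
  by rewrite ltrDl.
move=> [M HM]; exists M; split; first exact: num_real.
by move=> N MN x Ax; apply: le_trans (HM x Ax) (ltW MN).
Qed.

Lemma line_quotient (f : R * R -> R) p v (h : R) :
  (fun k : R => k^-1 *: (((fun k : R => f (k *: v + p)) \o shift h) k%:A - f (h *: v + p)))
  = (fun k : R => k^-1 *: ((f \o shift (h *: v + p)) (k *: v) - f (h *: v + p))).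
Proof. by apply/funext => k /=; rewrite scalerDl addrA [k%:A]mulr1. Qed.

Lemma line_derive (f : R * R -> R) p v (h : R) :
  'D_1 (fun k : R => f (k *: v + p)) h = 'D_v f (h *: v + p).
Proof. by rewrite /derive line_quotient. Qed.

Lemma line_derivable (f : R * R -> R) p v (h : R) :
  derivable f (h *: v + p) v -> derivable (fun k : R => f (k *: v + p)) h 1.
Proof. by rewrite /derivable line_quotient. Qed.

Lemma is_derive_line f p v (h : R) : differentiable f (h *: v + p) ->
  is_derive h 1 (fun k : R => f (k *: v + p)) ('D_v f (h *: v + p)).
Proof.
move=> df; apply: DeriveDef; last exact: line_derive.
by apply: line_derivable; apply: diff_derivable.
Qed.

(** * One-variable estimates from bounds of orders zero and two *)

Lemma lipschitz1 (F dF : R -> R) (C a b : R) :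
    (forall y : R, is_derive y 1 F (dF y)) -> (forall y, `|dF y| <= C) ->
  `|F a - F b| <= C * `|a - b|.
Proof.
move=> dFF dFC.
have cF : continuous F.
  by move=> y; apply: differentiable_continuous; apply/derivable1_diffP; case: (dFF y).
wlog ab : a b / b < a.
  move=> H; have [ab|ab|->] := ltgtP a b; last by rewrite !subrr normr0 mulr0.
    by rewrite distrC [X in _ * X]distrC; exact: H.
  exact: H.
have [c _ ->] := @MVT R F dF b a ab (fun y _ => dFF y) (continuous_subspaceT cF).
by rewrite normrM ler_wpM2r.
Qed.

(** [C11b] bounds a function and its second derivatives only. The mean value theorem on [[y, y + 1]]
    gives a point where the slope is at most [2 * M], and from there to [y] it changes by at most
    [K]. *)
Lemma landau1 (F dF ddF : R -> R) (M K : R) :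
    (forall y : R, is_derive y 1 F (dF y)) -> (forall y : R, is_derive y 1 dF (ddF y)) ->
    (forall y, `|F y| <= M) -> (forall y, `|ddF y| <= K) ->
  forall y, `|dF y| <= 2 * M + K.
Proof.
move=> dFF ddFF FM FK y.
have cF : continuous F.
  by move=> z; apply: differentiable_continuous; apply/derivable1_diffP; case: (dFF z).
have y1 : y < y + 1 by lra.
have [c cI E] := @MVT R F dF y (y + 1) y1 (fun y _ => dFF y) (continuous_subspaceT cF).
have := lipschitz1 y c ddFF FK.
have K0 := le_trans (normr_ge0 _) (FK 0).
have : `|y - c| <= 1.
  by move: cI; rewrite in_itv /= => /andP[? ?]; rewrite ler_norml; apply/andP; split; lra.
move=> h1 h2.
have h3 : `|dF y - dF c| <= K by rewrite (le_trans h2) // ler_piMr.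
have E2 : dF y = (F (y + 1) - F y) + (dF y - dF c) by rewrite E; lra.
rewrite E2 (le_trans (ler_normD _ _)) // lerD //.
by rewrite (le_trans (ler_normB _ _)) //; have := FM (y+1); have := FM y; lra.
Qed.

(** For [z ^+ 2 <= 1] the bound [2 * K * z ^+ 2] from two mean values is used, beyond it the bound
    [4 * M]; each costs a factor 2 when the denominator [1 + z ^+ 2] is introduced. *)
Lemma sdiff_bound (F dF ddF : R -> R) (M K : R) :
    (forall y : R, is_derive y 1 F (dF y)) -> (forall y : R, is_derive y 1 dF (ddF y)) ->
    (forall y, `|F y| <= M) -> (forall y, `|ddF y| <= K) ->
  forall x z, `|sdiff F x z| <= (8 * M + 4 * K) * (z ^+ 2 / (1 + z ^+ 2)).
Proof.
move=> dFF ddFF FM FK x z.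
have M0 := le_trans (normr_ge0 _) (FM 0).
have K0 := le_trans (normr_ge0 _) (FK 0).
have cF : continuous F.
  by move=> y; apply: differentiable_continuous; apply/derivable1_diffP; case: (dFF y).
have h4 : `|sdiff F x z| <= 4 * M.
  rewrite /sdiff (le_trans (ler_normB _ _)) //.
  have : `|F x *+ 2 - F (x + z)| <= 3 * M.
    rewrite (le_trans (ler_normB _ _)) // normrMn.
    by have := FM x; have := FM (x + z); lra.
  by have := FM (x - z); lra.
have hz : `|sdiff F x z| <= 2 * K * z ^+ 2.
  wlog z0 : z {h4} / 0 < z.
    move=> H; have [z0|z0|->] := ltgtP z 0.
    - have := H (- z); rewrite sqrrN oppr_gt0 => /(_ z0).
      by rewrite /sdiff opprK addrAC.
    - exact: H.
    - by rewrite /sdiff subr0 addr0 mulr2n (_ : _ - _ = 0) ?normr0 ?expr0n /= ?mulr0 //; ring.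
  have xz1 : x < x + z by lra.
  have xz2 : x - z < x by lra.
  have [c cI E] := @MVT R F dF _ _ xz1 (fun y _ => dFF y) (continuous_subspaceT cF).
  have [d dI E'] := @MVT R F dF _ _ xz2 (fun y _ => dFF y) (continuous_subspaceT cF).
  have -> : sdiff F x z = (dF d - dF c) * z.
    rewrite /sdiff; have -> : F x *+ 2 - F (x + z) - F (x - z) =
       (F x - F (x - z)) - (F (x + z) - F x) by ring.
    by rewrite E E'; ring.
  rewrite normrM (gtr0_norm z0) expr2 mulrA ler_wpM2r ?(ltW z0) //.
  rewrite (le_trans (lipschitz1 _ _ ddFF FK)) // -mulrA mulrCA ler_wpM2l //.
  move: cI dI; rewrite !in_itv /= => /andP[? ?] /andP[? ?].
  by rewrite ler_norml; apply/andP; split; lra.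
have d0 : 0 < 1 + z ^+ 2 by rewrite ltr_pwDl ?ltr01 ?sqr_ge0.
rewrite mulrA ler_pdivlMr //.
have z2 := sqr_ge0 z.
have [z1|z1] := leP (z ^+ 2) 1.
  have : `|sdiff F x z| * (1 + z ^+ 2) <= 2 * K * z ^+ 2 * (1 + z ^+ 2).
    by rewrite ler_wpM2r // ltW.
  move=> h; apply: (le_trans h); move: (z ^+ 2) z1 z2 => s s1 s0.
  have := mulr_ge0 (mulr_ge0 K0 s0) (_ : 0 <= 1 - s); rewrite subr_ge0 => /(_ s1).
  by have := mulr_ge0 M0 s0; nra.
have : `|sdiff F x z| * (1 + z ^+ 2) <= 4 * M * (1 + z ^+ 2).
  by rewrite ler_wpM2r // ltW.
move=> h; apply: (le_trans h); move: (z ^+ 2) z1 z2 => s s1 s0.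
have := mulr_ge0 M0 (_ : 0 <= s - 1); rewrite subr_ge0 => /(_ (ltW s1)).
by have := mulr_ge0 K0 s0; nra.
Qed.

Definition test phi := smooth phi /\ C11b phi.

Lemma smooth_differentiable phi p : smooth phi -> differentiable phi p.
Proof. by move=> sphi; exact: (sphi [::] p). Qed.

Lemma smooth_derive phi v : smooth phi -> smooth ('D_v phi).
Proof.
move=> sphi vs p; have := sphi (rcons vs v) p.
by rewrite -cats1 foldr_cat.
Qed.

Lemma is_derive_x phi (t y : R) : differentiable phi (t, y) ->
  is_derive y 1 (fun x : R => phi (t, x)) ('D_(0, 1) phi (t, y)).
Proof.
move=> df; have E (k : R) : k *: ((0, 1) : R * R) + (t, 0) = (t, k).
  by congr (_, _); rewrite /= /GRing.scale /= ?mulr0 ?mulr1 ?add0r ?addr0.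
have := @is_derive_line phi (t, 0) (0, 1) y; rewrite E => /(_ df).
by under eq_fun do rewrite E.
Qed.

Lemma is_derive_t phi (t y : R) : differentiable phi (t, y) ->
  is_derive t 1 (fun s : R => phi (s, y)) ('D_(1, 0) phi (t, y)).
Proof.
move=> df; have E (k : R) : k *: ((1, 0) : R * R) + (0, y) = (k, y).
  by congr (_, _); rewrite /= /GRing.scale /= ?mulr0 ?mulr1 ?add0r ?addr0.
have := @is_derive_line phi (0, y) (1, 0) t; rewrite E => /(_ df).
by under eq_fun do rewrite E.
Qed.

Lemma lipschitz_plane psi (C : R) : (forall p, differentiable psi p) ->
    (forall p, `|'D_(1, 0) psi p| <= C) -> (forall p, `|'D_(0, 1) psi p| <= C) ->
  forall p q, `|psi p - psi q| <= C * (`|p.1 - q.1| + `|p.2 - q.2|).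
Proof.
move=> df C1 C2 [t x] [s y] /=.
have -> : psi (t, x) - psi (s, y) = (psi (t, x) - psi (s, x)) + (psi (s, x) - psi (s, y)) by ring.
rewrite (le_trans (ler_normD _ _)) // mulrDr lerD //.
  by apply: (@lipschitz1 (fun t => psi (t, x)) (fun t => 'D_(1, 0) psi (t, x))) => // u;
    exact: is_derive_t.
by apply: (@lipschitz1 (fun x => psi (s, x)) (fun x => 'D_(0, 1) psi (s, x))) => // u;
  exact: is_derive_x.
Qed.

(** What the continuity of the operator at moving points uses, gathered under one constant. *)
Definition test_bound phi (C : R) : Prop :=
  [/\ forall p, `|phi p| <= C, forall p, `|'D_(1, 0) phi p| <= C,
      forall p, `|'D_(0, 1) phi p| <= C,
      forall v, v = (1, 0) \/ v = (0, 1) -> forall p q,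
        `|'D_v phi p - 'D_v phi q| <= C * (`|p.1 - q.1| + `|p.2 - q.2|)
    & forall t x z, `|sdiff (fun y => phi (t, y)) x z| <= C * (z ^+ 2 / (1 + z ^+ 2))].

Lemma test_bounded phi : test phi -> exists2 C : R, 0 <= C & test_bound phi C.
Proof.
move=> [sphi [/bounded_onP[M HM] H2]].
have /bounded_onP[Ktt Htt] := H2 (1, 0) (1, 0).
have /bounded_onP[Ktx Htx] := H2 (1, 0) (0, 1).
have /bounded_onP[Kxt Hxt] := H2 (0, 1) (1, 0).
have /bounded_onP[Kxx Hxx] := H2 (0, 1) (0, 1).
have M0 := le_trans (normr_ge0 _) (HM 0 I).
have Ktt0 := le_trans (normr_ge0 _) (Htt 0 I).
have Ktx0 := le_trans (normr_ge0 _) (Htx 0 I).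
have Kxt0 := le_trans (normr_ge0 _) (Hxt 0 I).
have Kxx0 := le_trans (normr_ge0 _) (Hxx 0 I).
have st := smooth_derive (1, 0) sphi; have sx := smooth_derive (0, 1) sphi.
set C := 8 * M + 4 * (Ktt + Ktx + Kxt + Kxx).
have KC (K a b : R) : K <= C -> 0 <= a -> b <= K * a -> b <= C * a.
  by move=> KC a0 ba; apply: le_trans ba _; exact: ler_wpM2r.
have C0 : 0 <= C by rewrite /C; lra.
exists C => //; split.
- by move=> p; rewrite (le_trans (HM p I)) // /C; lra.
- move=> [t x]; have h : `|'D_(1, 0) phi (t, x)| <= 2 * M + Ktt.
    apply: (@landau1 (fun t => phi (t, x)) (fun t => 'D_(1, 0) phi (t, x))
      (fun t => 'D_(1, 0) ('D_(1, 0) phi) (t, x))) => y; [| |exact: HM|exact: Htt];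
     by apply: is_derive_t; exact: smooth_differentiable.
  by apply: (le_trans h); rewrite /C; lra.
- move=> [t x]; have h : `|'D_(0, 1) phi (t, x)| <= 2 * M + Kxx.
    apply: (@landau1 (fun x => phi (t, x)) (fun x => 'D_(0, 1) phi (t, x))
      (fun x => 'D_(0, 1) ('D_(0, 1) phi) (t, x))) => y; [| |exact: HM|exact: Hxx];
     by apply: is_derive_x; exact: smooth_differentiable.
  by apply: (le_trans h); rewrite /C; lra.
- have dt r : differentiable ('D_(1, 0) phi) r by exact: smooth_differentiable.
  have dx r : differentiable ('D_(0, 1) phi) r by exact: smooth_differentiable.
  have tC (v w : R * R) K : (forall p, setT p -> `|'D_v ('D_w phi) p| <= K) -> K <= C ->
      forall p, `|'D_v ('D_w phi) p| <= C.
    by move=> H KC' p; exact: (le_trans (H p I) KC').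
  move=> v [] -> p q; [apply: (lipschitz_plane dt)|apply: (lipschitz_plane dx)].
  + by apply: (tC _ _ _ Htt); rewrite /C; lra.
  + by apply: (tC _ _ _ Hxt); rewrite /C; lra.
  + by apply: (tC _ _ _ Htx); rewrite /C; lra.
  + by apply: (tC _ _ _ Hxx); rewrite /C; lra.
- move=> t x z; apply: (KC (8 * M + 4 * Kxx)).
  + by rewrite /C; lra.
  + by rewrite mulr_ge0 ?invr_ge0 ?addr_ge0 ?sqr_ge0.
  + apply: (@sdiff_bound (fun x => phi (t, x)) (fun x => 'D_(0, 1) phi (t, x))
      (fun x => 'D_(0, 1) ('D_(0, 1) phi) (t, x)) M Kxx) => y; [| |exact: HM|exact: Hxx];
     by apply: is_derive_x; exact: smooth_differentiable.
Qed.

Lemma test_continuous phi : test phi -> continuous phi.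
Proof.
by move=> [sphi _] p; apply: differentiable_continuous; exact: smooth_differentiable.
Qed.

Lemma test_Hregular phi t x : test phi -> Hregular (fun y => phi (t, y)) x.
Proof.
move=> tphi; have [C C0 [CM _ _ _ CS]] := test_bounded tphi; split.
- move=> y; have := @is_derive_x phi t y (smooth_differentiable _ tphi.1).
  by case=> d _; apply: differentiable_continuous; apply/derivable1_diffP.
- by exists C.
- by exists C => z; exact: CS.
Qed.

(** [smooth] speaks of all iterated derivatives, so closure of the test functions under an operation
    needs the iterated derivative of the result in closed form. Multiples, reflections and
    translations follow the same pattern. *)
Lemma foldr_deriveD phi psi (vs : seq (R * R)) : smooth phi -> smooth psi ->
  foldr (fun v g => 'D_v g) (fun p => phi p + psi p) vs =
  (fun p => foldr (fun v g => 'D_v g) phi vs p + foldr (fun v g => 'D_v g) psi vs p).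
Proof.
move=> sphi spsi; elim: vs => [//|v vs /= ->].
by apply/funext => p; rewrite deriveD //; apply: diff_derivable.
Qed.

Lemma foldr_deriveZ c phi (vs : seq (R * R)) : smooth phi ->
  foldr (fun v g => 'D_v g) (fun p => c * phi p) vs =
  (fun p => c * foldr (fun v g => 'D_v g) phi vs p).
Proof.
move=> sphi; elim: vs => [//|v vs /= ->].
by apply/funext => p; rewrite (@deriveZ _ _ _ _ c) //; apply: diff_derivable.
Qed.

Lemma testD phi psi : test phi -> test psi -> test (fun p => phi p + psi p).
Proof.
move=> [sphi [/bounded_onP[M HM] Bphi]] [spsi [/bounded_onP[N HN] Bpsi]].
have E := foldr_deriveD _ sphi spsi; split; [|split].
- by move=> vs p; rewrite E; apply: differentiableD; [exact: sphi|exact: spsi].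
- apply/bounded_onP; exists (M + N) => p _.
  by apply: (le_trans (ler_normD _ _)); apply: lerD; [exact: HM|exact: HN].
- move=> v w; have /bounded_onP[K HK] := Bphi v w; have /bounded_onP[L HL] := Bpsi v w.
  apply/bounded_onP; exists (K + L) => p _.
  have /(congr1 (@^~ p)) /= -> := E [:: v; w].
  by apply: (le_trans (ler_normD _ _)); apply: lerD; [exact: HK|exact: HL].
Qed.

Lemma testZ c phi : test phi -> test (fun p => c * phi p).
Proof.
move=> [sphi [/bounded_onP[M HM] Bphi]].
have E := @foldr_deriveZ c phi ^~ sphi; split; [|split].
- by move=> vs p; rewrite E; apply: differentiableZ; exact: sphi.
- apply/bounded_onP; exists (`|c| * M) => p _.
  by rewrite normrM; apply: ler_wpM2l; [exact: normr_ge0|exact: HM].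
- move=> v w; have /bounded_onP[K HK] := Bphi v w.
  apply/bounded_onP; exists (`|c| * K) => p _.
  have /(congr1 (@^~ p)) /= -> := E [:: v; w].
  by rewrite normrM; apply: ler_wpM2l; [exact: normr_ge0|exact: HK].
Qed.

End test_functions.

(** * An algebra of bounded test functions stable under derivation *)

Section test_algebra.
Variable R : realType.
Implicit Types (f g phi psi : R * R -> R) (p q v w : R * R).

Lemma differentiable_fst p : differentiable (fst : R * R -> R) p.
Proof. by apply: linear_differentiable => q; exact: cvg_fst. Qed.

Lemma differentiable_snd p : differentiable (snd : R * R -> R) p.
Proof. by apply: linear_differentiable => q; exact: cvg_snd. Qed.

Definition affine (a b c : R) (p : R * R) : R := a * p.1 + b * p.2 + c.

Lemma differentiable_affine a b c p : differentiable (affine a b c) p.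
Proof.
apply: differentiableD; last exact: differentiable_cst.
apply: differentiableD; apply: differentiableZ.
  exact: differentiable_fst.
exact: differentiable_snd.
Qed.

Lemma affine_line a b c p v (h : R) :
  affine a b c (h *: v + p) = h * (a * v.1 + b * v.2) + affine a b c p.
Proof. by rewrite /affine /= /GRing.scale /=; ring. Qed.

Lemma derive_affine (g : R -> R) (dg : R) a b c p v :
    is_derive (affine a b c p) 1 g dg ->
  'D_v (fun q => g (affine a b c q)) p = (a * v.1 + b * v.2) * dg.
Proof.
move=> [/derivable1_diffP dfg <-].
transitivity ('D_(a * v.1 + b * v.2) g (affine a b c p)).
  by rewrite /derive; congr lim; under eq_fun => h do rewrite /= affine_line.
rewrite !deriveE //.
by rewrite -[X in 'd _ _ X = _]mulr1 [X in 'd _ _ X = _](_ : _ = (a * v.1 + b * v.2) *: 1) // linearZ.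
Qed.

Lemma differentiable_comp_affine (g : R -> R) (dg : R) a b c p :
    is_derive (affine a b c p) 1 g dg ->
  differentiable (fun q => g (affine a b c q)) p.
Proof.
move=> [/derivable1_diffP dfg _].
by apply: (differentiable_comp (differentiable_affine a b c p)).
Qed.

Definition lorentz (y : R) : R := (1 + y ^+ 2)^-1.
Definition odd_lorentz (y : R) : R := y * lorentz y.
Definition sigmoid (y : R) : R := (1 + expR y)^-1.

Lemma lorentz_den (y : R) : 0 < 1 + y ^+ 2.
Proof. by rewrite ltr_pwDl ?ltr01 ?sqr_ge0. Qed.

Lemma is_derive_lorentz (y : R) :
  is_derive y 1 lorentz (- 2 * (lorentz y * odd_lorentz y)).
Proof.
have n0 := lorentz_den y.
have h : is_derive y 1 (fun y : R => 1 + y ^+ 2) (2 * y).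
  have -> : (fun y : R => 1 + y ^+ 2) = (cst 1 + id * id) by apply/funext => z; rewrite expr2.
  have h1 := is_deriveM (is_derive_id y (1 : R)) (is_derive_id y (1 : R)).
  have h2 := is_deriveD (is_derive_cst (1 : R) y (1 : R)) h1.
  apply: (is_derive_eq h2).
  by rewrite add0r /GRing.scale /= mulr1 mulr2n mulrDl !mul1r.
have := @is_deriveV R (fun y => 1 + y ^+ 2) y _ 1 (lt0r_neq0 n0) h.
move=> h3; apply: (is_derive_eq h3); rewrite /GRing.scale /= /odd_lorentz /lorentz.
by field; rewrite gt_eqF.
Qed.

Lemma is_derive_odd_lorentz (y : R) :
  is_derive y 1 odd_lorentz (lorentz y - 2 * (odd_lorentz y * odd_lorentz y)).
Proof.
have h3 := is_deriveM (is_derive_id y 1) (is_derive_lorentz y).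
apply: (is_derive_eq h3); rewrite /GRing.scale /= /odd_lorentz.
by ring.
Qed.

Lemma is_derive_sigmoid (y : R) :
  is_derive y 1 sigmoid (sigmoid y * sigmoid y - sigmoid y).
Proof.
have n0 : 0 < 1 + expR y by rewrite addr_gt0 ?expR_gt0.
have h2 := is_deriveD (is_derive_cst (1 : R) y (1 : R)) (is_derive_expR y).
have := @is_deriveV R (fun y => 1 + expR y) y _ 1 (lt0r_neq0 n0) h2.
move=> h3; apply: (is_derive_eq h3); rewrite /GRing.scale /= /sigmoid.
by field; rewrite gt_eqF.
Qed.

(** The derivative of each generator is a polynomial in the generators, so the class is closed under
    derivation and its members are test functions by an induction that involves no estimate on
    derivatives. [odd_lorentz] closes the family under derivation; [sigmoid], decreasing from 1 to
    0, provides smooth steps. *)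
Inductive balg : (R * R -> R) -> Prop :=
| balg_cst k : balg (fun=> k)
| balgD f g : balg f -> balg g -> balg (fun p => f p + g p)
| balgM f g : balg f -> balg g -> balg (fun p => f p * g p)
| balg_lorentz a b c : balg (fun p => lorentz (affine a b c p))
| balg_odd_lorentz a b c : balg (fun p => odd_lorentz (affine a b c p))
| balg_sigmoid a b c : balg (fun p => sigmoid (affine a b c p)).

Lemma lorentz_ge0 (y : R) : 0 <= lorentz y.
Proof. by rewrite invr_ge0 ltW // lorentz_den. Qed.

Lemma lorentz_le1 (y : R) : lorentz y <= 1.
Proof. by rewrite invf_le1 ?lorentz_den // lerDl sqr_ge0. Qed.

Lemma odd_lorentz_le1 (y : R) : `|odd_lorentz y| <= 1.
Proof.
rewrite normrM (ger0_norm (lorentz_ge0 y)) ler_pdivrMr ?lorentz_den // mul1r.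
by rewrite -real_normK ?num_real //; have := sqr_ge0 (`|y| - 1); nra.
Qed.

Lemma sigmoid_ge0 (y : R) : 0 <= sigmoid y.
Proof. by rewrite invr_ge0 ltW // addr_gt0 ?expR_gt0. Qed.

Lemma sigmoid_le1 (y : R) : sigmoid y <= 1.
Proof. by rewrite invf_le1 ?addr_gt0 ?expR_gt0 // lerDl expR_ge0. Qed.

Lemma balg_bounded f : balg f -> exists M : R, forall p, `|f p| <= M.
Proof.
elim=> [k|g h _ [M HM] _ [N HN]|g h _ [M HM] _ [N HN]|a b c|a b c|a b c].
- by exists `|k|.
- by exists (M + N) => p; rewrite (le_trans (ler_normD _ _)) // lerD.
- by exists (M * N) => p; rewrite normrM ler_pM.
- by exists 1 => p; rewrite ger0_norm ?lorentz_ge0 ?lorentz_le1.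
- by exists 1 => p; rewrite odd_lorentz_le1.
- by exists 1 => p; rewrite ger0_norm ?sigmoid_ge0 ?sigmoid_le1.
Qed.

Lemma balg_differentiable f : balg f -> forall p, differentiable f p.
Proof.
elim=> [k p|g h _ dg _ dh p|g h _ dg _ dh p|a b c p|a b c p|a b c p].
- exact: differentiable_cst.
- exact: differentiableD.
- exact: differentiableM.
- exact: differentiable_comp_affine (is_derive_lorentz _).
- exact: differentiable_comp_affine (is_derive_odd_lorentz _).
- exact: differentiable_comp_affine (is_derive_sigmoid _).
Qed.

Lemma balgZ k f : balg f -> balg (fun p => k * f p).
Proof. by move=> bf; apply: balgM => //; exact: balg_cst. Qed.

Lemma balgB f g : balg f -> balg g -> balg (fun p => f p - g p).
Proof.
move=> bf bg; have -> : (fun p => f p - g p) = (fun p => f p + (-1) * g p).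
  by apply/funext => p; rewrite mulN1r.
by apply: balgD => //; exact: balgZ.
Qed.

Lemma balg_derive f v : balg f -> balg ('D_v f).
Proof.
elim=> [k|g h bg dg bh dh|g h bg dg bh dh|a b c|a b c|a b c].
- have -> : 'D_v (fun=> k) = (fun=> 0) :> (R * R -> R) by apply/funext => p; rewrite derive_cst.
  exact: balg_cst.
- have -> : 'D_v (fun p => g p + h p) = (fun p => 'D_v g p + 'D_v h p).
    by apply/funext => p; rewrite deriveD //; apply: diff_derivable; exact: balg_differentiable.
  exact: balgD.
- have -> : 'D_v (fun p => g p * h p) = (fun p => g p * 'D_v h p + h p * 'D_v g p).
    by apply/funext => p; rewrite deriveM //; apply: diff_derivable; exact: balg_differentiable.
  by apply: balgD; apply: balgM.
- have -> : 'D_v (fun p => lorentz (affine a b c p)) = (fun p => (a * v.1 + b * v.2) *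
     (- 2 * (lorentz (affine a b c p) * odd_lorentz (affine a b c p)))).
    by apply/funext => p; exact: derive_affine (is_derive_lorentz _).
  by do 2 apply: balgZ; apply: balgM; [exact: balg_lorentz|exact: balg_odd_lorentz].
- have -> : 'D_v (fun p => odd_lorentz (affine a b c p)) = (fun p => (a * v.1 + b * v.2) *
     (lorentz (affine a b c p) - 2 * (odd_lorentz (affine a b c p) * odd_lorentz (affine a b c p)))).
    by apply/funext => p; exact: derive_affine (is_derive_odd_lorentz _).
  apply: balgZ; apply: balgB; first exact: balg_lorentz.
  by apply: balgZ; apply: balgM; exact: balg_odd_lorentz.
- have -> : 'D_v (fun p => sigmoid (affine a b c p)) = (fun p => (a * v.1 + b * v.2) *
     (sigmoid (affine a b c p) * sigmoid (affine a b c p) - sigmoid (affine a b c p))).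
    by apply/funext => p; exact: derive_affine (is_derive_sigmoid _).
  by apply: balgZ; apply: balgB; [apply: balgM|]; exact: balg_sigmoid.
Qed.

Lemma balg_test f : balg f -> test f.
Proof.
move=> bf.
have bD (vs : seq (R * R)) : balg (foldr (fun v g => 'D_v g) f vs).
  by elim: vs => [//|v vs IH] /=; exact: balg_derive.
split; [|split].
- by move=> vs p; exact: balg_differentiable.
- by apply/bounded_onP; have [M HM] := balg_bounded bf; exists M => p _.
- move=> v w; apply/bounded_onP; have [M HM] := balg_bounded (bD [:: v; w]).
  by exists M => p _; exact: HM.
Qed.

(** Composed with a change of sign, this reflection keeps the sign of the space derivative and
    reverses those of the time derivative and of the nonlocal term. It therefore exchanges sub- and
    supersolutions. *)
Definition reflx (p : R * R) : R * R := (p.1, - p.2).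

Lemma differentiable_reflx p : differentiable reflx p.
Proof.
apply: differentiable_pair; first exact: differentiable_fst.
by apply: differentiableN; exact: differentiable_snd.
Qed.

Lemma derive_reflx f v p : (forall q, differentiable f q) ->
  'D_v (fun q => - f (reflx q)) p = - 'D_(reflx v) f (reflx p).
Proof.
move=> df; rewrite deriveN; last first.
  by apply: diff_derivable; apply: (differentiable_comp (differentiable_reflx p)).
congr (- _); rewrite /derive; congr lim.
have E (h : R) : reflx (h *: v + p) = h *: reflx v + reflx p.
  rewrite /reflx /=; congr (_, _); rewrite opprD; congr (_ + _); exact: (esym (mulrN _ _)).
by under eq_fun => h do rewrite /= E.
Qed.

Lemma foldr_derive_reflx f (vs : seq (R * R)) : smooth f ->
  foldr (fun v g => 'D_v g) (fun q => - f (reflx q)) vs =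
  (fun q => - foldr (fun v g => 'D_v g) f (map reflx vs) (reflx q)).
Proof.
move=> sf; elim: vs => [//|v vs /= ->].
by apply/funext => p; rewrite derive_reflx //; exact: sf.
Qed.

Lemma test_reflx f : test f -> test (fun q => - f (reflx q)).
Proof.
move=> [sf [/bounded_onP[M HM] Bf]]; have E := foldr_derive_reflx _ sf.
split; [|split].
- move=> vs p; rewrite E; apply: differentiableN.
  by apply: (differentiable_comp (differentiable_reflx p)); exact: sf.
- by apply/bounded_onP; exists M => p _; rewrite normrN; exact: HM.
- move=> v w; have /bounded_onP[K HK] := Bf (reflx v) (reflx w).
  apply/bounded_onP; exists K => p _.
  by have /(congr1 (@^~ p)) /= -> := E [:: v; w]; rewrite normrN; exact: HK.
Qed.


End test_algebra.

(** * Touching, perturbation and continuity of the operator *)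

Section operator.
Variable R : realType.
Implicit Types (f g phi psi : R * R -> R) (p q v w : R * R).

Lemma derive_eq_at_max phi psi p : (forall q, differentiable phi q) ->
    (forall q, differentiable psi q) -> 0 < p.1 ->
    (forall q, halfplane q -> phi q - psi q <= phi p - psi p) ->
  'D_(1, 0) phi p = 'D_(1, 0) psi p /\ 'D_(0, 1) phi p = 'D_(0, 1) psi p.
Proof.
case: p => t x dphi dpsi /= t0 H.
have h1 (s : R) := is_deriveB (is_derive_t (dphi (s, x))) (is_derive_t (dpsi (s, x))).
have h2 (y : R) := is_deriveB (is_derive_x (dphi (t, y))) (is_derive_x (dpsi (t, y))).
split.
(* The interval []0, 2 * t[] is centred at [t] and stays in the half-plane. *)
- have := @derive1_at_max R ((fun s => phi (s, x)) - (fun s => psi (s, x))) 0 (2 * t) t.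
  case.
  + by lra.
  + by move=> s _; case: (h1 s).
  + by rewrite in_itv /=; apply/andP; split; lra.
  + move=> s; rewrite in_itv /= => /andP[s0 _]; apply: (H (s, x)).
    by rewrite /halfplane /= ltW.
  + by move=> _; case: (h1 t) => _ -> /eqP; rewrite subr_eq0 => /eqP.
- have := @derive1_at_max R ((fun y => phi (t, y)) - (fun y => psi (t, y))) (x - 1) (x + 1) x.
  case.
  + by lra.
  + by move=> s _; case: (h2 s).
  + by rewrite in_itv /=; apply/andP; split; lra.
  + by move=> y _; apply: (H (t, y)); rewrite /halfplane /= ltW.
  + by move=> _; case: (h2 x) => _ -> /eqP; rewrite subr_eq0 => /eqP.
Qed.

Lemma Htilde_dist_le (F G : R -> R) (x y K L r : R) : Hregular F x -> Hregular G y ->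
    0 < r -> 0 <= K -> 0 <= L ->
    (forall z, 0 < z -> `|sdiff F x z - sdiff G y z| <=
       K * (z ^+ 2 / (r ^+ 2 + z ^+ 2)) + L * (z ^+ 2 / (1 ^+ 2 + z ^+ 2))) ->
  `|Htilde F x - Htilde G y| <= K * kint r + L * kint 1.
Proof.
move=> hF hG r0 K0 L0 H.
have h1 := Htilde_le hF hG r0 ltr01 K0 L0.
have h2 := Htilde_le hG hF r0 ltr01 K0 L0.
move: (Htilde F x) (Htilde G y) (kint r) (kint 1) h1 h2 => a b c d h1 h2.
rewrite ler_norml; apply/andP; split.
  rewrite lerNl; suff : b <= a + K * c + L * d by lra.
  by apply: h2 => z z0; have := H z z0; rewrite ler_norml => /andP[]; lra.
suff : a <= b + K * c + L * d by lra.
by apply: h1 => z z0; have := H z z0; rewrite ler_norml => /andP[]; lra.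
Qed.

Lemma Htilde_mono (F G : R -> R) (x y : R) : Hregular F x -> Hregular G y ->
    (forall z, 0 < z -> sdiff F x z <= sdiff G y z) -> Htilde F x <= Htilde G y.
Proof.
move=> hF hG H.
have := Htilde_le hF hG ltr01 ltr01 (lexx 0) (lexx 0); rewrite !mul0r !addr0; apply => z z0.
by rewrite !mul0r !addr0; exact: H.
Qed.

(** At a point of contact the first derivatives agree and the second differences are ordered.
    Because the coefficient is a positive part, the order passes to the operator: this is the
    ellipticity of the equation. *)
Lemma operatorE_touch phi psi p : test phi -> test psi -> 0 < p.1 ->
    (forall q, halfplane q -> phi q - psi q <= phi p - psi p) ->
  operatorE psi p <= operatorE phi p.
Proof.
move=> tphi tpsi p0 H.
have [Et Ex] := derive_eq_at_max (fun q => smooth_differentiable q tphi.1)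
   (fun q => smooth_differentiable q tpsi.1) p0 H.
rewrite /operatorE Et Ex lerD2l; apply: ler_wpM2l.
  by rewrite le_max lexx orbT.
apply: Htilde_mono => [||z z0]; try exact: test_Hregular.
have hp y : halfplane (p.1, y) by rewrite /halfplane /= ltW.
have := H (p.1, p.2 + z) (hp _); have := H (p.1, p.2 - z) (hp _).
by case: (p) => t x /=; rewrite /sdiff; clear; lra.
Qed.

(** The profile [q] of the overview, in a form that lies in the algebra [balg]. *)
Definition bump (y : R) : R := 1 - lorentz y.

Lemma bumpE (y : R) : bump y = y ^+ 2 / (1 + y ^+ 2).
Proof. by rewrite /bump /lorentz; field; rewrite gt_eqF ?lorentz_den. Qed.

Lemma bump_ge0 (y : R) : 0 <= bump y.
Proof. by rewrite subr_ge0 lorentz_le1. Qed.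

Lemma bump_le1 (y : R) : bump y <= 1.
Proof. by rewrite /bump; have := lorentz_ge0 y; lra. Qed.

Lemma bump0 : bump 0 = 0.
Proof. by rewrite bumpE expr0n /= mul0r. Qed.

Lemma bump_gt0 (y : R) : y != 0 -> 0 < bump y.
Proof. by move=> y0; rewrite bumpE divr_gt0 ?lorentz_den // exprn_even_gt0. Qed.

Lemma balg_bump a b c : balg (fun p : R * R => bump (affine a b c p)).
Proof. by apply: balgB; [exact: balg_cst|exact: balg_lorentz]. Qed.

Definition pen (o p : R * R) : R := bump (p.1 - o.1) + bump (p.2 - o.2).

Lemma balg_pen o : balg (pen o).
Proof.
have -> : pen o = (fun p => bump (affine 1 0 (- o.1) p) + bump (affine 0 1 (- o.2) p)).
  by apply/funext => p; rewrite /pen /affine; congr (bump _ + bump _); ring.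
by apply: balgD; exact: balg_bump.
Qed.

Lemma test_pen o : test (pen o).
Proof. exact: balg_test (balg_pen o). Qed.

Lemma pen0 o : pen o o = 0.
Proof. by rewrite /pen !subrr bump0 addr0. Qed.

Lemma pen_gt0 o p : p != o -> 0 < pen o p.
Proof.
case: p o => [t x] [s y]; rewrite xpair_eqE negb_and /pen /= => /orP[H|H].
  by rewrite ltr_pwDl ?bump_ge0 // bump_gt0 // subr_eq0.
by rewrite ltr_wpDl ?bump_ge0 // bump_gt0 // subr_eq0.
Qed.

Definition perturb phi (gamma : R) (o p : R * R) : R := phi p + gamma * pen o p.

Lemma test_perturb phi gamma o : test phi -> test (perturb phi gamma o).
Proof. by move=> tphi; exact: (testD tphi (testZ gamma (test_pen o))). Qed.

Lemma derive_perturb phi gamma o v p : test phi ->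
  'D_v (perturb phi gamma o) p = 'D_v phi p + gamma * 'D_v (pen o) p.
Proof.
move=> tphi; have tp := testZ gamma (test_pen o).
have d1 := diff_derivable (v := v) (smooth_differentiable p tphi.1).
have d2 := diff_derivable (v := v) (smooth_differentiable p tp.1).
have d3 := diff_derivable (v := v) (smooth_differentiable p (test_pen o).1).
by rewrite (deriveD d1 d2) (deriveZ gamma d3).
Qed.

Lemma kernel_frac_ge (r z : R) : 0 < r -> r <= z -> 1 <= 2 * (z ^+ 2 / (r ^+ 2 + z ^+ 2)).
Proof.
move=> r0 rz; have z0 : 0 < z by lra.
have d0 : 0 < r ^+ 2 + z ^+ 2 by rewrite ltr_pwDl ?exprn_gt0 ?sqr_ge0.
rewrite mulrA ler_pdivlMr //.
have : r ^+ 2 <= z ^+ 2 by rewrite ler_sqr ?nnegrE; lra.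
by lra.
Qed.

Lemma kernel_frac_le (r z : R) : 0 < r -> z <= r -> 0 < z ->
  z ^+ 2 <= 2 * r ^+ 2 * (z ^+ 2 / (r ^+ 2 + z ^+ 2)).
Proof.
move=> r0 zr z0.
have d0 : 0 < r ^+ 2 + z ^+ 2 by rewrite ltr_pwDl ?exprn_gt0 ?sqr_ge0.
rewrite mulrA ler_pdivlMr //.
have : z ^+ 2 <= r ^+ 2 by rewrite ler_sqr ?nnegrE; lra.
by rewrite -subr_ge0 => /(mulr_ge0 (sqr_ge0 z)); lra.
Qed.

(* Moving the base point by [rho] changes the second difference by [O(rho)] and by
   [O(z^2)]; with [rho = r^2] both are [O(r^2)] times [z^2 / (r^2 + z^2)]. *)
Lemma sdiff_near phi C : test_bound phi C -> 0 <= C ->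
  (forall p q, `|phi p - phi q| <= C * (`|p.1 - q.1| + `|p.2 - q.2|)) ->
  forall r p q z, 0 < r -> 0 < z ->
    `|p.1 - q.1| <= r ^+ 2 -> `|p.2 - q.2| <= r ^+ 2 ->
  `|sdiff (fun y => phi (p.1, y)) p.2 z - sdiff (fun y => phi (q.1, y)) q.2 z| <=
    16 * C * r ^+ 2 * (z ^+ 2 / (r ^+ 2 + z ^+ 2)).
Proof.
move=> [_ _ _ _ CS] C0 CL r p q z r0 z0 h1 h2.
have [rz|zr] := leP r z.
  have L a b : `|a - b| = `|p.2 - q.2| -> `|phi (p.1, a) - phi (q.1, b)| <= C * (2 * r ^+ 2).
    move=> E; apply: le_trans (CL _ _) _; apply: ler_wpM2l => //=.
    by rewrite E; lra.
  have /ler_normlP[a1 a2] := L p.2 q.2 erefl.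
  have /ler_normlP[b1 b2] : `|phi (p.1, p.2 + z) - phi (q.1, q.2 + z)| <= C * (2 * r ^+ 2).
    by apply: L; congr (`|_|); ring.
  have /ler_normlP[c1 c2] : `|phi (p.1, p.2 - z) - phi (q.1, q.2 - z)| <= C * (2 * r ^+ 2).
    by apply: L; congr (`|_|); ring.
  have K : `|sdiff (fun y => phi (p.1, y)) p.2 z - sdiff (fun y => phi (q.1, y)) q.2 z|
      <= 8 * C * r ^+ 2.
    by rewrite /sdiff ler_norml; apply/andP; split; lra.
  apply: (le_trans K).
  have := kernel_frac_ge r0 rz; have : 0 <= 8 * C * r ^+ 2 by apply: mulr_ge0; [apply: mulr_ge0|exact: sqr_ge0].
  by move=> A0 k; have := ler_wpM2l A0 k; lra.
have SP (o : R * R) : `|sdiff (fun y => phi (o.1, y)) o.2 z| <= C * z ^+ 2.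
  apply: le_trans (CS _ _ _) _; apply: ler_wpM2l => //.
  by rewrite ler_pdivrMr ?lorentz_den // ler_peMr ?sqr_ge0 // lerDl sqr_ge0.
apply: le_trans (ler_normB _ _) _.
have := kernel_frac_le r0 (ltW zr) z0 => k.
have := ler_wpM2l C0 k; have := SP p; have := SP q.
have : 0 <= C * (r ^+ 2 * (z ^+ 2 / (r ^+ 2 + z ^+ 2))).
  apply: mulr_ge0 => //; apply: mulr_ge0; first exact: sqr_ge0.
  by rewrite mulr_ge0 ?invr_ge0 ?addr_ge0 ?sqr_ge0.
by lra.
Qed.

Lemma maxr_dist (a b : R) : `|Num.max a 0 - Num.max b 0| <= `|a - b|.
Proof.
have [ha|ha] := leP a 0; have [hb|hb] := leP b 0; rewrite ?subrr ?normr0 ?normr_ge0 ?subr0 ?sub0r ?normrN //.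
- by rewrite (ler0_norm (x := a - b)) ?gtr0_norm //; lra.
- by rewrite (ger0_norm (x := a - b)) ?gtr0_norm //; lra.
Qed.

(** A displacement of size [r ^+ 2] changes the second difference by [O(r ^+ 2)] at width [r], hence
    the nonlocal term by [O(r)], the same order as a penalisation of size [r]. [A] depends on [phi]
    and [o] only, so viscosity inequalities pass to the limit along maximum points tending to
    [o]. *)
Lemma operatorE_near phi o : test phi -> exists2 A : R, 0 <= A &
  forall r gamma p, 0 < r -> r <= 1 -> `|gamma| <= r ->
    `|p.1 - o.1| <= r ^+ 2 -> `|p.2 - o.2| <= r ^+ 2 ->
  `|operatorE (perturb phi gamma o) p - operatorE phi o| <= A * r.
Proof.
move=> tphi.
have [C C0 bC] := test_bounded tphi; have [C' C'0 bC'] := test_bounded (test_pen o).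
have CL : forall p q, `|phi p - phi q| <= C * (`|p.1 - q.1| + `|p.2 - q.2|).
  have [_ c1 c2 _ _] := bC.
  by apply: lipschitz_plane => // p; exact: smooth_differentiable tphi.1.
have [_ c1 c2 c3 c4] := bC; have [_ d1 d2 _ d4] := bC'.
set H0 := Htilde (fun y => phi (o.1, y)) o.2.
set B := 2 * C + C'; set D := (16 * C + C') * (pi / 2).
have pi0 : 0 < pi / 2 :> R by rewrite divr_gt0 ?pi_gt0.
have B0 : 0 <= B by rewrite /B; lra.
have D0 : 0 <= D by rewrite /D mulr_ge0 ?(ltW pi0) //; lra.
exists (B + (B * (`|H0| + D) + C * D)).
  by rewrite addr_ge0 // addr_ge0 // mulr_ge0 // addr_ge0.
move=> r gamma p r0 r1 gr h1 h2.
have r2 : r ^+ 2 <= r by rewrite expr2 ler_piMr // ltW.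
have DD v : v = (1, 0) \/ v = (0, 1) -> `|'D_v (pen o) p| <= C' ->
    `|'D_v (perturb phi gamma o) p - 'D_v phi o| <= B * r.
  move=> hv hp; rewrite derive_perturb //.
  have -> : 'D_v phi p + gamma * 'D_v (pen o) p - 'D_v phi o =
     ('D_v phi p - 'D_v phi o) + gamma * 'D_v (pen o) p by ring.
  apply: le_trans (ler_normD _ _) _.
  have e1 : `|'D_v phi p - 'D_v phi o| <= C * (2 * r).
    by apply: le_trans (c3 v hv p o) _; apply: ler_wpM2l => //; lra.
  have e2 : `|gamma * 'D_v (pen o) p| <= r * C' by rewrite normrM; apply: ler_pM.
  by rewrite /B; lra.
have Dt := DD (1, 0) (or_introl erefl) (d1 p).
have Dx := DD (0, 1) (or_intror erefl) (d2 p).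
have HD : `|Htilde (fun y => perturb phi gamma o (p.1, y)) p.2 - H0| <= D * r.
  have hF := test_Hregular p.1 p.2 (test_perturb gamma o tphi).
  have hG := test_Hregular o.1 o.2 tphi.
  have K0 : 0 <= 16 * C * r ^+ 2 by apply: mulr_ge0; [apply: mulr_ge0|exact: sqr_ge0].
  have L0 : 0 <= `|gamma| * C' by rewrite mulr_ge0.
  apply: le_trans (Htilde_dist_le hF hG r0 K0 L0 _) _.
    move=> z z0.
    have -> : sdiff (fun y => perturb phi gamma o (p.1, y)) p.2 z =
        sdiff (fun y => phi (p.1, y)) p.2 z + gamma * sdiff (fun y => pen o (p.1, y)) p.2 z.
      by rewrite /sdiff /perturb /=; ring.
    rewrite addrAC; apply: le_trans (ler_normD _ _) _; apply: lerD.
      exact: sdiff_near.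
    rewrite normrM -mulrA expr1n; apply: ler_wpM2l => //; exact: d4.
  rewrite /kint invr1 mul1r.
  have -> : 16 * C * r ^+ 2 * (r^-1 * (pi / 2)) = 16 * C * (pi / 2) * r.
    by field; rewrite gt_eqF.
  have : `|gamma| * C' * (pi / 2) <= r * C' * (pi / 2).
    by apply: ler_wpM2r; [exact: ltW|exact: ler_wpM2r].
  by rewrite /D; clear; lra.
rewrite /operatorE.
set P := 'D_(0, 1) (perturb phi gamma o) p; set P0 := 'D_(0, 1) phi o.
set T := 'D_(1, 0) (perturb phi gamma o) p; set T0 := 'D_(1, 0) phi o.
set H := Htilde (fun y => perturb phi gamma o (p.1, y)) p.2.
rewrite -/H -/P -/T in Dt Dx HD; rewrite -/P0 -/T0 in Dt Dx.
have -> : T + Num.max P 0 * H - (T0 + Num.max P0 0 * H0) =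
  (T - T0) + ((Num.max P 0 - Num.max P0 0) * H + Num.max P0 0 * (H - H0)) by ring.
apply: le_trans (ler_normD _ _) _; rewrite [leRHS]mulrDl; apply: lerD; first exact: Dt.
apply: le_trans (ler_normD _ _) _; rewrite [leRHS]mulrDl; apply: lerD; rewrite normrM.
  have -> : B * (`|H0| + D) * r = (B * r) * (`|H0| + D) by ring.
  apply: ler_pM => //.
    exact: le_trans (maxr_dist _ _) Dx.
  have -> : H = H0 + (H - H0) by ring.
  apply: le_trans (ler_normD _ _) _; rewrite lerD2l; apply: le_trans HD _.
  by rewrite ler_piMr.
rewrite -mulrA; apply: ler_pM => //.
have : `|Num.max P0 0| <= `|P0|.
  by have := maxr_dist P0 0; rewrite maxxx !subr0.
by move=> h; apply: le_trans h (c2 o).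
Qed.

End operator.

(** * Semicontinuity and envelopes *)

Section semicontinuity.
Variable R : realType.

(** Over an arbitrary space, since doubling needs it on pairs of points. *)
Definition usc_on (T : topologicalType) (A : set T) (f : T -> R) : Prop :=
  forall x, A x -> forall a, f x < a -> \forall y \near x, A y -> f y < a.

Lemma usc_onP (F : R * R -> R) : usc F <-> usc_on (@halfplane R) F.
Proof.
split.
  move=> H x Ax a xa.
  have [|V nV VP] := H x (- a); first by rewrite lte_fin ltrN2.
  have {}nV : within (@halfplane R) (nbhs x) V by rewrite nbhs_subspace_in.
  by apply: filterS nV => y /VP; rewrite lte_fin ltrN2.
move=> H x a; rewrite lte_fin => xa.
have [Ax|nAx] := pselect (halfplane x); last first.
  (* Points off the half-plane are isolated in the subspace topology. *)
  exists [set x].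
    by change (nbhs_subspace (A := @halfplane R) x [set x]); rewrite -nbhs_subspace_out.
  by move=> y ->; rewrite lte_fin.
exists [set y | halfplane y /\ F y < - a].
  change (nbhs_subspace (A := @halfplane R) x [set y | halfplane y /\ F y < - a]).
  rewrite -nbhs_subspace_in // /within /=.
  have := H x Ax (- a); rewrite ltrNr => /(_ xa).
  by apply: filterS => y h Ay; split => //; exact: h.
by move=> y [_]; rewrite lte_fin ltrNr.
Qed.

Lemma lsc_usc (F : R * R -> R) : lsc F <-> usc (fun p => - F p).
Proof. by rewrite /lsc /usc; under [in X in _ <-> X]eq_fun do rewrite opprK. Qed.

Lemma near_boxP (p : R * R) (P : set (R * R)) :
  (\forall q \near p, P q) <->
  exists2 e : R, 0 < e & forall q, `|q.1 - p.1| < e -> `|q.2 - p.2| < e -> P q.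
Proof.
split.
  move=> /nbhs_ballP[e /= e0 H]; exists e => // q h1 h2; apply: H.
  by split => /=; rewrite /ball /= distrC.
move=> [e e0 H]; apply/nbhs_ballP; exists e => //= q [h1 h2]; apply: H.
  by rewrite distrC; exact: h1.
by rewrite distrC; exact: h2.
Qed.

Lemma usc_onD (T : topologicalType) (A : set T) (f g : T -> R) :
  usc_on A f -> usc_on A g -> usc_on A (fun x => f x + g x).
Proof.
move=> hf hg x Ax a xa.
set e := (a - (f x + g x)) / 2.
have e0 : 0 < e by rewrite /e; lra.
have h1 := hf x Ax (f x + e); have h2 := hg x Ax (g x + e).
near=> y => Ay.
have : f y < f x + e by move: Ay; near: y; apply: h1; lra.
have : g y < g x + e by move: Ay; near: y; apply: h2; lra.
by rewrite /e; lra.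
Unshelve. all: by end_near. Qed.

Lemma continuous_usc_on (T : topologicalType) (A : set T) (f : T -> R) :
  continuous f -> usc_on A f.
Proof.
move=> cf x Ax a xa; near=> y => _.
near: y; exact: (cf x _ (lt_nbhsl xa)).
Unshelve. all: by end_near. Qed.

Lemma usc_on_comp (S T : topologicalType) (A : set T) (B : set S) (f : T -> R) (h : S -> T) :
    continuous h -> (forall x, B x -> A (h x)) ->
  usc_on A f -> usc_on B (fun x => f (h x)).
Proof.
move=> ch BA hf x Bx a xa.
have N : \forall y \near x, A (h y) -> f (h y) < a := ch x _ (hf (h x) (BA x Bx) a xa).
by apply: filterS N => y H By; apply: H; exact: BA.
Qed.

Lemma usc_on_sub (T : topologicalType) (A B : set T) (f : T -> R) :
  B `<=` A -> usc_on A f -> usc_on B f.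
Proof.
move=> BA hf x Bx a xa.
by have N := hf x (BA x Bx) a xa; apply: filterS N => y H /BA.
Qed.

Lemma usc_on_max (T : topologicalType) (A : set T) (f g : T -> R) :
  usc_on A f -> usc_on A g -> usc_on A (fun x => Num.max (f x) (g x)).
Proof.
move=> hf hg x Ax a; rewrite gt_max => /andP[fa ga].
have h1 := hf x Ax a fa; have h2 := hg x Ax a ga.
by apply: filterS2 h1 h2 => y h1 h2 Ay; rewrite gt_max h1 // h2.
Qed.

(** Without a maximum, the superlevel sets [B c], nested because the values are totally ordered,
    generate a proper filter. Some [y0] has a larger value than its cluster point [x], and
    semicontinuity keeps a neighbourhood of [x] off the superlevel set of [y0]. *)
Lemma usc_on_compact_max (T : topologicalType) (A : set T) (f : T -> R) :
    compact A -> A !=set0 -> usc_on A f ->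
  exists2 c, A c & forall y, A y -> f y <= f c.
Proof.
move=> cA [x0 Ax0] hf; apply: contrapT => /forall2NP H.
have up c : A c -> exists2 y, A y & f c < f y.
  move=> Ac; have [//|] := H c.
  move=> /existsNP[y /not_implyP[Ay /negP]]; rewrite -ltNge => cy.
  by exists y.
pose B (c : T) := [set y | A y /\ f c <= f y].
have FF : ProperFilter (filter_from A B).
  apply: filter_from_proper; last by move=> c Ac; exists c; split.
  apply: filter_from_filter; first by exists x0.
  move=> c d Ac Ad; have [cd|dc] := leP (f c) (f d).
    by exists d => // y [Ay dy]; split; split => //; exact: le_trans cd dy.
  by exists c => // y [Ay cy]; split; split => //; apply: le_trans (ltW dc) cy.
have FA : filter_from A B A by exists x0 => // y [].
have [x [Ax cx]] := cA _ FF FA.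
have [y0 Ay0 xy0] := up x Ax.
have FB : filter_from A B (B y0) by exists y0.
have [y [[Ay y0y]]] := cx _ _ FB (hf x Ax (f y0) xy0).
by move=> /(_ Ay); rewrite ltNge y0y.
Qed.

Lemma compact_box (T L : R) : compact (`[0, T]%classic `*` `[- L, L]%classic : set (R * R)).
Proof. by apply: compact_setX; exact: segment_compact. Qed.

(** Only the superlevel set of one point has to be bounded, which is as much as saturating
    penalisations can provide. *)
Lemma usc_halfplane_max (f : R * R -> R) (p0 : R * R) (T L : R) :
    usc_on (@halfplane R) f -> halfplane p0 ->
    (forall q, halfplane q -> f p0 <= f q -> q.1 <= T /\ `|q.2| <= L) ->
  exists2 c, halfplane c & forall q, halfplane q -> f q <= f c.
Proof.
move=> hf hp0 H.
set A := (`[0, T]%classic `*` `[- L, L]%classic : set (R * R)).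
have AP q : halfplane q -> f p0 <= f q -> A q.
  move=> hq /(H _ hq)[h1 h2]; split => /=; rewrite in_itv /=.
    by apply/andP.
  by rewrite -ler_norml.
have Ah : A `<=` @halfplane R by move=> q [/=]; rewrite in_itv /= => /andP[].
have [c Ac cmax] := usc_on_compact_max (@compact_box T L)
  (ex_intro _ p0 (AP _ hp0 (lexx _))) (usc_on_sub Ah hf).
exists c; first exact: Ah.
move=> q hq; have [h|h] := leP (f p0) (f q); first exact/cmax/AP.
by apply: le_trans (ltW h) _; apply: cmax; exact: AP.
Qed.

Lemma usc_halfplane2_max (f : (R * R) * (R * R) -> R) (p0 : (R * R) * (R * R)) (T L : R) :
    usc_on (@halfplane R `*` @halfplane R) f -> halfplane p0.1 -> halfplane p0.2 ->
    (forall q, halfplane q.1 -> halfplane q.2 -> f p0 <= f q ->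
      [/\ q.1.1 <= T, `|q.1.2| <= L, q.2.1 <= T & `|q.2.2| <= L]) ->
  exists c, [/\ halfplane c.1, halfplane c.2 &
    forall q, halfplane q.1 -> halfplane q.2 -> f q <= f c].
Proof.
move=> hf hp0 hp0' H.
set A := (`[0, T]%classic `*` `[- L, L]%classic : set (R * R)).
have AP q : halfplane q.1 -> halfplane q.2 -> f p0 <= f q -> (A `*` A) q.
  move=> hq hq' /(H _ hq hq')[h1 h2 h3 h4].
  by split; split => /=; rewrite in_itv /= ?h1 ?h3 ?andbT // -ler_norml.
have Ah : A `<=` @halfplane R by move=> q [/=]; rewrite in_itv /= => /andP[].
have AAh : A `*` A `<=` @halfplane R `*` @halfplane R by move=> q [/Ah ? /Ah ?].
have cA : compact (A `*` A) by apply: compact_setX; exact: compact_box.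
have [c [Ac Ac'] cmax] := usc_on_compact_max cA
  (ex_intro _ p0 (AP _ hp0 hp0' (lexx _))) (usc_on_sub AAh hf).
exists c; split; [exact: Ah|exact: Ah|].
move=> q hq hq'; have [h|h] := leP (f p0) (f q); first exact/cmax/AP.
by apply: le_trans (ltW h) _; apply: cmax; exact: AP.
Qed.

(** * Lower semicontinuous envelopes of bounded functions *)

Definition bounded_by (M : R) (F : R * R -> R) : Prop :=
  forall p, halfplane p -> `|F p| <= M.

(** For a bounded function the extended limit inferior is finite, so [fine] discards nothing. *)
Lemma lower_env_fin (F : R * R -> R) (M : R) p : bounded_by M F -> halfplane p ->
  [/\ limf_einf (EFin \o F) (within (@halfplane R) (nbhs p)) = (lower_env F p)%:E,
      - M <= lower_env F p & lower_env F p <= F p].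
Proof.
move=> FM hp.
set L := limf_einf _ _.
have h1 : ((- M)%:E <= L)%E.
  rewrite /L limf_einfE; apply: ereal_sup_ge; exists (ereal_inf ((EFin \o F) @` @halfplane R)).
    by exists (@halfplane R) => //; apply: nearW.
  apply: le_ereal_inf_tmp => _ [q hq <-] /=; rewrite lee_fin.
  by have := FM q hq; rewrite ler_norml => /andP[].
have h2 : (L <= (F p)%:E)%E.
  rewrite /L limf_einfE; apply: ge_ereal_sup => _ [V hV <-].
  by apply: ereal_inf_lbound; exists p => //; exact: (nbhs_singleton hV).
have E : L = (lower_env F p)%:E.
  rewrite /lower_env -/L fineK // fin_numE; apply/andP; split.
    by rewrite gt_eqF // (lt_le_trans _ h1) // ltNyr.
  by rewrite lt_eqF // (le_lt_trans h2) // ltry.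
by split => //; rewrite -lee_fin -E.
Qed.

(** Together with [lower_env_lt] this replaces the filter definition in what follows. The margin
    between [a] and [b] is what makes the envelope semicontinuous. *)
Lemma lower_env_gt (F : R * R -> R) (M : R) p a : bounded_by M F -> halfplane p ->
  a < lower_env F p -> exists2 b, a < b & \forall q \near p, halfplane q -> b <= F q.
Proof.
move=> FM hp; have [E _ _] := lower_env_fin FM hp.
rewrite -lte_fin -E limf_einfE => /ereal_sup_gt[_ [V hV <-]] h.
set I := ereal_inf _ in h.
have hI q : V q -> (I <= (F q)%:E)%E by move=> Vq; apply: ereal_inf_lbound; exists q.
have Vp : V p by exact: (nbhs_singleton hV).
have IF : I \is a fin_num.
  rewrite fin_numE; apply/andP; split.
    by rewrite gt_eqF // (lt_trans _ h) // ltNyr.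
  by rewrite lt_eqF // (le_lt_trans (hI p Vp)) // ltry.
exists (fine I); first by rewrite -lte_fin fineK.
by apply: filterS hV => q /hI; rewrite -{1}(fineK IF) lee_fin.
Qed.

Lemma lower_env_lt (F : R * R -> R) (M : R) p a : bounded_by M F -> halfplane p ->
    lower_env F p < a -> forall P : set (R * R), (\forall q \near p, P q) ->
  exists q, [/\ halfplane q, P q & F q < a].
Proof.
move=> FM hp; have [E _ _] := lower_env_fin FM hp.
rewrite -lte_fin -E => h P nP; apply: contrapT => H.
have : (a%:E <= limf_einf (EFin \o F) (within (@halfplane R) (nbhs p)))%E.
  rewrite limf_einfE; apply: ereal_sup_ge.
  exists (ereal_inf ((EFin \o F) @` (@halfplane R `&` P))).
    exists (@halfplane R `&` P) => //; apply: filterS nP => q; split => //.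
  apply: le_ereal_inf_tmp => _ [q [hq Pq] <-] /=; rewrite lee_fin leNgt; apply/negP => Fa.
  by apply: H; exists q.
by rewrite leNgt h.
Qed.

Lemma lower_env_lsc (F : R * R -> R) (M : R) : bounded_by M F ->
  usc_on (@halfplane R) (fun p => - lower_env F p).
Proof.
move=> FM p hp a; rewrite ltrNl => h.
have [b ab /near_boxP[e e0 H]] := lower_env_gt FM hp h.
apply/near_boxP; exists (e / 2); first by lra.
move=> q h1 h2 hq; rewrite ltrNl ltNge; apply/negP => qa.
have qb : lower_env F q < b by lra.
have N : \forall r \near q, `|r.1 - q.1| < e / 2 /\ `|r.2 - q.2| < e / 2.
  by apply/near_boxP; exists (e / 2); [lra|].
have [r [hr [r1 r2] rb]] := lower_env_lt FM hq qb N.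
have : b <= F r.
  apply: H => //.
    by have := ler_normD (r.1 - q.1) (q.1 - p.1); rewrite subrKA; lra.
  by have := ler_normD (r.2 - q.2) (q.2 - p.2); rewrite subrKA; lra.
by rewrite leNgt rb.
Qed.

End semicontinuity.

(** * Viscosity inequalities and barriers *)

Section viscosity.
Variable R : realType.
Implicit Types (u v phi psi : R * R -> R) (p q o : R * R).

(** The form in which limits [r -> 0] of viscosity inequalities are taken. *)
Lemma small_le0 (a A : R) : 0 <= A ->
  (forall r, 0 < r -> r <= 1 -> a <= A * r) -> a <= 0.
Proof.
move=> A0 H; rewrite leNgt; apply/negP => a0.
have A1 : 0 < A + 1 by lra.
set r := Num.min 1 (a / (A + 1)).
have r0 : 0 < r by rewrite lt_min ltr01 divr_gt0.
have r1 : r <= 1 by rewrite ge_min lexx.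
have r2 : r <= a / (A + 1) by rewrite ge_min lexx orbT.
have := H r r0 r1; move: r2; rewrite ler_pdivlMr //; nra.
Qed.

(** A penalisation [r * pen] makes the maximum strict and moves the operator by [O(r)] only;
    viscosity inequalities can then be used at any global maximum. *)
Lemma subsolution_max u phi p : subsolution u -> test phi -> 0 < p.1 ->
    (forall q, halfplane q -> u q - phi q <= u p - phi p) ->
  operatorE phi p <= 0.
Proof.
move=> [_ su] tphi p0 H.
have [A A0 HA] := operatorE_near p tphi.
apply: (small_le0 A0) => r r0 r1.
have tper := test_perturb r p tphi.
have sm : strict_max (u \- perturb phi r p) p.
  move=> q hq qp; rewrite /perturb /= pen0 mulr0 addr0.
  have : 0 < r * pen p q by rewrite mulr_gt0 ?pen_gt0.
  by have := H q hq; lra.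
have h1 := su _ _ tper.1 tper.2 p0 sm.
have : `|operatorE (perturb phi r p) p - operatorE phi p| <= A * r.
  by apply: HA; rewrite ?subrr ?normr0 ?sqr_ge0 // gtr0_norm.
move: h1; move: (operatorE _ p) (operatorE phi p) => a b.
by rewrite ler_norml => a0 /andP[ba _]; clear -a0 ba; lra.
Qed.

Lemma reflxK : involutive (@reflx R).
Proof. by move=> [t x]; rewrite /reflx /= opprK. Qed.

Lemma Htilde_reflx phi t x : test phi ->
  Htilde (fun y => - phi (reflx (t, y))) x = - Htilde (fun y => phi (t, y)) (- x).
Proof.
move=> tphi.
have h1 := test_Hregular t x (test_reflx tphi).
have h2 := test_Hregular t (- x) tphi.
have i2 := sdiff_integrable h2.
rewrite (HtildeE h1) (HtildeE h2).
rewrite -mulN1r -RintegralZl //; apply: eq_Rintegral => z _.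
rewrite /sdiff /reflx /= mulN1r -mulNr; congr (_ / _).
have -> : - (x + z) = - x - z by ring.
have -> : - (x - z) = - x + z by ring.
by ring.
Qed.

Lemma operatorE_reflx phi p : test phi ->
  operatorE (fun q => - phi (reflx q)) p = - operatorE phi (reflx p).
Proof.
move=> tphi; have dphi q := smooth_differentiable q tphi.1.
rewrite /operatorE !derive_reflx // Htilde_reflx //.
have -> : reflx (1, 0) = (1, 0) :> R * R by rewrite /reflx oppr0.
have -> : - 'D_(reflx (0, 1)) phi (reflx p) = 'D_(0, 1) phi (reflx p).
  have -> : reflx (0, 1) = - (0, 1) :> R * R by rewrite /reflx; congr (_, _); rewrite /= oppr0.
  by rewrite !deriveE // linearN opprK.
by rewrite /=; ring.
Qed.

Lemma halfplane_reflx p : halfplane p -> halfplane (reflx p).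
Proof. by []. Qed.

Lemma reflx_continuous : continuous (@reflx R).
Proof. by move=> p; apply: differentiable_continuous; exact: differentiable_reflx. Qed.

Lemma supersolution_reflx v : supersolution v -> subsolution (fun p => - v (reflx p)).
Proof.
move=> [/lsc_usc/usc_onP lv sv]; split.
  apply/usc_onP; apply: (usc_on_comp reflx_continuous _ lv).
  exact: halfplane_reflx.
move=> phi p sphi Cphi p0 sm.
have tphi : test phi by split.
have t' := test_reflx tphi.
have := sv _ (reflx p) t'.1 t'.2 p0; rewrite operatorE_reflx // reflxK.
rewrite oppr_ge0; apply=> q hq qp.
have := sm (reflx q) (halfplane_reflx hq); rewrite /= !reflxK => H.
have : reflx q != p by apply: contra qp => /eqP <-; rewrite reflxK.
by move=> /H; lra.
Qed.

Lemma supersolution_min v phi p : supersolution v -> test phi -> 0 < p.1 ->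
    (forall q, halfplane q -> v p - phi p <= v q - phi q) ->
  0 <= operatorE phi p.
Proof.
move=> /supersolution_reflx sv tphi p0 H.
have := @subsolution_max _ _ (reflx p) sv (test_reflx tphi) p0.
rewrite operatorE_reflx // reflxK oppr_le0; apply => q hq.
by have := H (reflx q) (halfplane_reflx hq); lra.
Qed.

(** * Barriers built from the bounded profile *)

Definition dbump (y : R) : R := 2 * (lorentz y * odd_lorentz y).

Lemma is_derive_bump (y : R) : is_derive y 1 (@bump R) (dbump y).
Proof.
have h := is_deriveB (is_derive_cst (1 : R) y (1 : R)) (is_derive_lorentz y).
by apply: (is_derive_eq h); rewrite sub0r -mulNr opprK.
Qed.

Lemma derive_bump a b c p (w : R * R) :
  'D_w (fun q => bump (affine a b c q)) p = (a * w.1 + b * w.2) * dbump (affine a b c p).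
Proof. exact: derive_affine (is_derive_bump _). Qed.

Lemma dbumpE (y : R) : dbump y = 2 * y / (1 + y ^+ 2) ^+ 2.
Proof. by rewrite /dbump /odd_lorentz /lorentz; field; rewrite gt_eqF ?lorentz_den. Qed.

Lemma dbump_le2 (y : R) : `|dbump y| <= 2.
Proof.
rewrite /dbump normrM normr_nat ler_piMr // normrM (ger0_norm (lorentz_ge0 y)).
apply: mulr_ile1; [exact: lorentz_ge0|exact: normr_ge0|exact: lorentz_le1|exact: odd_lorentz_le1].
Qed.

Lemma bump_le_half (y : R) : bump y <= 1 / 2 -> `|y| <= 1.
Proof.
rewrite bumpE ler_pdivrMr ?lorentz_den // -(ler_sqr (x := `|y|)) ?nnegrE //.
by rewrite real_normK ?num_real // expr1n; lra.
Qed.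

Lemma bump_ge_half (y : R) : 1 <= `|y| -> 1 / 2 <= bump y.
Proof.
move=> h; have : 1 <= y ^+ 2 by rewrite -real_normK ?num_real // expr_ge1.
by rewrite bumpE ler_pdivlMr ?lorentz_den //; lra.
Qed.

(* [bump y <= 3/4] means [y^2 <= 3], where the increasing time profile still has slope at least 1/8. *)
Lemma dbump_ge (y : R) : 1 <= y -> bump y <= 3 / 4 -> y <= 2 /\ 1 / 8 <= dbump y.
Proof.
move=> y1; rewrite bumpE ler_pdivrMr ?lorentz_den // => h.
have h3 : y ^+ 2 <= 3 by lra.
split; first by nra.
rewrite dbumpE ler_pdivlMr ?exprn_gt0 ?lorentz_den //.
have : (1 + y ^+ 2) ^+ 2 <= 16.
  have -> : 16 = 4 ^+ 2 :> R by rewrite expr2; ring.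
  by rewrite ler_sqr ?nnegrE ?ler0n ?addr_ge0 ?sqr_ge0 //; lra.
by lra.
Qed.

Lemma derive_balgD (f g : R * R -> R) p (w : R * R) : balg f -> balg g ->
  'D_w (fun q => f q + g q) p = 'D_w f p + 'D_w g p.
Proof.
move=> bf bg; apply: deriveD; apply: diff_derivable; exact: balg_differentiable.
Qed.

Lemma derive_balgM (f g : R * R -> R) p (w : R * R) : balg f -> balg g ->
  'D_w (fun q => f q * g q) p = f p * 'D_w g p + g p * 'D_w f p.
Proof.
move=> bf bg; apply: deriveM; apply: diff_derivable; exact: balg_differentiable.
Qed.

Lemma derive_balgZ k (f : R * R -> R) p (w : R * R) : balg f ->
  'D_w (fun q => k * f q) p = k * 'D_w f p.
Proof.
move=> bf; rewrite (derive_balgM _ _ (balg_cst k) bf) derive_cst mulr0 addr0 //.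
Qed.

(* On [0 <= t] the term [bump (C * t + 1) - 1 / 2] increases from 0 and is smooth and
   bounded on the whole line, unlike [t] itself. *)
Definition barrier (M d C c x0 : R) (p : R * R) : R :=
  (c + 4 * M * bump (affine 0 d^-1 (- (x0 / d)) p)) +
  8 * M * (bump (affine C 0 1 p) - 1 / 2).

Lemma balg_barrier M d C c x0 : balg (barrier M d C c x0).
Proof.
apply: balgD.
  by apply: balgD; [exact: balg_cst|apply: balgZ; exact: balg_bump].
by apply: balgZ; apply: balgB; [exact: balg_bump|exact: balg_cst].
Qed.

Lemma barrierE M d C c x0 t x : barrier M d C c x0 (t, x) =
  c + 4 * M * bump ((x - x0) / d) + 8 * M * (bump (C * t + 1) - 1 / 2).
Proof.
by rewrite /barrier /affine /=; congr (_ + _ * bump _ + _ * (bump _ - _)); ring.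
Qed.

(** Whatever [c] and [x0], the slope in space is at most [8 * M / d] and the nonlocal term at least
    [- 4 * M * K * kint 1]; [G] bounds the product. While the time term is at most [2 * M], its
    slope is at least [M * C = G + 1], which wins. *)
Lemma operatorE_barrier (M d : R) : 0 < M -> 0 < d ->
  exists2 C : R, 0 < C & forall c x0 t x, 0 <= t ->
    8 * M * (bump (C * t + 1) - 1 / 2) <= 2 * M ->
    0 < operatorE (barrier M d C c x0) (t, x).
Proof.
move=> M0 d0.
have [K K0 [_ _ _ _ HK]] := test_bounded (balg_test (balg_bump 0 d^-1 0)).
set G := (4 * M * (d^-1 * 2)) * (4 * M * K * kint 1).
have k0 : 0 < kint 1 :> R by rewrite mulr_gt0 ?invr_gt0 // divr_gt0 ?pi_gt0.
have M4 : 0 <= 4 * M by rewrite mulr_ge0 // ltW.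
have d2 : 0 <= d^-1 * 2 by rewrite mulr_ge0 // invr_ge0 ltW.
have Q0 : 0 <= 4 * M * K * kint 1 by rewrite mulr_ge0 ?(ltW k0) // mulr_ge0.
have G0 : 0 <= G by rewrite /G mulr_ge0 // mulr_ge0.
set C := (G + 1) / M.
have C0 : 0 < C by rewrite divr_gt0 //; lra.
exists C => // c x0 t x t0 ht.
rewrite /operatorE.
have E (w : R * R) : 'D_w (barrier M d C c x0) (t, x) =
   4 * M * (d^-1 * w.2 * dbump (affine 0 d^-1 (- (x0 / d)) (t, x)))
   + 8 * M * (C * w.1 * dbump (C * t + 1)).
  rewrite /barrier derive_balgD; last 2 first.
  - by apply: balgD; [exact: balg_cst|apply: balgZ; exact: balg_bump].
  - by apply: balgZ; apply: balgB; [exact: balg_bump|exact: balg_cst].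
  rewrite derive_balgD; [|exact: balg_cst|by apply: balgZ; exact: balg_bump].
  rewrite derive_cst add0r derive_balgZ; last exact: balg_bump.
  rewrite derive_bump mul0r add0r.
  rewrite derive_balgZ; last by apply: balgB; [exact: balg_bump|exact: balg_cst].
  rewrite derive_balgD; [|exact: balg_bump|exact: balg_cst].
  rewrite derive_cst addr0 derive_bump mul0r addr0; congr (_ + _ * (_ * dbump _)).
  by rewrite /affine /=; ring.
rewrite !E /= !mulr0 !mul0r !mulr0 add0r addr0 !mulr1.
set P := 4 * M * _.
have P2 : `|P| <= 4 * M * (d^-1 * 2).
  have dd : 0 < d^-1 by rewrite invr_gt0.
  rewrite /P normrM (ger0_norm M4) ler_wpM2l // normrM (gtr0_norm dd) ler_pM2l //.
  exact: dbump_le2.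
set H := Htilde _ _.
have HH : - (4 * M * K * kint 1) <= H.
  (* The zero function serves as reference for a lower bound on the nonlocal term. *)
  have h1 := test_Hregular 0 0 (balg_test (balg_cst (0 : R))).
  have h2 := test_Hregular t x (balg_test (balg_barrier M d C c x0)).
  have MK : 0 <= 4 * M * K by rewrite mulr_ge0 // mulr_ge0 // ltW.
  have := Htilde_le h1 h2 ltr01 ltr01 MK (lexx 0).
  have -> : Htilde (fun=> 0 : R) 0 = 0.
    rewrite (HtildeE h1) (@eq_Rintegral _ _ _ _ _ (cst 0)) ?Rintegral_cst ?mul0r //.
    by move=> z _; rewrite /sdiff mul0rn !subr0 mul0r.
  rewrite mul0r addr0 -/H => L.
  suff : 0 <= H + 4 * M * K * kint 1 by lra.
  apply: L => z z0; rewrite mul0r addr0 /sdiff mul0rn !subr0.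
  rewrite !barrierE.
  have := HK 0 (x - x0) z; rewrite /sdiff /affine /= mul0r !add0r !addr0.
  have -> : d^-1 * (x - x0) = (x - x0) / d by ring.
  have -> : d^-1 * (x - x0 + z) = (x + z - x0) / d by ring.
  have -> : d^-1 * (x - x0 - z) = (x - z - x0) / d by ring.
  rewrite expr1n => /ler_normlP[]; set a := bump _; set b := bump _; set e := bump _.
  move=> h _.
  have h' := ler_wpM2l (_ : 0 <= 4 * M) h.
  have {h'} := h' _; rewrite mulr_ge0 ?(ltW M0) // => /(_ isT) h'.
  have -> : 4 * M * K * (z ^+ 2 / (1 + z ^+ 2)) = 4 * M * (K * (z ^+ 2 / (1 + z ^+ 2))) by ring.
  by lra.
have [_ D8] : C * t + 1 <= 2 /\ 1 / 8 <= dbump (C * t + 1).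
  apply: dbump_ge; first by rewrite lerDr mulr_ge0 // ltW.
  by rewrite -(ler_pM2l (_ : 0 < 8 * M)); [lra|rewrite mulr_gt0].
have MC : M * C = G + 1 by rewrite /C; field; rewrite gt_eqF.
have T1 : G + 1 <= 8 * M * (C * dbump (C * t + 1)).
  have := ler_wpM2l (_ : 0 <= 8 * (M * C)) D8.
  rewrite {1}MC => /(_ _); have : 0 <= 8 * (G + 1) by lra.
  by move=> -> /(_ isT); rewrite MC => h; rewrite mulrA -[8 * M * C]mulrA MC; lra.
have T2 : - G <= Num.max P 0 * H.
  have P0 : 0 <= Num.max P 0 by rewrite le_max lexx orbT.
  have PP : Num.max P 0 <= 4 * M * (d^-1 * 2).
    rewrite ge_max; apply/andP; split; first by apply: le_trans P2; exact: ler_norm.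
    exact: mulr_ge0.
  have := ler_wpM2l P0 HH; have := ler_wpM2r Q0 PP; rewrite /G; lra.
by lra.
Qed.

(** As [u <= M] and [- M <= c], [u] can exceed the barrier only where each of its two nonnegative
    terms is below [2 * M]. The factor 4 then confines the point to distance [d] from [x0], the
    factor 8 to times where [operatorE_barrier] applies. A positive excess would thus attain its
    maximum, at a positive time by the initial bound, and the equation excludes this. *)
Lemma subsolution_barrier (M d : R) : 0 < M -> 0 < d ->
  exists2 C : R, 0 < C & forall u c x0, subsolution u -> bounded_by M u -> - M <= c ->
    (forall x, u (0, x) <= c + 4 * M * bump ((x - x0) / d)) ->
    forall p, halfplane p -> u p <= barrier M d C c x0 p.
Proof.
move=> M0 d0; have [C C0 HC] := operatorE_barrier M0 d0.
exists C => // u c x0 su uM cM u0 p hp; rewrite leNgt; apply/negP => up.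
set B := barrier M d C c x0 in up *.
have bB : balg B := balg_barrier _ _ _ _ _.
have usB : usc_on (@halfplane R) (fun q => u q + - B q).
  apply: usc_onD; first exact/usc_onP/su.1.
  by apply: continuous_usc_on => q; apply: continuousN; exact: test_continuous (balg_test bB) q.
have mono q : halfplane q -> 1 / 2 <= bump (C * q.1 + 1).
  by move=> q0; apply: bump_ge_half; rewrite ger0_norm ?lerDr ?addr_ge0 ?mulr_ge0 // ltW.
have key q : halfplane q -> 0 < u q - B q ->
    8 * M * (bump (C * q.1 + 1) - 1 / 2) <= 2 * M /\ bump ((q.2 - x0) / d) <= 1 / 2.
  move=> hq; have := uM q hq; rewrite ler_norml => /andP[_ h1].
  have := mono q hq; have := bump_ge0 ((q.2 - x0) / d).
  rewrite /B; case: q {hq} h1 => t x; rewrite barrierE /= => h1.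
  set b1 := bump _; set b2 := bump _ => h2 h3 h4.
  have k1 : 0 <= M * b1 by rewrite mulr_ge0 // ltW.
  have k2 : 0 <= M * (b2 - 1 / 2) by rewrite mulr_ge0 ?(ltW M0) //; lra.
  split; first by lra.
  by rewrite -(ler_pM2l M0); lra.
have [|o ho omax] := usc_halfplane_max (T := C^-1) (L := `|x0| + d) usB hp.
  move=> q hq h; have [] := key q hq; first by lra.
  move=> h1 h2; split.
    have [] := @dbump_ge (C * q.1 + 1).
    - by rewrite lerDr mulr_ge0 // ltW.
    - by rewrite -(ler_pM2l (_ : 0 < 8 * M)); [lra|rewrite mulr_gt0].
    by move=> h3 _; rewrite -[leRHS]mulr1 ler_pdivlMl //; lra.
  have := bump_le_half h2; rewrite normrM normfV (gtr0_norm d0) ler_pdivrMr // mul1r.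
  by have := ler_normD (q.2 - x0) x0; rewrite subrK; lra.
have o1 : 0 < u o - B o by have := omax p hp; lra.
have o0 : 0 < o.1.
  rewrite lt_neqAle ho andbT; apply/eqP => E.
  move: o1; case: o E {ho omax} => t x /= <-.
  have b1 : bump 1 = 1 / 2 :> R by rewrite bumpE expr1n; field.
  by have := u0 x; rewrite /B barrierE mulr0 add0r b1; lra.
have := subsolution_max su (balg_test bB) o0 omax; rewrite leNgt => /negP; apply.
have [h1 _] := key o ho o1.
by case: (o) h1 ho => t x /= h1 ho; apply: HC.
Qed.

End viscosity.

(** * Smooth approximation of monotone semicontinuous functions *)

Section approximation.
Variable R : realType.
Implicit Types (u v phi psi : R * R -> R) (p q o : R * R).

Definition space_mono u : Prop := forall t, 0 <= t -> {homo (fun x => u (t, x)) : x y / x <= y}.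

Lemma sigmoid_decay (a : R) : 0 <= a -> sigmoid a <= (1 + a)^-1.
Proof.
move=> a0; have e0 := expR_gt0 a; have ea := expR_ge1Dx a.
by rewrite /sigmoid lef_pV2 ?posrE; lra.
Qed.

Lemma sigmoid_opp (a : R) : 1 - sigmoid a = sigmoid (- a).
Proof.
rewrite /sigmoid expRN; have e0 := expR_gt0 a; field.
by rewrite !gt_eqF ?addr_gt0.
Qed.

Lemma sigmoid_step (h e : R) : 0 < h -> 0 < e -> exists2 K : R, 0 < K &
  forall a : R, (h <= a -> sigmoid (K * a) <= e) /\ (a <= - h -> 1 - sigmoid (K * a) <= e).
Proof.
move=> h0 e0; exists (h^-1 * e^-1); first by rewrite mulr_gt0 ?invr_gt0.
have key a : h <= a -> sigmoid (h^-1 * e^-1 * a) <= e.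
  move=> ha.
  have k : e^-1 <= h^-1 * e^-1 * a.
    have : 1 <= h^-1 * a by rewrite mulrC ler_pdivlMr // mul1r.
    have : 0 < e^-1 by rewrite invr_gt0.
    by nra.
  have ei : 0 < e^-1 by rewrite invr_gt0.
  apply: (le_trans (sigmoid_decay _)); first by lra.
  by rewrite -[leRHS]invrK lef_pV2 ?posrE //; lra.
move=> a; split; first exact: key.
by move=> ha; rewrite sigmoid_opp -mulrN; apply: key; lra.
Qed.

(** The stairs descend to the left from [X] with step [h], one induction step per stair. By
    semicontinuity at [(tb, y)] and monotonicity in [x], [g] lies above [u] on all of [x <= y]: near
    time [tb] by its constant, at other times by the penalty [4 * M * bump]. A sigmoid centred at
    [y - h / 2] passes from the previous majorant to [g]. Closeness is claimed on the slice [tb]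
    only, which is all that the nonlocal term sees. *)
Lemma approx_stairs u (M tb X h : R) : 0 < M -> bounded_by M u -> space_mono u ->
    usc_on (@halfplane R) u -> 0 <= tb -> 0 < h ->
  forall (n : nat) (k : R), 0 < k -> exists2 psi, balg psi &
    [/\ forall q, halfplane q -> u q <= psi q,
        forall x, psi (tb, x) <= M + k
      & forall (i : nat) x, (i < n)%N -> x <= X - i%:R * h - h ->
          psi (tb, x) <= u (tb, X - i%:R * h) + k].
Proof.
move=> M0 uM um us tb0 h0; elim=> [|n IH] k k0.
  exists (fun=> M); first exact: balg_cst.
  split => // [q hq|x]; last by lra.
  by have := uM q hq; rewrite ler_norml => /andP[].
have [|psi bpsi [psi_u psi_M psi_s]] := IH (k / 2); first by lra.
set y := X - n%:R * h; set c := u (tb, y).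
have cM := uM (tb, y) tb0; rewrite -/c ler_norml in cM; case/andP: cM => cM1 cM2.
have [e e0 He] : exists2 e : R, 0 < e &
    forall q, `|q.1 - tb| < e -> `|q.2 - y| < e -> halfplane q -> u q < c + k / 4.
  apply/(near_boxP (tb, y)); apply: us; first exact: tb0.
  by rewrite -/c; lra.
(* The sigmoid is within [d] of its limits off a window of half-width [h / 2]; this [d] keeps the
   resulting errors within [k]. *)
set d := k / (8 * (2 * M + k)).
have d0 : 0 < d by rewrite divr_gt0 // mulr_gt0 //; lra.
have dE : d * (2 * M + k) = k / 8 by rewrite /d; field; rewrite gt_eqF //; lra.
have [|K K0 HK] := @sigmoid_step (h / 2) d _ d0; first by lra.
pose g q := c + k / 4 + 4 * M * bump (affine e^-1 0 (- (tb / e)) q).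
pose s q := sigmoid (affine 0 (- K) (K * (y - h / 2)) q).
have bg : balg g by apply: balgD; [exact: balg_cst|apply: balgZ; exact: balg_bump].
have bs : balg s by exact: balg_sigmoid.
(* To the right of [y], [g] may fall below [u], by at most [2 * M] and with weight at most [d]; the
   constant [2 * M * d] compensates for this. *)
exists (fun q => g q + s q * (psi q - g q) + 2 * M * d).
  apply: balgD; last exact: balg_cst.
  by apply: balgD => //; apply: balgM => //; exact: balgB.
have s0 q : 0 <= s q := sigmoid_ge0 _.
have s1 q : s q <= 1 := sigmoid_le1 _.
have Md : 0 < M * d by rewrite mulr_gt0.
have kd : 0 < k * d by rewrite mulr_gt0.
have gtb x : g (tb, x) = c + k / 4.
  rewrite /g /affine /= mul0r addr0 (_ : e^-1 * tb + - (tb / e) = 0) ?bump0; last by ring.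
  by rewrite mulr0 addr0.
have sE q : s q = sigmoid (K * (y - h / 2 - q.2)) by rewrite /s /affine; congr sigmoid; ring.
split.
- move=> [t x] hq; have uq := psi_u _ hq; have uMq := uM _ hq.
  rewrite ler_norml in uMq; case/andP: uMq => uM1 uM2.
  have [xy|yx] := leP x y.
    have ug : u (t, x) <= g (t, x).
      have hy : halfplane (t, y) by [].
      apply: le_trans (um t hq _ _ xy) _.
      have b0 : 0 <= M * bump (affine e^-1 0 (- (tb / e)) (t, x)).
        by rewrite mulr_ge0 ?bump_ge0 // ltW.
      have [te|et] := ltP `|t - tb| e.
        have := He (t, y) te _ hy; rewrite /= subrr normr0 => /(_ e0).
        by rewrite /g; lra.
      have : 1 / 2 <= bump (affine e^-1 0 (- (tb / e)) (t, x)).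
        apply: bump_ge_half; rewrite /affine /= mul0r addr0.
        have -> : e^-1 * t + - (tb / e) = (t - tb) / e by ring.
        by rewrite normrM normfV (gtr0_norm e0) ler_pdivlMr // mul1r.
      rewrite -(ler_pM2l M0) /g => b1.
      by have := uM _ hy; rewrite ler_norml => /andP[_ ?]; lra.
    have := s0 (t, x); have := s1 (t, x); move: (s _) => S S1 S0.
    have a1 := mulr_ge0 S0 (_ : 0 <= psi (t, x) - u (t, x)).
    have a2 := mulr_ge0 (_ : 0 <= 1 - S) (_ : 0 <= g (t, x) - u (t, x)).
    have := a1 _; have := a2 _ _; rewrite !subr_ge0 => /(_ S1 ug) ? /(_ uq) ?.
    lra.
  have sx : 1 - s (t, x) <= d.
    by rewrite sE; apply: (HK _).2; rewrite /=; lra.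
  have gM : - M <= g (t, x).
    have b0 : 0 <= M * bump (affine e^-1 0 (- (tb / e)) (t, x)).
      by rewrite mulr_ge0 ?bump_ge0 // ltW.
    by rewrite /g; lra.
  have := s0 (t, x); have := s1 (t, x); move: (s _) sx => S Sd S1 S0.
  have a1 : 0 <= S * (psi (t, x) - u (t, x)) by rewrite mulr_ge0 // subr_ge0.
  have a2 : 0 <= (1 - S) * (g (t, x) - u (t, x) + 2 * M) by rewrite mulr_ge0; lra.
  have a3 : 0 <= (d - (1 - S)) * (2 * M) by rewrite mulr_ge0; lra.
  lra.
- move=> x; rewrite gtb; have := psi_M x.
  have := s0 (tb, x); have := s1 (tb, x); move: (s _) => S S1 S0 pM.
  have a1 : 0 <= S * (M + k / 2 - psi (tb, x)) by rewrite mulr_ge0; lra.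
  have a2 : 0 <= (1 - S) * (M - c) by rewrite mulr_ge0; lra.
  have a3 : 0 <= S * k by rewrite mulr_ge0 // ltW.
  have a4 : 0 <= (1 - S) * k by rewrite mulr_ge0 ?subr_ge0 // ltW.
  lra.
- move=> i x; rewrite ltnS leq_eqVlt => /predU1P[->|i_n] hx; rewrite gtb.
    rewrite -/y -/c in hx *.
    have sx : s (tb, x) <= d by rewrite sE; apply: (HK _).1; rewrite /=; lra.
    have := s0 (tb, x); have := psi_M x; move: (s _) sx => S Sd pM S0.
    have a1 : 0 <= S * (2 * M + k / 2 - (psi (tb, x) - (c + k / 4))) by rewrite mulr_ge0; lra.
    have a2 : 0 <= (d - S) * (2 * M + k / 2) by rewrite mulr_ge0; lra.
    lra.
  have uc : c <= u (tb, X - i%:R * h).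
    apply: um => //; rewrite lerD2l lerN2; apply: ler_wpM2r; first exact: ltW.
    by rewrite ler_nat ltnW.
  have := psi_s i x i_n hx; have := s0 (tb, x); have := s1 (tb, x).
  move: (s _) => S S1 S0 pu.
  have a1 : 0 <= S * (u (tb, X - i%:R * h) + k / 2 - psi (tb, x)) by rewrite mulr_ge0; lra.
  have a2 : 0 <= (1 - S) * (u (tb, X - i%:R * h) - c) by rewrite mulr_ge0; lra.
  have a3 : 0 <= (1 - S) * k by rewrite mulr_ge0 ?subr_ge0 // ltW.
  have a4 : 0 <= S * k by rewrite mulr_ge0 // ltW.
  lra.
Qed.

(** As [u] may jump, a smooth majorant can only be compared with [u] shifted by [d], which also
    absorbs the width of the stairs. Finitely many stairs cover [|z| <= L]; beyond it the last term
    exceeds the oscillation of [u]. *)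
Lemma approx_above u (M d L : R) p : 0 < M -> bounded_by M u -> space_mono u ->
    usc_on (@halfplane R) u -> halfplane p -> 0 < d -> d <= M -> 0 < L ->
  exists2 psi, balg psi & (forall q, halfplane q -> u q <= psi q) /\
    forall z, psi (p.1, p.2 + z) <= u (p.1, p.2 + z + d) + d + 8 * M * bump (z / L).
Proof.
case: p => tb xb /= M0 uM um us hp d0 dM L0.
set h := d / 2; have h0 : 0 < h by rewrite /h; lra.
(* [X] leaves one stair to the right of [xb + L], and [n] stairs reach down to [xb - L], where
   [X - x] is [2 * L + h]. *)
set X := xb + L + h.
set n := (Num.truncn ((2 * L + h) / h)).+1.
have [psi bpsi [psi_u psi_M psi_s]] := @approx_stairs u M tb X h M0 uM um us hp h0 n d d0.
exists psi => //; split => // z.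
have b0 : 0 <= M * bump (z / L) by rewrite mulr_ge0 ?bump_ge0 // ltW.
have [zL|Lz] := ltP L `|z|.
  have : 1 / 2 <= bump (z / L).
    by apply: bump_ge_half; rewrite normrM normfV (gtr0_norm L0) ler_pdivlMr // mul1r ltW.
  rewrite -(ler_pM2l M0) => b1.
  have := uM (tb, xb + z + d) hp; rewrite ler_norml => /andP[? _].
  by have := psi_M (xb + z); lra.
move: Lz; rewrite ler_norml => /andP[z1 z2].
set x := xb + z.
set a := (X - x) / h.
have a1 : 1 <= a by rewrite ler_pdivlMr // mul1r /X /x; lra.
have := @truncn_itv R a; have -> : 0 <= a by lra.
move=> /(_ isT) /andP[ia ai].
have i1 : (0 < Num.truncn a)%N by rewrite truncn_gt0.
(* [x] lies under the stair of index [j], whose height is the value of [u] at [X - j%:R * h], less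
   than [2 * h = d] to the right of [x]. *)
set j := (Num.truncn a).-1.
have jE : Num.truncn a = j.+1 by rewrite prednK.
rewrite jE in ia ai.
have aE : a * h = X - x by rewrite /a divfK // gt_eqF.
have ia' : (j.+1)%:R * h <= X - x by rewrite -aE ler_wpM2r // ltW.
have ai' : X - x < (j.+2)%:R * h by rewrite -aE ltr_pM2r.
rewrite -[j.+1%:R]natr1 mulrDl mul1r in ia'.
rewrite -[j.+2%:R]natr1 -[j.+1%:R]natr1 !mulrDl mul1r in ai'.
have jn : (j < n)%N.
  rewrite ltnS ltnW // -jE; apply: le_truncn.
  by rewrite ler_wpM2r ?invr_ge0 ?(ltW h0) // /X /x; lra.
have := psi_s j x jn; have -> : x <= X - j%:R * h - h by lra.
move=> /(_ isT) P; apply: (le_trans P).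
have : u (tb, X - j%:R * h) <= u (tb, x + d) by apply: um => //; rewrite /h in ai' *; lra.
by lra.
Qed.

End approximation.

(** * Initial modulus and blending of test functions *)

Section comparison.
Variable R : realType.
Implicit Types (u v phi psi : R * R -> R) (p q o : R * R).

Lemma bump_lipschitz (a b : R) : `|bump a - bump b| <= 2 * `|a - b|.
Proof. exact: lipschitz1 (@is_derive_bump R) (@dbump_le2 R). Qed.

Lemma bumpN (a : R) : bump (- a) = bump a.
Proof. by rewrite !bumpE sqrrN. Qed.

Lemma bump_div (r z : R) : 0 < r -> bump (z / r) = z ^+ 2 / (r ^+ 2 + z ^+ 2).
Proof.
move=> r0; have d0 : 0 < r ^+ 2 + z ^+ 2 by rewrite ltr_pwDl ?exprn_gt0 ?sqr_ge0.
have r2 : 0 < r ^+ 2 by rewrite exprn_gt0.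
rewrite bumpE; field; rewrite !gt_eqF //.
Qed.

Definition bump2 (a h : R) : R := bump (a + h) + bump (a - h) - bump a *+ 2.

(** The bound is uniform in the base point. Since [bump (z / r)] is the kernel fraction of
    [Htilde_le] at width [r], second differences of rescaled profiles are integrated at once. *)
Lemma bump2_le : exists2 K : R, 0 <= K & forall a h, `|bump2 a h| <= K * bump h.
Proof.
have [K K0 [_ _ _ _ HK]] := test_bounded (balg_test (@balg_bump R 0 1 0)).
exists K => // a h; have := HK 0 a h; rewrite -bumpE.
have E x : affine 0 1 0 (0, x) = x :> R by rewrite /affine /=; ring.
by rewrite /sdiff !E /bump2 -normrN; congr (`|_| <= _); ring.
Qed.

Lemma balg_reflx phi : balg phi -> balg (fun q => phi (reflx q)).
Proof.
have E a b c q : affine a b c (reflx q) = affine a (- b) c q :> R.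
  by rewrite /affine /reflx /=; ring.
elim=> [k|f g _ IHf _ IHg|f g _ IHf _ IHg|a b c|a b c|a b c].
- exact: balg_cst.
- exact: balgD.
- exact: balgM.
- by under eq_fun do rewrite E; exact: balg_lorentz.
- by under eq_fun do rewrite E; exact: balg_odd_lorentz.
- by under eq_fun do rewrite E; exact: balg_sigmoid.
Qed.

(** The weight depends on the space variable only and vanishes to second order at [o.2]: value and
    first derivatives at [o] are those of [phi], while [psi] takes over at distances beyond [r]. *)
Definition blend (r : R) (o : R * R) phi psi : R * R -> R :=
  fun p => phi p + bump (affine 0 r^-1 (- (o.2 / r)) p) * (psi p - phi p).

Lemma balg_blend r o phi psi : balg phi -> balg psi -> balg (blend r o phi psi).
Proof.
move=> bphi bpsi; apply: balgD => //; apply: balgM; first exact: balg_bump.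
exact: balgB.
Qed.

Lemma blendE r o phi psi z : blend r o phi psi (o.1, o.2 + z) =
  (1 - bump (z / r)) * phi (o.1, o.2 + z) + bump (z / r) * psi (o.1, o.2 + z).
Proof.
rewrite /blend; have -> : affine 0 r^-1 (- (o.2 / r)) (o.1, o.2 + z) = z / r.
  by rewrite /affine /=; ring.
by ring.
Qed.

Lemma blend_base r o phi psi : blend r o phi psi o = phi o.
Proof.
rewrite /blend (_ : affine _ _ _ _ = 0) ?bump0 ?mul0r ?addr0 //.
by rewrite /affine /=; ring.
Qed.

Lemma derive_blend r o phi psi (w : R * R) : balg phi -> balg psi ->
  'D_w (blend r o phi psi) o = 'D_w phi o.
Proof.
move=> bphi bpsi; have bb := @balg_bump R 0 r^-1 (- (o.2 / r)).
have bs := balgB bpsi bphi.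
rewrite /blend (derive_balgD _ _ bphi (balgM bb bs)) (derive_balgM _ _ bb bs) derive_bump.
rewrite (_ : affine _ _ _ _ = 0) ?bump0 ?mul0r; last by rewrite /affine /=; ring.
by rewrite /dbump /odd_lorentz mul0r !mulr0 !addr0.
Qed.

Lemma blend_ge r o u phi psi p : u p <= phi p -> u p <= psi p -> u p <= blend r o phi psi p.
Proof.
move=> h1 h2; rewrite /blend; set b := bump _.
have b0 : 0 <= b := bump_ge0 _; have b1 : b <= 1 := bump_le1 _.
have := mulr_ge0 b0 (_ : 0 <= psi p - u p); have := mulr_ge0 (_ : 0 <= 1 - b) (_ : 0 <= phi p - u p).
by rewrite !subr_ge0 => /(_ b1 h1) ? /(_ h2) ?; lra.
Qed.

Lemma blend_le r o v phi psi p : phi p <= v p -> psi p <= v p -> blend r o phi psi p <= v p.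
Proof.
move=> h1 h2; rewrite /blend; set b := bump _.
have b0 : 0 <= b := bump_ge0 _; have b1 : b <= 1 := bump_le1 _.
have := mulr_ge0 b0 (_ : 0 <= v p - psi p); have := mulr_ge0 (_ : 0 <= 1 - b) (_ : 0 <= v p - phi p).
by rewrite !subr_ge0 => /(_ b1 h1) ? /(_ h2) ?; lra.
Qed.

Lemma bounded_by_reflx M v : bounded_by M v -> bounded_by M (fun p => - v (reflx p)).
Proof. by move=> vM p hp; rewrite normrN; exact: vM. Qed.

Lemma space_mono_reflx v : space_mono v -> space_mono (fun p => - v (reflx p)).
Proof. by move=> mv t t0 x y xy; rewrite lerN2; apply: mv => //=; rewrite lerN2. Qed.

Lemma approx_below v (M d L : R) p : 0 < M -> bounded_by M v -> space_mono v ->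
    usc_on (@halfplane R) (fun q => - v q) -> halfplane p -> 0 < d -> d <= M -> 0 < L ->
  exists2 psi, balg psi & (forall q, halfplane q -> psi q <= v q) /\
    forall z, v (p.1, p.2 + z - d) - d - 8 * M * bump (z / L) <= psi (p.1, p.2 + z).
Proof.
move=> M0 vM mv lv hp d0 dM L0.
have lw : usc_on (@halfplane R) (fun q => - v (reflx q)).
  by apply: (usc_on_comp (@reflx_continuous R) _ lv); exact: halfplane_reflx.
have [psi bpsi [psi_v psi_le]] := @approx_above _ _ M d L (reflx p) M0 (bounded_by_reflx vM)
  (space_mono_reflx mv) lw hp d0 dM L0.
exists (fun q => (-1) * psi (reflx q)); first by apply: balgZ; exact: balg_reflx.
split=> [q hq|z].
  by have := psi_v (reflx q) hq; rewrite reflxK mulN1r; lra.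
have := psi_le (- z); rewrite /reflx /= mulN1r mulNr bumpN.
have -> : - (- p.2 - z + d) = p.2 + z - d by ring.
have -> : - p.2 - z = - (p.2 + z) by ring.
by lra.
Qed.

(** The barrier centred at [x] with [c = u (0, x + d)] lies above the initial value: by monotonicity
    up to [x + d], by the term [4 * M * bump] beyond. The shift by [d] stands in for continuity of
    the initial value; the factor 16 is 8 times the Lipschitz constant 2 of [bump]. *)
Lemma initial_modulus u (M d : R) : 0 < M -> 0 < d -> subsolution u -> bounded_by M u ->
    space_mono u ->
  exists2 C : R, 0 < C & forall t x, 0 <= t -> u (t, x) <= u (0, x + d) + C * t.
Proof.
move=> M0 d0 su uM mu; have [C C0 HC] := subsolution_barrier M0 d0.
exists (16 * M * C); first by rewrite !mulr_gt0.
move=> t x t0.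
have h0 y : halfplane (0 : R, y) by rewrite /halfplane /=.
have uM' y : - M <= u (0, y) <= M by have := uM _ (h0 y); rewrite ler_norml.
have /andP[c1 c2] := uM' (x + d).
have B := HC u (u (0, x + d)) x su uM c1.
have : u (t, x) <= barrier M d C (u (0, x + d)) x (t, x).
  apply: B => // y; have [yx|xy] := leP y (x + d).
    apply: (le_trans (mu 0 (lexx 0) _ _ yx)).
    by rewrite lerDl mulr_ge0 ?bump_ge0 // mulr_ge0 // ltW.
  have : 1 / 2 <= bump ((y - x) / d).
    apply: bump_ge_half; rewrite normrM normfV (gtr0_norm d0) ler_pdivlMr // mul1r.
    by rewrite ger0_norm; lra.
  by rewrite -(ler_pM2l M0); have /andP[] := uM' y; lra.
rewrite barrierE subrr mul0r bump0 mulr0 addr0 => h.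
have b1 : bump 1 = 1 / 2 :> R by rewrite bumpE expr1n; field.
have := bump_lipschitz (C * t + 1) 1; rewrite b1 addrK (ger0_norm (x := C * t)); last first.
  by rewrite mulr_ge0 // ltW.
move=> /ler_normlP[_]; rewrite -(ler_pM2l M0); lra.
Qed.

(** Of the gap [rho], a quarter is spent on the modulus of each function and the remaining half on
    the distance between [x] and [y]. *)
Lemma initial_gap u v (M rho k : R) : 0 < M -> 0 < rho -> 0 < k ->
    subsolution u -> supersolution v -> bounded_by M u -> bounded_by M v ->
    space_mono u -> space_mono v -> (forall x, u (0, x + rho) <= v (0, x)) ->
  exists2 tau : R, 0 < tau & forall t s x y, 0 <= t -> t <= tau -> 0 <= s -> s <= tau ->
    `|x - y| <= rho / 2 -> u (t, x) - v (s, y) <= k.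
Proof.
move=> M0 rho0 k0 su sv uM vM mu mv uv.
have d0 : 0 < rho / 4 by lra.
have [C C0 HC] := initial_modulus M0 d0 su uM mu.
have [D D0 HD] := initial_modulus M0 d0 (supersolution_reflx sv) (bounded_by_reflx vM)
  (space_mono_reflx mv).
exists (k / (C + D)); first by rewrite divr_gt0 // addr_gt0.
set tau := k / (C + D); have tauE : (C + D) * tau = k by rewrite /tau; field; lra.
move=> t s x y t0 tt s0 st; rewrite ler_norml => /andP[xy1 xy2].
have h1 := HC t x t0; have := HD s (- y) s0; rewrite /reflx /= opprK opprD opprK => h2.
have h3 := uv (y - rho / 4).
have h4 : u (0, x + rho / 4) <= u (0, y - rho / 4 + rho) by apply: mu => //; lra.
have h5 : C * t <= C * tau by rewrite ler_pM2l.
have h6 : D * s <= D * tau by rewrite ler_pM2l.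
lra.
Qed.

End comparison.

(** * Doubling of variables *)

Section doubling.
Variable R : realType.
Implicit Types (u v phi psi : R * R -> R) (p q o : R * R).

(** In order: doubling in space, doubling in time, localisation, growth in time. The last two act on
    the first point only, so the space slopes of the two test functions differ by the localisation
    alone. *)
Definition Phi (M e h b l : R) (p q : R * R) : R :=
  4 * M * bump ((p.2 - q.2) / e) + 4 * M * bump ((p.1 - q.1) / h) +
  4 * M * bump (b * p.2) + 8 * M * (bump (l * p.1 + 1) - 1 / 2).

Ltac balg := repeat first [exact: balg_bump | exact: balg_cst | apply: balgD | apply: balgZ].

Lemma PhilE M e h b l q k : (fun p => Phi M e h b l p q + k) = (fun p =>
  4 * M * bump (affine 0 e^-1 (- (q.2 / e)) p) + (4 * M * bump (affine h^-1 0 (- (q.1 / h)) p) +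
  (4 * M * bump (affine 0 b 0 p) + (8 * M * bump (affine l 0 1 p) + (k - 4 * M))))).
Proof.
apply/funext => p; rewrite /Phi /affine !mul0r !add0r !addr0.
have -> : e^-1 * p.2 + - (q.2 / e) = (p.2 - q.2) / e by ring.
have -> : h^-1 * p.1 + - (q.1 / h) = (p.1 - q.1) / h by ring.
by lra.
Qed.

Lemma balg_Phil M e h b l q k : balg (fun p => Phi M e h b l p q + k).
Proof. by rewrite PhilE; balg. Qed.

Lemma derive_Phil M e h b l q k p (w : R * R) :
  'D_w (fun p => Phi M e h b l p q + k) p =
  4 * M * (e^-1 * w.2 * dbump ((p.2 - q.2) / e)) + 4 * M * (h^-1 * w.1 * dbump ((p.1 - q.1) / h))
  + 4 * M * (b * w.2 * dbump (b * p.2)) + 8 * M * (l * w.1 * dbump (l * p.1 + 1)).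
Proof.
rewrite PhilE.
rewrite derive_balgD; [|by balg|by balg]; rewrite derive_balgD; [|by balg|by balg].
rewrite derive_balgD; [|by balg|by balg]; rewrite derive_balgD; [|by balg|by balg].
rewrite derive_cst addr0 !derive_balgZ; try by balg.
rewrite !derive_bump /affine !mul0r !add0r !addr0.
have -> : e^-1 * p.2 + - (q.2 / e) = (p.2 - q.2) / e by ring.
have -> : h^-1 * p.1 + - (q.1 / h) = (p.1 - q.1) / h by ring.
by ring.
Qed.

Lemma PhirE M e h b l p k : (fun q => k - Phi M e h b l p q) = (fun q =>
  - (4 * M) * bump (affine 0 (- e^-1) (p.2 / e) q) +
  (- (4 * M) * bump (affine (- h^-1) 0 (p.1 / h) q) +
  (k - 4 * M * bump (b * p.2) - 8 * M * (bump (l * p.1 + 1) - 1 / 2)))).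
Proof.
apply/funext => q; rewrite /Phi /affine !mul0r !add0r !addr0.
have -> : - e^-1 * q.2 + p.2 / e = (p.2 - q.2) / e by ring.
have -> : - h^-1 * q.1 + p.1 / h = (p.1 - q.1) / h by ring.
by ring.
Qed.

Lemma balg_Phir M e h b l p k : balg (fun q => k - Phi M e h b l p q).
Proof. by rewrite PhirE; balg. Qed.

Lemma derive_Phir M e h b l p k q (w : R * R) :
  'D_w (fun q => k - Phi M e h b l p q) q =
  4 * M * (e^-1 * w.2 * dbump ((p.2 - q.2) / e)) + 4 * M * (h^-1 * w.1 * dbump ((p.1 - q.1) / h)).
Proof.
rewrite PhirE.
rewrite derive_balgD; [|by balg|by balg]; rewrite derive_balgD; [|by balg|by balg].
rewrite derive_cst addr0 !derive_balgZ; try by balg.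
rewrite !derive_bump /affine !mul0r !add0r !addr0.
have -> : - e^-1 * q.2 + p.2 / e = (p.2 - q.2) / e by ring.
have -> : - h^-1 * q.1 + p.1 / h = (p.1 - q.1) / h by ring.
by ring.
Qed.

Lemma bump_scale_le (e z : R) : 0 < e -> bump (z / e) <= (e ^+ 2)^-1 * z ^+ 2.
Proof.
move=> e0; have -> : (e ^+ 2)^-1 * z ^+ 2 = (z / e) ^+ 2 by rewrite expr_div_n mulrC.
rewrite bumpE ler_pdivrMr ?lorentz_den // ler_peMr ?sqr_ge0 //.
by rewrite lerDl sqr_ge0.
Qed.

(** Weight and kernel being the same function, a second difference [O(z ^+ 2)] of the near part
    becomes [O(r ^+ 2)] at width [r]. *)
Lemma one_sub_bump (r z : R) : 0 < r -> (1 - bump (z / r)) * z ^+ 2 = r ^+ 2 * bump (z / r).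
Proof.
move=> r0; rewrite bump_div //; field.
by rewrite gt_eqF // ltr_pwDl ?exprn_gt0 ?sqr_ge0.
Qed.

Lemma convex_le (c a1 a2 m1 m2 : R) : 0 <= c -> c <= 1 -> a1 <= m1 -> a2 <= m2 ->
  (1 - c) * a1 + c * a2 <= (1 - c) * m1 + c * m2.
Proof. by move=> c0 c1 h1 h2; apply: lerD; apply: ler_wpM2l => //; lra. Qed.

(* The test functions are the penalisation at distances below [r] and smooth
   approximations of [u] and [v] beyond; the latter are taken with shift [r ^+ 2] and
   cut-off [b^-1], so that all errors are [O(r)]. *)
Lemma doubling_estimate u v (M e h l : R) : 1 <= M -> 0 < e -> 0 < h -> 0 < l ->
    subsolution u -> supersolution v -> bounded_by M u -> bounded_by M v ->
    space_mono u -> space_mono v ->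
  exists2 A : R, 0 <= A & forall r b p q, 0 < r -> r <= 1 -> 0 < b -> b <= r ^+ 2 ->
    0 < p.1 -> 0 < q.1 ->
    (forall p' q', halfplane p' -> halfplane q' ->
       u p' - v q' - Phi M e h b l p' q' <= u p - v q - Phi M e h b l p q) ->
    8 * M * (bump (l * p.1 + 1) - 1 / 2) <= 2 * M ->
    M * l <= A * r.
Proof.
move=> M1 e0 h0 l0 su sv uM vM mu mv.
have M0 : 0 < M by lra.
have [K K0 HK] := bump2_le R.
set pp := pi / 2 : R; have pp0 : 0 < pp by rewrite /pp divr_gt0 // pi_gt0.
(* [A1] and [A2] bound the difference of the two nonlocal terms at widths [r] and [L = b^-1]; [D]
   bounds the one for [u] alone. *)
set A1 := 8 * M * K * (e ^+ 2)^-1 + 32 * M * e^-1 + 16 * M + 4.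
set A2 := 4 * M * K + 32 * M.
set D := 4 * M * K * ((e ^+ 2)^-1 + 1) + 24 * M.
have ei : 0 < e^-1 by rewrite invr_gt0.
have e2i : 0 < (e ^+ 2)^-1 by rewrite invr_gt0 exprn_gt0.
have MK : 0 <= M * K by rewrite mulr_ge0 // ltW.
have A10 : 0 <= A1.
  have : 0 <= M * K * (e ^+ 2)^-1 by rewrite mulr_ge0 // ltW.
  have : 0 <= M * e^-1 by rewrite mulr_ge0 // ltW.
  by rewrite /A1; lra.
have A20 : 0 <= A2 by rewrite /A2; lra.
have D0 : 0 <= D.
  have : 0 <= M * K * (e ^+ 2)^-1 by rewrite mulr_ge0 // ltW.
  by rewrite /D; lra.
exists (8 * M * e^-1 * (pp * (A1 + A2)) + 8 * M * (pp * D)).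
  have q1 : 0 <= pp * (A1 + A2) by apply: mulr_ge0; [exact: ltW|exact: addr_ge0].
  have q2 : 0 <= pp * D by apply: mulr_ge0 => //; exact: ltW.
  have q3 : 0 <= 8 * M by lra.
  by apply: addr_ge0; apply: mulr_ge0 => //; apply: mulr_ge0 => //; exact: ltW.
move=> r b [tp xp] [tq xq] r0 r1 b0 br /= tp0 tq0 fmax hl.
set L := b^-1; have L0 : 0 < L by rewrite invr_gt0.
have r2 : 0 < r ^+ 2 by rewrite exprn_gt0.
have rr : r ^+ 2 <= r by rewrite expr2 ler_piMr // ltW.
have r2M : r ^+ 2 <= M by lra.
have b_le1 : b <= 1 by lra.
have hp : halfplane (tp, xp) by rewrite /halfplane /= ltW.
have hq : halfplane (tq, xq) by rewrite /halfplane /= ltW.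
have usu : usc_on (@halfplane R) u by exact/usc_onP/su.1.
have lsv : usc_on (@halfplane R) (fun q => - v q) by apply/usc_onP; exact: (lsc_usc v).1 sv.1.
have [psi1 bpsi1 [psi1_u psi1_le]] := approx_above M0 uM mu usu hp r2 r2M L0.
have [psi2 bpsi2 [psi2_v psi2_ge]] := approx_below M0 vM mv lsv hq r2 r2M L0.
rewrite /= in psi1_le psi2_ge.
set U := u (tp, xp) in fmax *; set V := v (tq, xq) in fmax *.
set F := Phi M e h b l in fmax *.
set F0 := F (tp, xp) (tq, xq) in fmax *.
(* One point is frozen, and the constants place the contact with [u], respectively [v], at the
   maximum. *)
pose phi1 p := F p (tq, xq) + (U - F0).
pose phi2 q := (V + F0) - F (tp, xp) q.
have b1 : balg phi1 by exact: balg_Phil.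
have b2 : balg phi2 by exact: balg_Phir.
set T1 := blend r (tp, xp) phi1 psi1; set T2 := blend r (tq, xq) phi2 psi2.
have bT1 : balg T1 by exact: balg_blend.
have bT2 : balg T2 by exact: balg_blend.
have T1U : T1 (tp, xp) = U by rewrite /T1 blend_base /phi1 -/F0; lra.
have T2V : T2 (tq, xq) = V by rewrite /T2 blend_base /phi2 -/F0; lra.
have op1 : operatorE T1 (tp, xp) <= 0.
  apply: (subsolution_max (p := (tp, xp)) su (balg_test bT1) tp0) => q hq'; rewrite T1U -/U subrr subr_le0.
  apply: blend_ge; last exact: psi1_u.
  by have := fmax q (tq, xq) hq' hq; rewrite /phi1 -/V; lra.
have op2 : 0 <= operatorE T2 (tq, xq).
  apply: (supersolution_min (p := (tq, xq)) sv (balg_test bT2) tq0) => q hq'; rewrite T2V -/V subrr subr_ge0.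
  apply: blend_le; last exact: psi2_v.
  by have := fmax (tp, xp) q hp hq'; rewrite /phi2 -/U; lra.
rewrite /operatorE /= in op1 op2.
rewrite !derive_blend // in op1; rewrite !derive_blend // in op2.
rewrite !derive_Phil in op1; rewrite !derive_Phir in op2.
rewrite /= ?mulr0 ?mul0r ?mulr0 ?addr0 ?add0r ?mulr1 in op1 op2.
set P := 4 * M * (e^-1 * dbump ((xp - xq) / e)) in op1 op2.
set a := 4 * M * (h^-1 * dbump ((tp - tq) / h)) in op1 op2.
set E := 4 * M * (b * dbump (b * xp)) in op1.
set Th := 8 * M * (l * dbump (l * tp + 1)) in op1.
set H1 := Htilde _ _ in op1; set H2 := Htilde _ _ in op2.
have hF1 : Hregular (fun y => T1 (tp, y)) xp := test_Hregular tp xp (balg_test bT1).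
have hF2 : Hregular (fun y => T2 (tq, y)) xq := test_Hregular tq xq (balg_test bT2).
set w := (xp - xq) / e.
have B0 z : 0 <= bump (z / r) := bump_ge0 _.
have B1 z : bump (z / r) <= 1 := bump_le1 _.
have BN z : bump (- z / r) = bump (z / r) by rewrite mulNr bumpN.
have BLN z : bump (- z / L) = bump (z / L) by rewrite mulNr bumpN.
have BL z : bump (b * z) = bump (z / L) by rewrite /L invrK mulrC.
have BL0 z : 0 <= bump (z / L) := bump_ge0 _.
have T1E z : T1 (tp, xp + z) = (1 - bump (z / r)) * phi1 (tp, xp + z) +
    bump (z / r) * psi1 (tp, xp + z) := blendE r (tp, xp) phi1 psi1 z.
have T2E z : T2 (tq, xq + z) = (1 - bump (z / r)) * phi2 (tq, xq + z) +
    bump (z / r) * psi2 (tq, xq + z) := blendE r (tq, xq) phi2 psi2 z.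
have p1E z : phi1 (tp, xp + z) - U = 4 * M * (bump (w + z / e) - bump w) +
    4 * M * (bump (b * xp + b * z) - bump (b * xp)).
  rewrite /phi1 /F0 /F /Phi /= -/w.
  have -> : (xp + z - xq) / e = w + z / e by rewrite /w; ring.
  have -> : b * (xp + z) = b * xp + b * z by ring.
  by ring.
have p2E z : phi2 (tq, xq + z) - V = - (4 * M * (bump (w - z / e) - bump w)).
  rewrite /phi2 /F0 /F /Phi /= -/w.
  have -> : (xp - (xq + z)) / e = w - z / e by rewrite /w; ring.
  by ring.
(* Both points move by the same [z], which the space doubling does not see; moving them by a further
   [r ^+ 2] in opposite directions undoes the shifts of [psi1] and [psi2] and changes its argument
   by [2 * r ^+ 2 / e] only. *)
have far z : psi1 (tp, xp + z) - U - (psi2 (tq, xq + z) - V) <=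
    4 * M * (4 * r ^+ 2 * e^-1) + 4 * M * (2 * b * r ^+ 2) + 2 * r ^+ 2 + 16 * M * bump (z / L)
    + 4 * M * (bump (b * xp + b * z) - bump (b * xp)).
  have := psi1_le z; have := psi2_ge z.
  have := fmax (tp, xp + z + r ^+ 2) (tq, xq + z - r ^+ 2) hp hq.
  rewrite /F0 /F /Phi /= -/w.
  have -> : (xp + z + r ^+ 2 - (xq + z - r ^+ 2)) / e = w + 2 * r ^+ 2 * e^-1 by rewrite /w; ring.
  have -> : b * (xp + z + r ^+ 2) = b * xp + b * z + b * r ^+ 2 by ring.
  have /ler_normlP[_] := bump_lipschitz (w + 2 * r ^+ 2 * e^-1) w.
  have /ler_normlP[_] := bump_lipschitz (b * xp + b * z + b * r ^+ 2) (b * xp + b * z).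
  have -> : `|w + 2 * r ^+ 2 / e - w| = 2 * r ^+ 2 / e.
    by rewrite addrAC subrr add0r ger0_norm // mulr_ge0 ?mulr_ge0 // ltW.
  have -> : `|b * xp + b * z + b * r ^+ 2 - (b * xp + b * z)| = b * r ^+ 2.
    by rewrite addrAC subrr add0r ger0_norm // mulr_ge0 // ltW.
  rewrite -(ler_pM2l M0) => i1; rewrite -(ler_pM2l M0) => i2.
  by clear -i1 i2; lra.
have Kn z : bump2 w (z / e) <= K * ((e ^+ 2)^-1 * z ^+ 2).
  apply: le_trans (ler_norm _) _; apply: (le_trans (HK _ _)); apply: ler_wpM2l => //.
  exact: bump_scale_le.
have KL z : bump2 (b * xp) (b * z) <= K * bump (z / L).
  by rewrite -BL; apply: le_trans (ler_norm _) _; exact: HK.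
(* Near the points each test function contributes its own second difference. Far away, adding [z]
   and [- z] turns the first differences of the localisation into a second one, of size
   [bump (z / L)]. *)
have HH : H2 <= H1 + A1 * r ^+ 2 * kint r + A2 * kint L.
  apply: Htilde_le => // [|z z0]; first by rewrite mulr_ge0 // ltW.
  have ee : sdiff (fun y => T2 (tq, y)) xq z - sdiff (fun y => T1 (tp, y)) xp z =
     (1 - bump (z / r)) * ((phi1 (tp, xp + z) - U - (phi2 (tq, xq + z) - V)) +
        (phi1 (tp, xp + - z) - U - (phi2 (tq, xq + - z) - V)))
     + bump (z / r) * ((psi1 (tp, xp + z) - U - (psi2 (tq, xq + z) - V)) +
        (psi1 (tp, xp + - z) - U - (psi2 (tq, xq + - z) - V))).
    by rewrite /sdiff T1U T2V !T1E !T2E !BN; ring.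
  rewrite -(bump_div z r0) -(bump_div z L0).
  suff : sdiff (fun y => T2 (tq, y)) xq z - sdiff (fun y => T1 (tp, y)) xp z <=
      A1 * r ^+ 2 * bump (z / r) + A2 * bump (z / L) by clear; lra.
  rewrite ee; apply: le_trans (convex_le (B0 z) (B1 z)
    (m1 := 8 * M * (K * ((e ^+ 2)^-1 * z ^+ 2)) + 4 * M * (K * bump (z / L)))
    (m2 := 32 * M * r ^+ 2 * e^-1 + 16 * M * b * r ^+ 2 + 4 * r ^+ 2 + 32 * M * bump (z / L)
      + 4 * M * (K * bump (z / L))) _ _) _.
  - rewrite !p1E !p2E mulNr !opprK mulrN.
    have k1 := ler_wpM2l (ltW M0) (Kn z); have k2 := ler_wpM2l (ltW M0) (KL z).
    by rewrite /bump2 in k1 k2; clear -k1 k2; lra.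
  - have f1 := far z; have f2 := far (- z); rewrite BLN mulrN in f2.
    have k2 := ler_wpM2l (ltW M0) (KL z).
    by rewrite /bump2 in k2; clear -f1 f2 k2; lra.
  have o1 := one_sub_bump z r0.
  have c1 : (1 - bump (z / r)) * (8 * M * (K * ((e ^+ 2)^-1 * z ^+ 2))) =
     8 * M * K * (e ^+ 2)^-1 * (r ^+ 2 * bump (z / r)) by rewrite -o1; ring.
  have c2 : bump (z / r) * (32 * M * bump (z / L)) <= 32 * M * bump (z / L).
    by apply: ler_piMl => //; rewrite mulr_ge0 // mulr_ge0 // ltW.
  have c3 : b * (M * (r ^+ 2 * bump (z / r))) <= M * (r ^+ 2 * bump (z / r)).
    by apply: ler_piMl; [rewrite mulr_ge0 ?mulr_ge0 // ltW|exact: b_le1].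
  by rewrite mulrDr c1 /A1 /A2; clear -c2 c3; lra.
have hz : Hregular (fun=> 0 : R) 0 := test_Hregular 0 0 (balg_test (balg_cst (0 : R))).
have z00 : Htilde (fun=> 0 : R) 0 = 0.
  rewrite (HtildeE hz) (@eq_Rintegral _ _ _ _ _ (cst 0)) ?Rintegral_cst ?mul0r //.
  by move=> z _; rewrite /sdiff mul0rn !subr0 mul0r.
have H1n : `|H1| <= D * kint r.
  have := @Htilde_dist_le _ _ _ xp 0 D 0 r hF1 hz r0 D0 (lexx _).
  rewrite z00 subr0 mul0r addr0; apply => z z0.
  rewrite mul0r addr0 -(bump_div z r0) {2}/sdiff mul0rn !subr0.
  have ee : sdiff (fun y => T1 (tp, y)) xp z = 
     (1 - bump (z / r)) * (- (phi1 (tp, xp + z) - U) - (phi1 (tp, xp + - z) - U))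
     + bump (z / r) * ((U - psi1 (tp, xp + z)) + (U - psi1 (tp, xp + - z))).
    by rewrite /sdiff T1U !T1E !BN; ring.
  have near2 : `|- (phi1 (tp, xp + z) - U) - (phi1 (tp, xp + - z) - U)| <=
      4 * M * K * ((e ^+ 2)^-1 + 1) * z ^+ 2.
    rewrite !p1E mulNr mulrN.
    have q1 : `|bump2 w (z / e)| <= K * ((e ^+ 2)^-1 * z ^+ 2).
      by apply: (le_trans (HK _ _)); apply: ler_wpM2l => //; exact: bump_scale_le.
    have q2 : `|bump2 (b * xp) (b * z)| <= K * (1 * z ^+ 2).
      apply: (le_trans (HK _ _)); apply: ler_wpM2l => //; rewrite BL.
      apply: le_trans (bump_scale_le _ L0) _; apply: ler_wpM2r; first exact: sqr_ge0.
      by rewrite /L exprVn invrK expr_le1 // ltW.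
    have k1 := ler_wpM2l (ltW M0) q1; have k2 := ler_wpM2l (ltW M0) q2.
    rewrite (_ : _ - _ = - (4 * (M * bump2 w (z / e)) + 4 * (M * bump2 (b * xp) (b * z)))); last first.
      by rewrite /bump2; ring.
    rewrite normrN; apply: (le_trans (ler_normD _ _)).
    by rewrite !normrM normr_nat (gtr0_norm M0); clear -k1 k2; lra.
  have psiB z' : `|U - psi1 (tp, xp + z')| <= 12 * M.
    have u1 := uM (tp, xp) hp; have u2 := uM (tp, xp + z') hp.
    have u3 := uM (tp, xp + z' + r ^+ 2) hp.
    have u4 := psi1_u (tp, xp + z') hp; have u5 := psi1_le z'.
    have u6 : M * bump (z' / L) <= M by apply: ler_piMr; [exact: ltW|exact: bump_le1].
    move: u1 u2 u3; rewrite -/U !ler_norml => /andP[a1 a2] /andP[a3 a4] /andP[a5 a6].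
    by apply/andP; split; clear -M0 r2M u4 u5 u6 a1 a2 a3 a4 a5 a6; lra.
  rewrite ee; apply: (le_trans (ler_normD _ _)); rewrite !normrM (ger0_norm (B0 z)).
  rewrite ger0_norm; last by rewrite subr_ge0.
  have c1 := ler_wpM2l (_ : 0 <= 1 - bump (z / r)) near2.
  have c2 : `|(U - psi1 (tp, xp + z)) + (U - psi1 (tp, xp + - z))| <= 24 * M.
    by apply: (le_trans (ler_normD _ _)); have := psiB z; have := psiB (- z); clear; lra.
  have c3 := ler_wpM2l (B0 z) c2.
  have o1 := one_sub_bump z r0.
  have c4 : (1 - bump (z / r)) * (4 * M * K * ((e ^+ 2)^-1 + 1) * z ^+ 2) <=
     4 * M * K * ((e ^+ 2)^-1 + 1) * bump (z / r).
    rewrite mulrCA o1; apply: ler_wpM2l; last by apply: ler_piMl => //; exact: le_trans rr r1.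
    by rewrite mulr_ge0 ?addr_ge0 ?(ltW e2i) //; clear -MK; lra.
  have {}c1 := c1 _; rewrite subr_ge0 in c1; have {}c1 := c1 (B1 z).
  by rewrite /D; clear -c1 c3 c4; lra.
have kr : r ^+ 2 * kint r = r * pp by rewrite /kint -/pp; clear -r0; field; lra.
have kL : kint L = b * pp by rewrite /kint -/pp /L invrK.
have Th_ge : M * l <= Th.
  have [_ D8] : l * tp + 1 <= 2 /\ 1 / 8 <= dbump (l * tp + 1).
    apply: dbump_ge; first by rewrite lerDr mulr_ge0 // ltW.
    by rewrite -(ler_pM2l (_ : 0 < 8 * M)); [clear -hl; lra|rewrite mulr_gt0].
  have Ml : 0 <= M * l by rewrite mulr_ge0 // ltW.
  by have := ler_wpM2l Ml D8; rewrite /Th; clear; lra.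
have Pb : `|P| <= 8 * M * e^-1.
  rewrite /P -/w 3!normrM normr_nat (gtr0_norm M0) (gtr0_norm ei).
  by have := ler_wpM2l (ltW (mulr_gt0 M0 ei)) (dbump_le2 w); clear; lra.
have Eb : `|E| <= 8 * M * b.
  rewrite /E 3!normrM normr_nat (gtr0_norm M0) (gtr0_norm b0).
  by have := ler_wpM2l (ltW (mulr_gt0 M0 b0)) (dbump_le2 (b * xp)); clear; lra.
set Pp := Num.max P 0 in op2; set Qp := Num.max _ 0 in op1.
have Pp0 : 0 <= Pp by rewrite /Pp le_max lexx orbT.
have PpB : Pp <= 8 * M * e^-1.
  rewrite /Pp ge_max; apply/andP; split; first by apply: le_trans Pb; exact: ler_norm.
  by rewrite mulr_ge0 ?(ltW ei) // mulr_ge0 // ltW.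
have QE : `|Qp - Pp| <= `|E|.
  by rewrite /Qp /Pp (le_trans (maxr_dist _ _)) // (_ : _ - P = E) //; ring.
have X0 : 0 <= pp * (A1 + A2) * r.
  by apply: mulr_ge0; [apply: mulr_ge0; [exact: ltW|exact: addr_ge0]|exact: ltW].
have HH' : H2 <= H1 + pp * (A1 + A2) * r.
  apply: (le_trans HH); rewrite -[A1 * _ * _]mulrA kr kL.
  have : A2 * b * pp <= A2 * r * pp.
    by apply: ler_wpM2r; [exact: ltW|apply: ler_wpM2l => //; exact: le_trans br rr].
  by clear; lra.
have Y1 : Pp * H2 <= Pp * H1 + 8 * M * e^-1 * (pp * (A1 + A2) * r).
  have := ler_wpM2l Pp0 HH'; have := ler_wpM2r X0 PpB; clear; lra.
(* The slopes differ by [O(b)] with [b <= r ^+ 2], which outweighs the size [O(1 / r)] of [H1]. *)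
have Y2 : `|(Qp - Pp) * H1| <= 8 * M * (pp * D) * r.
  rewrite normrM; apply: (@le_trans _ _ (8 * M * b * (D * kint r))).
    by apply: ler_pM => //; exact: le_trans QE Eb.
  have k0 : 0 <= kint r by rewrite /kint mulr_ge0 ?invr_ge0 // ltW.
  have : 8 * M * b * (D * kint r) <= 8 * M * r ^+ 2 * (D * kint r).
    apply: ler_wpM2r; first by rewrite mulr_ge0.
    by apply: ler_wpM2l => //; rewrite mulr_ge0 // ltW.
  have -> : 8 * M * r ^+ 2 * (D * kint r) = 8 * M * D * (r ^+ 2 * kint r) by ring.
  by rewrite kr; clear; lra.
(* Subtracting the two viscosity inequalities cancels the slope [a] of the time doubling and leaves
   the gain [Th]. *)
move: Y2; rewrite ler_norml => /andP[Y2 _].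
by clear -op1 op2 Th_ge Y1 Y2; lra.
Qed.

End doubling.

(** * Comparison *)

Section comparison_principle.
Variable R : realType.
Implicit Types (u v phi psi : R * R -> R) (p q o : R * R).

Lemma continuous_bump_comp (T : topologicalType) (g : T -> R) :
  continuous g -> continuous (fun x => bump (g x)).
Proof.
move=> cg x; apply: (continuous_comp (cg x)).
by apply: differentiable_continuous; apply/derivable1_diffP; case: (is_derive_bump (g x)).
Qed.

Lemma continuous_Phi (M e h b l : R) :
  continuous (fun c : (R * R) * (R * R) => Phi M e h b l c.1 c.2).
Proof.
have c11 : continuous (fun c : (R * R) * (R * R) => c.1.1).
  by move=> c; apply: continuous_comp; [exact: cvg_fst|exact: cvg_fst].
have c12 : continuous (fun c : (R * R) * (R * R) => c.1.2).
  by move=> c; apply: continuous_comp; [exact: cvg_fst|exact: cvg_snd].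
have c21 : continuous (fun c : (R * R) * (R * R) => c.2.1).
  by move=> c; apply: continuous_comp; [exact: cvg_snd|exact: cvg_fst].
have c22 : continuous (fun c : (R * R) * (R * R) => c.2.2).
  by move=> c; apply: continuous_comp; [exact: cvg_snd|exact: cvg_snd].
move=> c; apply: cvgD; [apply: cvgD; [apply: cvgD|]|].
- apply: cvgM; first exact: cvg_cst.
  apply: (continuous_bump_comp (g := fun c : (R * R) * (R * R) => (c.1.2 - c.2.2) / e)) => d.
  by apply: cvgM; [apply: cvgB; [exact: c12|exact: c22]|exact: cvg_cst].
- apply: cvgM; first exact: cvg_cst.
  apply: (continuous_bump_comp (g := fun c : (R * R) * (R * R) => (c.1.1 - c.2.1) / h)) => d.
  by apply: cvgM; [apply: cvgB; [exact: c11|exact: c21]|exact: cvg_cst].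
- apply: cvgM; first exact: cvg_cst.
  apply: (continuous_bump_comp (g := fun c : (R * R) * (R * R) => b * c.1.2)) => d.
  by apply: cvgM; [exact: cvg_cst|exact: c12].
- apply: cvgM; first exact: cvg_cst.
  apply: cvgB; last exact: cvg_cst.
  apply: (continuous_bump_comp (g := fun c : (R * R) * (R * R) => l * c.1.1 + 1)) => d.
  by apply: cvgD; [apply: cvgM; [exact: cvg_cst|exact: c11]|exact: cvg_cst].
Qed.

Theorem comparison u v (M rho : R) : 0 < rho -> subsolution u -> supersolution v ->
    bounded_by M u -> bounded_by M v -> space_mono u -> space_mono v ->
    (forall x, u (0, x + rho) <= v (0, x)) ->
  forall p, halfplane p -> u p <= v p.
Proof.
(* [1 <= M] makes the shift [r ^+ 2] of the smooth approximations at most [M]. *)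
wlog M1 : M / 1 <= M.
  move=> H rho0 su sv uM vM; have M0 : 0 <= M.
    by apply: (le_trans (normr_ge0 _) (uM (0, 0) _)); rewrite /halfplane /=.
  apply: (H (M + 1)) => //; first by lra.
  - by move=> q hq; have := uM q hq; lra.
  - by move=> q hq; have := vM q hq; lra.
move=> rho0 su sv uM vM mu mv uv [T X] hT; rewrite leNgt; apply/negP => gap.
have M0 : 0 < M by lra.
set m := u (T, X) - v (T, X).
have m0 : 0 < m by rewrite /m; lra.
have T0 : 0 <= T := hT.
have [|tau tau0 Htau] := @initial_gap R u v M rho (m / 4) M0 rho0 _ su sv uM vM mu mv uv.
  by lra.
set e := rho / 2; have e0 : 0 < e by rewrite /e; lra.
set h := tau / 2; have h0 : 0 < h by rewrite /h; lra.
(* At [(T, X)] the time term costs at most [16 * M * l * T] and the localisation [8 * M * b * |X|];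
   [l] and [B] make each at most [m / 4], so half of the gap survives. *)
set l := m / (64 * M * (T + 1)).
have l0 : 0 < l by rewrite divr_gt0 // mulr_gt0 //; lra.
have lE : 64 * M * (T + 1) * l = m by rewrite /l; field; rewrite !gt_eqF //; lra.
have [A A0 HA] := doubling_estimate M1 e0 h0 l0 su sv uM vM mu mv.
set B := m / (32 * M * (`|X| + 1)).
have X0 := normr_ge0 X.
have B0 : 0 < B by rewrite divr_gt0 // mulr_gt0 //; lra.
have BE : 32 * M * (`|X| + 1) * B = m by rewrite /B; field; rewrite !gt_eqF //; lra.
suff key : forall r, 0 < r -> r <= 1 -> M * l <= A * r.
  by have := small_le0 A0 key; rewrite leNgt mulr_gt0.
move=> r r0 r1.
set b := Num.min B (r ^+ 2).
have b0 : 0 < b by rewrite lt_min B0 exprn_gt0.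
have bB : b <= B by rewrite ge_min lexx.
have br : b <= r ^+ 2 by rewrite ge_min lexx orbT.
pose f (c : (R * R) * (R * R)) := (u c.1 + - v c.2) + - Phi M e h b l c.1 c.2.
have hh : halfplane (T, X) by [].
have usu : usc_on (@halfplane R) u by exact/usc_onP/su.1.
have lsv : usc_on (@halfplane R) (fun q => - v q) by apply/usc_onP; exact: (lsc_usc v).1 sv.1.
have usf : usc_on (@halfplane R `*` @halfplane R) f.
  apply: usc_onD; last first.
    by apply: continuous_usc_on => c; apply: cvgN; exact: continuous_Phi.
  apply: usc_onD.
    by apply: (usc_on_comp _ _ usu) => [c|c []]; [exact: cvg_fst|].
  by apply: (usc_on_comp _ _ lsv) => [c|c []]; [exact: cvg_snd|].
have b1 : bump 1 = 1 / 2 :> R by rewrite bumpE expr1n; field.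
have f0 : m / 2 <= f ((T, X), (T, X)).
  rewrite /f /Phi /= !subrr !mul0r bump0 mulr0 !add0r -/m.
  have /ler_normlP[_ i1] := bump_lipschitz (l * T + 1) 1.
  have /ler_normlP[_ i2] := bump_lipschitz (b * X) 0.
  rewrite b1 addrK (ger0_norm (x := l * T)) in i1; last by rewrite mulr_ge0 // ltW.
  rewrite bump0 !subr0 normrM (gtr0_norm b0) in i2.
  have i3 := ler_wpM2l (ltW M0) i1; have i4 := ler_wpM2l (ltW M0) i2.
  have i5 : M * (b * `|X|) <= M * (B * `|X|).
    by apply: ler_wpM2l; [exact: ltW|apply: ler_wpM2r].
  have i6 : 0 < M * l by rewrite mulr_gt0.
  have i7 : 0 < M * B by rewrite mulr_gt0.
  by rewrite /m in lE BE *; lra.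
have Phi_ge p q : halfplane p -> [/\ 4 * M * bump ((p.2 - q.2) / e) <= Phi M e h b l p q,
    4 * M * bump ((p.1 - q.1) / h) <= Phi M e h b l p q,
    4 * M * bump (b * p.2) <= Phi M e h b l p q &
    8 * M * (bump (l * p.1 + 1) - 1 / 2) <= Phi M e h b l p q /\ 0 <= Phi M e h b l p q].
  move=> hp; rewrite /Phi.
  have a1 : 0 <= M * bump ((p.2 - q.2) / e) by rewrite mulr_ge0 ?bump_ge0 // ltW.
  have a2 : 0 <= M * bump ((p.1 - q.1) / h) by rewrite mulr_ge0 ?bump_ge0 // ltW.
  have a3 : 0 <= M * bump (b * p.2) by rewrite mulr_ge0 ?bump_ge0 // ltW.
  have a4 : 0 <= M * (bump (l * p.1 + 1) - 1 / 2).
    apply: mulr_ge0; first exact: ltW.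
    have y1 : 1 <= l * p.1 + 1 by rewrite lerDr mulr_ge0 // ltW.
    by rewrite subr_ge0; apply: bump_ge_half; rewrite ger0_norm; clear -y1; lra.
  by clear -a1 a2 a3 a4; split; [| | |split]; lra.
have uvM p q : halfplane p -> halfplane q -> u p - v q <= 2 * M.
  move=> hp hq; have := uM p hp; have := vM q hq.
  by rewrite !ler_norml => /andP[? ?] /andP[? ?]; lra.
have half y : 4 * M * bump y <= 2 * M -> `|y| <= 1.
  by move=> H; apply: bump_le_half; rewrite -(ler_pM2l M0); lra.
(* As for the barrier: [u - v] is at most [2 * M], so each nonnegative term of [Phi] is too. *)
have loc p q : halfplane p -> halfplane q -> 0 <= f (p, q) ->
    [/\ `|p.2 - q.2| <= e, `|p.1 - q.1| <= h, `|p.2| <= b^-1, l * p.1 + 1 <= 2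
      & 8 * M * (bump (l * p.1 + 1) - 1 / 2) <= 2 * M].
  move=> hp hq fp; have [g1 g2 g3 [g4 _]] := Phi_ge p q hp.
  have U2 : Phi M e h b l p q <= 2 * M by have := uvM p q hp hq; rewrite /f /= in fp; lra.
  split.
  - have := half _ (le_trans g1 U2).
    by rewrite normrM normfV (gtr0_norm e0) ler_pdivrMr // mul1r.
  - have := half _ (le_trans g2 U2).
    by rewrite normrM normfV (gtr0_norm h0) ler_pdivrMr // mul1r.
  - have := half _ (le_trans g3 U2).
    by rewrite normrM (gtr0_norm b0) -ler_pdivlMl // mulr1.
  - have [] // := @dbump_ge R (l * p.1 + 1).
      by rewrite lerDr mulr_ge0 // ltW.
    by rewrite -(ler_pM2l (_ : 0 < 8 * M)); [clear -g4 U2; lra|rewrite mulr_gt0].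
  - exact: le_trans g4 U2.
have [|[p q] [/= hp hq fmax]] := usc_halfplane2_max (p0 := ((T, X), (T, X))) (T := l^-1 + h) (L := b^-1 + e) usf hh hh.
  move=> [p q] /= hp hq fpq.
  have [|d1 d2 d3 d4 _] := loc p q hp hq; first by clear -fpq f0 m0; lra.
  have li : p.1 <= l^-1 by rewrite -[leRHS]mulr1 ler_pdivlMl //; clear -d4; lra.
  split.
  - by clear -li h0; lra.
  - by clear -d3 e0; lra.
  - by move: d2; rewrite ler_norml; clear -li => /andP[? ?]; lra.
  - have := ler_normD p.2 (q.2 - p.2); rewrite subrKC distrC; clear -d1 d3; lra.
have fm : m / 2 <= f (p, q) by have := fmax ((T, X), (T, X)) hh hh; clear -f0; lra.
have [|d1 d2 d3 d4 d5] := loc p q hp hq; first by clear -fm m0; lra.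
have [_ _ _ [_ Ph0]] := Phi_ge p q hp.
(* With both times at most [tau], [initial_gap] would leave at most [m / 4], less than the maximum.
   As the times differ by at most [h = tau / 2], neither can then be 0. *)
have far0 : ~ (p.1 <= tau /\ q.1 <= tau).
  move=> [pt qt].
  have := Htau p.1 q.1 p.2 q.2 hp pt hq qt d1.
  by move: fm; rewrite /f /=; case: (p) Ph0 => ? ? /=; case: (q) => ? ? /=; lra.
have /andP[d21 d22] : - h <= p.1 - q.1 <= h by rewrite -ler_norml.
have p0 : 0 < p.1.
  rewrite ltNge; apply/negP => pn; apply: far0; rewrite /h in d21 d22.
  by clear -pn d21 d22 tau0; split; lra.
have q0 : 0 < q.1.
  rewrite ltNge; apply/negP => qn; apply: far0; rewrite /h in d21 d22.
  by clear -qn d21 d22 tau0; split; lra.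
apply: (HA r b p q) => // p' q' hp' hq'.
exact: (fmax (p', q') hp' hq').
Qed.

End comparison_principle.

(** * Perron's method *)

Section perron.
Variable R : realType.
Implicit Types (u phi psi : R * R -> R) (p q o : R * R).

(** Translation invariance serves twice: for the monotonicity of the maximal subsolution and for the
    shifted solution in the uniqueness proof. *)
Definition shiftx (d : R) (p : R * R) : R * R := (p.1, p.2 + d).

Lemma derive_shiftx (f : R * R -> R) d (v p : R * R) :
  'D_v (fun q => f (shiftx d q)) p = 'D_v f (shiftx d p).
Proof.
rewrite /derive; congr lim.
have E (h : R) : shiftx d (h *: v + p) = h *: v + shiftx d p.
  by rewrite /shiftx; congr (_, _); rewrite /= addrA.
by under eq_fun => h do rewrite /= E.
Qed.

Lemma foldr_derive_shiftx (f : R * R -> R) d (vs : seq (R * R)) :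
  foldr (fun v g => 'D_v g) (fun q => f (shiftx d q)) vs =
  (fun q => foldr (fun v g => 'D_v g) f vs (shiftx d q)).
Proof.
by elim: vs => [//|v vs /= ->]; apply/funext => p; exact: derive_shiftx.
Qed.

Lemma differentiable_shiftx d p : differentiable (shiftx d) p.
Proof.
apply: differentiable_pair; first exact: differentiable_fst.
by apply: differentiableD; [exact: differentiable_snd|exact: differentiable_cst].
Qed.

Lemma test_shiftx (f : R * R -> R) d : test f -> test (fun q => f (shiftx d q)).
Proof.
move=> [sf [/bounded_onP[M HM] Bf]]; have E := foldr_derive_shiftx f d.
split; [|split].
- move=> vs p; rewrite E.
  by apply: (differentiable_comp (differentiable_shiftx d p)); exact: sf.
- by apply/bounded_onP; exists M => p _; exact: HM.
- move=> v w; have /bounded_onP[K HK] := Bf v w.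
  apply/bounded_onP; exists K => p _.
  by have /(congr1 (@^~ p)) /= -> := E [:: v; w]; exact: HK.
Qed.

Lemma operatorE_shiftx phi d p : test phi ->
  operatorE (fun q => phi (shiftx d q)) p = operatorE phi (shiftx d p).
Proof.
move=> tphi; rewrite /operatorE !derive_shiftx; congr (_ + _ * _).
have h1 := test_Hregular p.1 p.2 (test_shiftx d tphi).
have h2 := test_Hregular p.1 (p.2 + d) tphi.
rewrite (HtildeE h1) [RHS](HtildeE h2); apply: eq_Rintegral => z _.
by rewrite /sdiff /shiftx /= ![_ + d + _]addrAC.
Qed.

Lemma shiftxK d : cancel (@shiftx d) (shiftx (- d)).
Proof. by move=> [t x]; rewrite /shiftx /= addrK. Qed.

Lemma shiftx_continuous d : continuous (shiftx d).
Proof. by move=> p; apply: differentiable_continuous; exact: differentiable_shiftx. Qed.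

Lemma subsolution_shiftx (w : R * R -> R) d : subsolution w -> subsolution (fun p => w (shiftx d p)).
Proof.
move=> [uw sw]; split.
  apply/usc_onP.
  by apply: (@usc_on_comp R _ _ _ _ _ _ (@shiftx_continuous d) _ ((usc_onP w).1 uw)).
move=> phi p sphi Cphi p0 sm.
have tphi : test phi by split.
have t' := test_shiftx (- d) tphi.
have := sw _ (shiftx d p) t'.1 t'.2 p0; rewrite operatorE_shiftx // shiftxK.
apply=> q hq qp; rewrite /= shiftxK.
have hq' : halfplane (shiftx (- d) q) by [].
have := sm (shiftx (- d) q) hq'; rewrite /=.
have -> : shiftx d (shiftx (- d) q) = q by rewrite -{1}(opprK d) shiftxK.
apply; apply: contra qp => /eqP <-.
by rewrite -{1}(opprK d) shiftxK.
Qed.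

Lemma operatorE_cst (k : R) p : operatorE (fun=> k) p = 0.
Proof.
by rewrite /operatorE !derive_cst maxxx mul0r addr0.
Qed.

Lemma subsolution_cst (k : R) : subsolution (fun=> k : R).
Proof.
split.
  by apply/usc_onP; apply: continuous_usc_on => p; exact: cvg_cst.
move=> phi p sphi Cphi p0 sm.
have tphi : test phi by split.
rewrite -(operatorE_cst k p).
apply: (operatorE_touch (balg_test (balg_cst k)) tphi p0) => q hq; have [->//|qp] := eqVneq q p.
exact: ltW (sm q hq qp).
Qed.

Lemma bump_mono (a b : R) : `|a| <= `|b| -> bump a <= bump b.
Proof.
move=> ab; rewrite /bump lerD2l lerN2 /lorentz lef_pV2 ?posrE ?lorentz_den // lerD2l.
by rewrite -(real_normK (num_real a)) -(real_normK (num_real b)) ler_sqr ?nnegrE.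
Qed.

Lemma pen_far o q (e : R) : 0 < e -> ~ (`|q.1 - o.1| < e /\ `|q.2 - o.2| < e) ->
  bump e <= pen o q.
Proof.
move=> e0 far; have b1 := bump_ge0 (q.1 - o.1); have b2 := bump_ge0 (q.2 - o.2).
have [h1|h1] := ltP `|q.1 - o.1| e; last first.
  by have := @bump_mono e (q.1 - o.1); rewrite gtr0_norm // => /(_ h1); rewrite /pen; lra.
have [h2|h2] := ltP `|q.2 - o.2| e; last first.
  by have := @bump_mono e (q.2 - o.2); rewrite gtr0_norm // => /(_ h2); rewrite /pen; lra.
by case: far.
Qed.

Lemma test_near_lt psi p (a : R) : test psi -> psi p < a -> \forall q \near p, psi q < a.
Proof.
move=> tpsi h; have := @continuous_usc_on R _ setT psi (test_continuous tpsi) p I a h.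
by move/near_boxP => [e e0 H]; apply/near_boxP; exists e => // q h1 h2; exact: H.
Qed.

Lemma test_near_gt psi p (a : R) : test psi -> a < psi p -> \forall q \near p, a < psi q.
Proof.
move=> tpsi h; have h' : - psi p < - a by rewrite ltrN2.
have cN : continuous (fun q => - psi q) by move=> q; apply: cvgN; exact: test_continuous.
have := @continuous_usc_on R _ setT _ cN p I (- a) h'.
move/near_boxP => [e e0 H]; apply/near_boxP; exists e => // q h1 h2.
by have := H q h1 h2 I; rewrite ltrN2.
Qed.

Definition upper_env u p : R := - lower_env (fun q => - u q) p.

Lemma bounded_byN M u : bounded_by M u -> bounded_by M (fun q => - u q).
Proof. by move=> uM p hp; rewrite normrN; exact: uM. Qed.

(* The penalisation traps the maximum points for a nearly optimal member of [S] near [p];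
   the inequality then passes to the limit by continuity of the operator. *)
Lemma subsolution_upper_env (S : set (R * R -> R)) u M : bounded_by M u ->
    (forall w, S w -> subsolution w) ->
    (forall w p, S w -> halfplane p -> w p <= u p) ->
    (forall p a, halfplane p -> a < u p -> exists2 w, S w & a < w p) ->
  subsolution (upper_env u).
Proof.
move=> uM Ssub Sle Sup; have nM := bounded_byN uM.
have ule p : halfplane p -> u p <= upper_env u p.
  by move=> hp; have [_ _] := lower_env_fin nM hp; rewrite /upper_env; lra.
split; first by apply/usc_onP; exact: lower_env_lsc nM.
move=> phi p sphi Cphi p0 sm.
have tphi : test phi by split.
have hp : halfplane p by rewrite /halfplane /= ltW.
have max_p q : halfplane q -> upper_env u q - phi q <= upper_env u p - phi p.
  by move=> hq; have [->//|qp] := eqVneq q p; exact: ltW (sm q hq qp).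
have [A A0 HA] := operatorE_near p tphi.
apply: (small_le0 A0) => r r0 r1.
(* [r ^+ 2] is the displacement allowed by [operatorE_near], and [p.1 / 2] keeps the box at positive
   times. *)
set e := Num.min (r ^+ 2) (p.1 / 2).
have e0 : 0 < e by rewrite lt_min exprn_gt0 //; lra.
have er : e <= r ^+ 2 by rewrite ge_min lexx.
have ep : e <= p.1 / 2 by rewrite ge_min lexx orbT.
set g := r * bump e.
have g0 : 0 < g by rewrite mulr_gt0 // bump_gt0 // gt_eqF.
have tper := test_perturb r p tphi.
set psi := perturb phi r p in tper *.
have psip : psi p = phi p by rewrite /psi /perturb pen0 mulr0 addr0.
have N1 : \forall q \near p, psi q < psi p + g / 4.
  have h : psi p < psi p + g / 4 by lra.
  exact: (test_near_lt tper h).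
have [|q [hq psiq uq]] := lower_env_lt nM hp _ N1 (a := - upper_env u p + g / 4).
  by rewrite /upper_env opprK; lra.
have [|w Sw wq] := Sup q (upper_env u p - g / 4) hq; first by lra.
have usw : usc_on (@halfplane R) (fun q => w q + - psi q).
  apply: usc_onD; first by apply/usc_onP; exact: (Ssub w Sw).1.
  by apply: continuous_usc_on => q'; apply: cvgN; exact: test_continuous.
(* Off the box the penalisation costs at least [g], whereas [w q - psi q] is within [g / 2] of the
   maximum of [upper_env u - phi]. *)
have near_box q' : halfplane q' -> w q - psi q <= w q' - psi q' ->
    `|q'.1 - p.1| < e /\ `|q'.2 - p.2| < e.
  move=> hq' le; apply: contrapT => far.
  have := pen_far e0 far; rewrite -(ler_pM2l r0) -/g => gp.
  have := max_p q' hq'; have := Sle w q' Sw hq'; have := ule q' hq'.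
  move: psiq uq wq le gp; rewrite psip {3}/psi /perturb.
  by clear -g0; lra.
have [|c hc cmax] := usc_halfplane_max (T := p.1 + e) (L := `|p.2| + e) usw hq.
  move=> q' hq' /(near_box _ hq')[/ltr_normlP[_ h1] h2]; split; first by lra.
  by have := ler_normD (q'.2 - p.2) p.2; rewrite subrK; lra.
have [c1 c2] := near_box c hc (cmax q hq).
have c0 : 0 < c.1 by move/ltr_normlP : c1 => [? ?]; lra.
have := subsolution_max (Ssub w Sw) tper c0 cmax.
have := HA r r c r0 r1 _ _ _; rewrite (gtr0_norm r0) => /(_ (lexx _)).
move=> /(_ (le_trans (ltW c1) er) (le_trans (ltW c2) er)).
rewrite ler_norml -/psi => /andP[+ _].
by move: (operatorE psi c) (operatorE phi p) => a b; clear; lra.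
Qed.

(* Perron's bump: where the lower envelope fails to be a supersolution, a touching
   test function can be lifted; being globally below the new function, it needs no
   separate treatment of the nonlocal term. *)
Lemma supersolution_lower_env u : (forall p, halfplane p -> 0 <= u p <= 1) ->
    subsolution u ->
    (forall w, subsolution w -> (forall p, halfplane p -> 0 <= w p <= 1) ->
       (forall x, w (0, x) = u (0, x)) -> forall p, halfplane p -> w p <= u p) ->
  supersolution (lower_env u).
Proof.
move=> u01 su umax.
have uM : bounded_by 1 u.
  by move=> p hp; have /andP[? ?] := u01 p hp; rewrite ler_norml; apply/andP; split; lra.
have lu p : halfplane p -> lower_env u p <= u p by move=> hp; have [] := lower_env_fin uM hp.
split; first by apply/lsc_usc/usc_onP; exact: lower_env_lsc uM.
move=> phi p sphi Cphi p0 sm; rewrite leNgt; apply/negP => op.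
have tphi : test phi by split.
have hp : halfplane p by rewrite /halfplane /= ltW.
set k := lower_env u p - phi p.
have phi_le q : halfplane q -> phi q + k <= lower_env u q.
  move=> hq; rewrite /k; have [->|qp] := eqVneq q p; first by lra.
  by have := sm q hq qp; rewrite /=; lra.
have lu1 q : halfplane q -> lower_env u q <= 1.
  by move=> hq; have /andP[_ h] := u01 q hq; have := lu q hq; lra.
(* At height 1, [phi] would touch a constant from below and its operator would be nonnegative. The
   strict inequality leaves room for a lift that stays below 1. *)
have p1 : lower_env u p < 1.
  rewrite lt_neqAle lu1 // andbT; apply/eqP => E; move: op; apply/negP; rewrite -leNgt.
  rewrite -(operatorE_cst 0 p).
  apply: (operatorE_touch tphi (balg_test (balg_cst (0 : R))) p0) => q hq.
  by have := phi_le q hq; have := lu1 q hq; rewrite /k; lra.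
have [A A0 HA] := operatorE_near p tphi.
(* Small enough for the operator to stay negative in the box after the perturbation by
   [- r * pen]. *)
set r := Num.min 1 (- operatorE phi p / (2 * (A + 1))).
have r0 : 0 < r by rewrite lt_min ltr01 divr_gt0 //; lra.
have r1 : r <= 1 by rewrite ge_min lexx.
have Ar : A * r < - operatorE phi p.
  have : r <= - operatorE phi p / (2 * (A + 1)) by rewrite ge_min lexx orbT.
  rewrite ler_pdivlMr; last by lra.
  by nra.
have tper := test_perturb (- r) p tphi.
set psi := perturb phi (- r) p in tper *.
have psip : psi p = phi p by rewrite /psi /perturb pen0 mulr0 addr0.
set a := (1 - lower_env u p) / 2.
have a0 : 0 < a by rewrite /a; lra.
have /near_boxP[e1 e10 He1] : \forall q \near p, psi q < psi p + a.
  have h : psi p < psi p + a by lra.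
  exact: (test_near_lt tper h).
set e := Num.min e1 (Num.min (r ^+ 2) (p.1 / 2)).
have e0 : 0 < e by rewrite !lt_min e10 exprn_gt0 //=; lra.
have ee1 : e <= e1 by rewrite ge_min lexx.
have er : e <= r ^+ 2 by rewrite !ge_min lexx orbT.
have ep : e <= p.1 / 2 by rewrite !ge_min lexx !orbT.
set g := Num.min (r * bump e) a.
have g0 : 0 < g by rewrite lt_min a0 andbT mulr_gt0 // bump_gt0 // gt_eqF.
have gr : g <= r * bump e by rewrite ge_min lexx.
have ga : g <= a by rewrite ge_min lexx orbT.
(* Off the box [psi + k] is at least [g] below [u], so after a lift by [g / 2] it can exceed [u] in
   the box only. *)
pose chi q := psi q + (k + g / 2).
have tchi : test chi by apply: (testD tper); exact: balg_test (balg_cst _).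
have chi_box q : halfplane q -> u q < chi q -> `|q.1 - p.1| < e /\ `|q.2 - p.2| < e.
  move=> hq uc; apply: contrapT => far.
  have := pen_far e0 far; rewrite -(ler_pM2l r0) => gp.
  have := phi_le q hq; have := lu q hq.
  move: uc; rewrite /chi /psi /perturb.
  by clear -gp gr g0; lra.
pose w q := Num.max (u q) (chi q).
have sw : subsolution w.
  split.
    apply/usc_onP; apply: usc_on_max; first exact/usc_onP/su.1.
    by apply: continuous_usc_on; exact: test_continuous.
  move=> phi' q sphi' Cphi' q0 sm'.
  have tphi' : test phi' by split.
  have hq : halfplane q by rewrite /halfplane /= ltW.
  have [cu|uc] := leP (chi q) (u q).
    apply: (su.2 phi' q sphi' Cphi' q0) => q' hq' q'q.
    have := sm' q' hq' q'q; rewrite /= {2}/w (max_l cu).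
    have : u q' <= w q' by rewrite /w le_max lexx.
    by lra.
  have [q1 q2] := chi_box q hq uc.
  have := HA r (- r) q r0 r1; rewrite normrN (gtr0_norm r0) => /(_ (lexx _)).
  move=> /(_ (le_trans (ltW q1) er) (le_trans (ltW q2) er)).
  rewrite ler_norml -/psi => /andP[_ op'].
  apply: (@le_trans _ _ (operatorE chi q)).
    apply: (operatorE_touch tchi tphi' q0) => q' hq'.
    have [->//|q'q] := eqVneq q' q.
    have := sm' q' hq' q'q; rewrite /= {2}/w (max_r (ltW uc)).
    have : chi q' <= w q' by rewrite /w le_max lexx orbT.
    by move: (w q') (chi q') (chi q) (phi' q') (phi' q) => a1 a2 a3 a4 a5; clear; lra.
  have : operatorE chi q <= operatorE psi q.
    by apply: (operatorE_touch tper tchi q0) => q' hq'; rewrite /chi; move: (psi q') (psi q) => *; clear; lra.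
  move: op' Ar; move: (operatorE chi q) (operatorE psi q) (operatorE phi p) => a1 a2 a3.
  by clear; lra.
have w01 q : halfplane q -> 0 <= w q <= 1.
  move=> hq; have /andP[u0 u1] := u01 q hq; rewrite /w le_max u0 /= ge_max u1 /=.
  have [cu|uc] := leP (chi q) (u q); first by lra.
  have [q1 q2] := chi_box q hq uc.
  have := He1 q (lt_le_trans q1 ee1) (lt_le_trans q2 ee1).
  by rewrite /chi psip /k /a in ga *; lra.
(* The box lies at positive times, so the initial values are untouched. *)
have w0 x : w (0, x) = u (0, x).
  rewrite /w; have [cu|uc] := leP (chi (0, x)) (u (0, x)); first by [].
  have h0 : halfplane (0 : R, x) by rewrite /halfplane /=.
  have [/= q1 _] := chi_box (0, x) h0 uc.
  by move: q1; rewrite sub0r normrN gtr0_norm //; lra.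
have N : \forall q \near p, psi p - g / 4 < psi q.
  have h : psi p - g / 4 < psi p by lra.
  exact: (test_near_gt tper h).
(* At this [q], [u] is below and [chi] above the level [lower_env u p + g / 4], against
   maximality. *)
have [|q [hq psiq uq]] := lower_env_lt uM hp _ N (a := lower_env u p + g / 4); first by lra.
have := umax w sw w01 w0 q hq.
have : chi q <= w q by rewrite /w le_max lexx orbT.
by rewrite /chi psip /k in psiq *; lra.
Qed.

End perron.

(** * The maximal subsolution and its initial values *)

Section perron_solution.
Variable R : realType.
Implicit Types (u : R * R -> R) (p q : R * R).

(** A point near [(t, y)] where [u] is small, moved left by [y - x], is a point near [(t, x)] where
    [u] is no larger. *)
Lemma space_mono_lower_env u M : bounded_by M u -> space_mono u -> space_mono (lower_env u).
Proof.
move=> uM mu t t0 x y xy; rewrite leNgt; apply/negP => lt.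
have hx : halfplane (t, x) by []; have hy : halfplane (t, y) by [].
have [b yb /near_boxP[e e0 H]] := lower_env_gt uM hx lt.
have N : \forall q \near (t, y), `|q.1 - t| < e /\ `|q.2 - y| < e.
  by apply/near_boxP; exists e.
have [[s z] [/= hq [h1 h2] qb]] := lower_env_lt uM hy yb N.
have h2' : `|z - (y - x) - x| < e by rewrite (_ : _ - x = z - y) //; ring.
have := H (s, z - (y - x)) h1 h2' hq.
have : u (s, z - (y - x)) <= u (s, z) by apply: mu => //; lra.
by lra.
Qed.

Lemma upper_env_ge u M p : bounded_by M u -> halfplane p -> u p <= upper_env u p.
Proof.
by move=> uM hp; have [_ _] := lower_env_fin (bounded_byN uM) hp; rewrite /upper_env; lra.
Qed.

Lemma upper_env_le u phi M : bounded_by M u -> test phi ->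
    (forall p, halfplane p -> u p <= phi p) ->
  forall p, halfplane p -> upper_env u p <= phi p.
Proof.
move=> uM tphi uphi p hp; rewrite leNgt; apply/negP => lt.
set d := (upper_env u p - phi p) / 2.
have d0 : 0 < d by rewrite /d; lra.
have h : phi p < phi p + d by lra.
have [|q [hq pq uq]] := lower_env_lt (bounded_byN uM) hp _ (test_near_lt tphi h)
    (a := - upper_env u p + d).
  by rewrite /upper_env opprK; lra.
have := uphi q hq; rewrite /d in pq uq; lra.
Qed.

(** The reflected barrier with [M = 1], truncated at 0 so that it can compete among functions with
    values in [[0, 1]]. *)
Definition lower_barrier (d C c x0 : R) (p : R * R) : R :=
  Num.max (- barrier 1 d C (- c) (- x0) (reflx p)) 0.

Lemma lower_barrierE (d C c x0 t x : R) : - barrier 1 d C (- c) (- x0) (reflx (t, x)) =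
  c - 4 * bump ((x - x0) / d) - 8 * (bump (C * t + 1) - 1 / 2).
Proof.
rewrite /reflx /= barrierE !mulr1.
have -> : (- x - - x0) / d = - ((x - x0) / d) by ring.
by rewrite bumpN; ring.
Qed.

(** Where the barrier is positive, [c <= 1] keeps its time term below 1, in the range of
    [operatorE_barrier]; elsewhere the constant 0 is touched. *)
Lemma subsolution_lower_barrier (d : R) : 0 < d ->
  exists2 C : R, 0 < C & forall c x0, c <= 1 -> subsolution (lower_barrier d C c x0).
Proof.
move=> d0; have [C C0 HC] := operatorE_barrier ltr01 d0.
exists C => // c x0 c1.
have tB := balg_test (balg_barrier 1 d C (- c) (- x0)).
have tb := test_reflx tB.
split.
  apply/usc_onP; apply: usc_on_max.
    by apply: continuous_usc_on; exact: test_continuous.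
  by apply: continuous_usc_on => p; exact: cvg_cst.
move=> phi p sphi Cphi p0 sm.
have tphi : test phi by split.
have [b0|b0] := leP (- barrier 1 d C (- c) (- x0) (reflx p)) 0.
  apply: ((subsolution_cst (0 : R)).2 phi p sphi Cphi p0) => q hq qp.
  have := sm q hq qp; rewrite /= {2}/lower_barrier (max_r b0).
  have : 0 <= lower_barrier d C c x0 q by rewrite /lower_barrier le_max lexx orbT.
  by lra.
apply: (@le_trans _ _ (operatorE (fun q => - barrier 1 d C (- c) (- x0) (reflx q)) p)).
  apply: (operatorE_touch tb tphi p0) => q hq.
  have [->//|qp] := eqVneq q p.
  have := sm q hq qp; rewrite /= {2}/lower_barrier (max_l (ltW b0)).
  have : - barrier 1 d C (- c) (- x0) (reflx q) <= lower_barrier d C c x0 q.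
    by rewrite /lower_barrier le_max lexx.
  by lra.
rewrite operatorE_reflx // oppr_le0; apply: ltW.
case: p b0 p0 {sm} => t x b0 /= t0; apply: HC; first exact: ltW.
rewrite lower_barrierE in b0; have := bump_ge0 ((x - x0) / d).
by rewrite mulr1; lra.
Qed.

(** The last two clauses identify [lower_env G (0, x)] with the supremum of [F0] over [y < x],
    without mentioning a limit. *)
Lemma perron (F0 : R -> R) : {homo F0 : x y / x <= y} -> (forall x, 0 <= F0 x <= 1) ->
    (forall x e, 0 < e -> exists2 d, 0 < d & F0 (x + d) <= F0 x + e) ->
  exists G : R * R -> R, [/\ bounded_by 1 G, space_mono G, subsolution G,
    supersolution (lower_env G) &
    forall x, [/\ G (0, x) = F0 x, forall d, 0 < d -> F0 (x - d) <= lower_env G (0, x) &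
      forall a, a < lower_env G (0, x) -> exists2 y, y < x & a < F0 y]].
Proof.
move=> mF F01 rcF.
pose S := [set w : R * R -> R | [/\ subsolution w, forall p, halfplane p -> 0 <= w p <= 1
  & forall x, w (0, x) <= F0 x]].
have S0 : S (fun=> 0).
  split; [exact: subsolution_cst|by move=> p _; rewrite lexx ler01|].
  by move=> x; have /andP[] := F01 x.
pose V p := [set w p | w in S].
have supV p : halfplane p -> has_sup (V p).
  move=> hp; split; first by exists 0; exists (fun=> 0).
  by exists 1 => _ [w [_ w1 _] <-]; have /andP[] := w1 p hp.
pose F p := sup (V p).
have Sle w p : S w -> halfplane p -> w p <= F p.
  by move=> Sw hp; apply: (sup_upper_bound (supV p hp)); exists w.
have Sup p a : halfplane p -> a < F p -> exists2 w, S w & a < w p.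
  by move=> hp /(sup_gt (supV p hp).1)[_ [w Sw <-] aw]; exists w.
have F1 p : halfplane p -> 0 <= F p <= 1.
  move=> hp; rewrite (Sle _ _ S0 hp) /=.
  by apply: (ge_sup (supV p hp).1) => _ [w [_ w1 _] <-]; have /andP[] := w1 p hp.
have FM : bounded_by 1 F.
  by move=> p hp; have /andP[? ?] := F1 p hp; rewrite ler_norml; apply/andP; split; lra.
set G := upper_env F.
have sG : subsolution G by apply: (subsolution_upper_env FM) Sle Sup => w [].
have G01 p : halfplane p -> 0 <= G p <= 1.
  move=> hp; have /andP[h _] := F1 p hp.
  rewrite (le_trans h (upper_env_ge FM hp)) /=.
  by apply: (upper_env_le FM (balg_test (balg_cst 1))) => // q hq; have /andP[] := F1 q hq.
have SG w p : S w -> halfplane p -> w p <= G p.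
  by move=> Sw hp; apply: le_trans (Sle w p Sw hp) (upper_env_ge FM hp).
have GM : bounded_by 1 G.
  by move=> p hp; have /andP[? ?] := G01 p hp; rewrite ler_norml; apply/andP; split; lra.
have h0 x : halfplane (0 : R, x) by rewrite /halfplane /=.
have b1 : bump 1 = 1 / 2 :> R by rewrite bumpE expr1n; field.
have far (d x x0 : R) : 0 < d -> d <= `|x - x0| -> 1 / 2 <= bump ((x - x0) / d).
  move=> d0 dx; apply: bump_ge_half.
  by rewrite normrM normfV (gtr0_norm d0) ler_pdivlMr // mul1r.
(* An upper barrier lies above every competitor, hence above the supremum and, being continuous,
   above its upper envelope; right-continuity of [F0] brings [x + d] back to [x]. *)
have G0 x : G (0, x) <= F0 x.
  rewrite leNgt; apply/negP => lt.
  have [|d d0 hd] := rcF x ((G (0, x) - F0 x) / 2); first by lra.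
  have [C C0 HC] := @subsolution_barrier R 1 d ltr01 d0.
  have := upper_env_le FM (balg_test (balg_barrier 1 d C (F0 (x + d)) x)) _ (h0 x).
  rewrite barrierE subrr mul0r bump0 !mulr0 add0r b1 subrr mulr0 !addr0 => h.
  suff : G (0, x) <= F0 (x + d) by lra.
  apply: h => p hp; apply: (ge_sup (supV p hp).1) => _ [w [sw w1 w0] <-].
  have /andP[c0 c1] := F01 (x + d).
  apply: (HC w) => //.
  - by move=> q hq; have /andP[? ?] := w1 q hq; rewrite ler_norml; apply/andP; split; lra.
  - lra.
  - move=> y; apply: (le_trans (w0 y)); have bp := bump_ge0 ((y - x) / d).
    have [yx|xy] := leP y (x + d); first by have := mF _ _ yx; lra.
    have dy : d <= `|y - x| by rewrite ger0_norm; lra.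
    by have := far d y x d0 dy; have /andP[_ ?] := F01 y; lra.
have SSG : S G by [].
(* [G] moved to the right is a competitor because [F0] is non-decreasing, hence it lies below the
   maximal [G]. *)
have mG : space_mono G.
  move=> t t0 x y xy.
  have SD : S (fun p => G (shiftx (- (y - x)) p)).
    split; [exact: subsolution_shiftx|by move=> p hp; exact: G01|].
    by move=> z; apply: (le_trans (G0 _)); apply: mF; rewrite /=; lra.
  have ht : halfplane (t, y) by [].
  have := SG _ (t, y) SD ht; rewrite /shiftx /=.
  by have -> : y - (y - x) = x by ring.
(* The lower barrier of height [F0 (x - d)] centred at [x] is a competitor, and its continuity at
   [(0, x)] bounds [G] below on a neighbourhood. *)
have lowG x d : 0 < d -> F0 (x - d) <= lower_env G (0, x).
  move=> d0; have [C C0 HC] := subsolution_lower_barrier d0.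
  have /andP[c0 c1] := F01 (x - d).
  set w := lower_barrier d C (F0 (x - d)) x.
  have Sw : S w.
    split; first exact: HC.
    - move=> [t z] hp; rewrite /w /lower_barrier le_max lexx orbT /= ge_max ler01 andbT.
      rewrite lower_barrierE; have := bump_ge0 ((z - x) / d).
      have y1 : 1 <= C * t + 1 by rewrite lerDr mulr_ge0 // ltW.
      have : 1 / 2 <= bump (C * t + 1) by apply: bump_ge_half; rewrite ger0_norm; lra.
      by lra.
    - move=> z; rewrite /w /lower_barrier ge_max lower_barrierE mulr0 add0r b1.
      have /andP[z0 _] := F01 z; rewrite z0 andbT; have bp := bump_ge0 ((z - x) / d).
      have [xz|zx] := leP (x - d) z; first by have := mF _ _ xz; lra.
      have dz : d <= `|z - x| by rewrite ler0_norm; lra.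
      by have := far d z x d0 dz; lra.
  rewrite leNgt; apply/negP => lt.
  have tb := test_reflx (balg_test (balg_barrier 1 d C (- F0 (x - d)) (- x))).
  set e := (F0 (x - d) - lower_env G (0, x)) / 2.
  have e0 : 0 < e by rewrite /e; lra.
  have bE : - barrier 1 d C (- F0 (x - d)) (- x) (reflx (0, x)) = F0 (x - d).
    by rewrite lower_barrierE subrr mul0r bump0 !mulr0 add0r b1; ring.
  have N := @test_near_gt R _ (0, x) (F0 (x - d) - e) tb.
  rewrite bE in N; have {}N := N _.
  have [||q [hq Nq Gq]] := lower_env_lt GM (h0 x) (a := lower_env G (0, x) + e) _ (N _).
  - by lra.
  - by lra.
  have := SG w q Sw hq.
  have : - barrier 1 d C (- F0 (x - d)) (- x) (reflx q) <= w q.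
    by rewrite /w /lower_barrier le_max lexx.
  by rewrite /e in Nq Gq *; lra.
(* A value of [G] below [F0 x] would spread by semicontinuity to [(0, x + e / 2)], where [lowG]
   gives at least [F0 (x + e / 4)]. *)
have GE x : G (0, x) = F0 x.
  apply/eqP; rewrite eq_le G0 /= leNgt; apply/negP => lt.
  have /near_boxP[e e0 He] := (usc_onP G).1 sG.1 (0, x) (h0 x) (F0 x) lt.
  have e2 : 0 < e / 4 by lra.
  have := He (0, x + e / 2) _ _ (h0 _); rewrite /= subrr normr0 => /(_ e0).
  rewrite addrAC subrr add0r gtr0_norm; last by lra.
  have e3 : e / 2 < e by lra.
  move=> /(_ e3).
  have := lowG (x + e / 2) (e / 4) e2.
  have [_ _] := lower_env_fin GM (h0 (x + e / 2)).
  have : F0 x <= F0 (x + e / 2 - e / 4) by apply: mF; lra.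
  by lra.
exists G; split => //.
  apply: supersolution_lower_env => // w sw w01 w0 p hp.
  by apply: SG => //; split => // x; rewrite w0.
move=> x; split => // [d|a]; first exact: lowG.
move=> /(lower_env_gt GM (h0 x))[b ab /near_boxP[e e0 He]].
exists (x - e / 2); first by lra.
have := He (0, x - e / 2) _ _ (h0 _); rewrite /= subrr normr0 GE => /(_ e0) h.
apply: (lt_le_trans ab); apply: h.
rewrite addrAC subrr add0r normrN gtr0_norm; lra.
Qed.

End perron_solution.

(** * The Cauchy problem *)

Section cauchy_problem.
Variable R : realType.
Variable mu0 : probability (measurableTypeR R) R.
Implicit Types (u : R * R -> R) (p q : R * R).

Definition mu_le (x : R) : R := fine (mu0 `]-oo, x]%classic).
Definition mu_lt (x : R) : R := fine (mu0 `]-oo, x[%classic).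

Lemma mu_leE x : (mu_le x)%:E = mu0 `]-oo, x]%classic.
Proof. by rewrite fineK // fin_num_measure. Qed.

Lemma mu_ltE x : (mu_lt x)%:E = mu0 `]-oo, x[%classic.
Proof. by rewrite fineK // fin_num_measure. Qed.

Lemma mu_le_mono : {homo mu_le : x y / x <= y}.
Proof.
move=> x y xy; rewrite -lee_fin !mu_leE; apply: le_measure; rewrite ?inE //.
by apply: subset_itvl; rewrite bnd_simp.
Qed.

Lemma mu_le01 x : 0 <= mu_le x <= 1.
Proof. by rewrite -!lee_fin mu_leE measure_ge0 /= probability_le1. Qed.

Lemma mu_le_lt x y : x < y -> mu_le x <= mu_lt y.
Proof.
move=> xy; rewrite -lee_fin mu_leE mu_ltE; apply: le_measure; rewrite ?inE //.
by apply: subset_itvl; rewrite bnd_simp.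
Qed.

Lemma mu_le_right_continuous x (e : R) : 0 < e -> exists2 d, 0 < d & mu_le (x + d) <= mu_le x + e.
Proof.
move=> e0; pose A n := `]-oo, (x + n.+1%:R^-1)%R]%classic.
have cA : (mu0 \o A) n @[n --> \oo] --> mu0 (\bigcap_n A n).
  apply: nonincreasing_cvg_mu => [| | |m n mn].
  - by rewrite -ge0_fin_numE ?measure_ge0 // fin_num_measure //; exact: measurable_itv.
  - by move=> ?; exact: measurable_itv.
  - by apply: bigcap_measurable => // ? _; exact: measurable_itv.
  - apply/subsetPset; apply: subset_itvl.
    by rewrite bnd_simp lerD2l lef_pV2 ?posrE // ler_nat.
rewrite -itvNycEbigcap -mu_leE in cA.
have lt : mu_le x < mu_le x + e by rewrite ltrDl.
have [n _ /(_ n (leqnn n)) /= h] := cvgr_lt (mu_le x) (fine_cvg cA) _ lt.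
by exists n.+1%:R^-1; [rewrite invr_gt0|exact: ltW h].
Qed.

Lemma mu_lt_approx x (e : R) : 0 < e -> exists2 y, y < x & mu_lt x <= mu_le y + e.
Proof.
move=> e0; pose A n := `]-oo, (x - n.+1%:R^-1)%R]%classic.
have E : `]-oo, x[%classic = \bigcup_n A n.
  apply/seteqP; split => z /=; rewrite in_itv /=.
    move=> zx; have [n hn] := ltr_add_invr zx.
    by exists n => //; rewrite /A /= in_itv /= lerBrDr ltW.
  move=> [n _]; rewrite /A /= in_itv /= => h; apply: (le_lt_trans h).
  by rewrite ltrBlDr ltrDl invr_gt0.
have cA : (mu0 \o A) n @[n --> \oo] --> mu0 (\bigcup_n A n).
  apply: nondecreasing_cvg_mu => [| |m n mn].
  - by move=> ?; exact: measurable_itv.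
  - by apply: bigcup_measurable => ? _; exact: measurable_itv.
  - apply/subsetPset; apply: subset_itvl.
    by rewrite bnd_simp lerD2l lerN2 lef_pV2 ?posrE // ler_nat.
rewrite -E -mu_ltE in cA.
have lt : mu_lt x - e < mu_lt x by rewrite ltrBlDr ltrDl.
have [n _ /(_ n (leqnn n)) /= h] := cvgr_gt (mu_lt x) (fine_cvg cA) _ lt.
exists (x - n.+1%:R^-1); first by rewrite ltrBlDr ltrDl invr_gt0.
by move: h; rewrite /mu_le /A; lra.
Qed.

Lemma cauchy_solution_le u (v : R * R -> R) : cauchy_solution mu0 u -> cauchy_solution mu0 v ->
  forall p, halfplane p -> u p <= v p.
Proof.
move=> [/bounded_onP[Mu uM] [mu [su _]] [u0 _]] [/bounded_onP[Mv vM] [mv [sv sv']] [_ v0]].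
have [M MuM MvM] : exists2 M : R, Mu <= M & Mv <= M.
  by exists (Num.max Mu Mv); rewrite le_max lexx ?orbT.
have bu : bounded_by M u by move=> p hp; exact: le_trans (uM p hp) MuM.
have bv : bounded_by M v by move=> p hp; exact: le_trans (vM p hp) MvM.
have bl : bounded_by M (lower_env v).
  move=> p hp; have [_ h1 h2] := lower_env_fin bv hp.
  by have := bv p hp; rewrite !ler_norml => /andP[? ?]; apply/andP; split; lra.
have ml := space_mono_lower_env bv mv.
(* Two shifts by [d]: one is the margin [rho] of [comparison], the other places the closed half-line
   up to [y - d] inside the open one up to [y], which carries the initial value of [lower_env v]. *)
have shift_le d : 0 < d -> forall t x, 0 <= t -> u (t, x) <= v (t, x + 2 * d).
  move=> d0 t x t0.
  have bs : bounded_by M (fun p => u (shiftx (- (2 * d)) p)) by move=> p hp; exact: bu.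
  have ms : space_mono (fun p => u (shiftx (- (2 * d)) p)).
    by move=> s s0 y z yz; apply: mu => //=; lra.
  have init y : u (shiftx (- (2 * d)) (0, y + d)) <= lower_env v (0, y).
    rewrite -lee_fin u0 v0; apply: le_measure; rewrite ?inE //.
    by apply: subset_itvl; rewrite bnd_simp /=; lra.
  have ht : halfplane (t, x + 2 * d) by [].
  have := comparison d0 (subsolution_shiftx (- (2 * d)) su) sv' bs bl ms ml init ht.
  have [_ _] := lower_env_fin bv ht.
  by rewrite /shiftx /= addrK; lra.
move=> [t x] hp; rewrite leNgt; apply/negP => lt.
(* Upper semicontinuity keeps [v] below [u (t, x)] slightly to the right of [x] too, against
   [shift_le]. *)
have /near_boxP[e e0 He] := (usc_onP v).1 sv.1 (t, x) hp _ lt.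
have e4 : 0 < e / 4 by lra.
have := shift_le (e / 4) e4 t x hp; rewrite leNgt => /negP; apply.
apply: He => //=; first by rewrite subrr normr0.
by rewrite addrAC subrr add0r gtr0_norm; lra.
Qed.

Lemma cauchy_solution_exists : exists u, cauchy_solution mu0 u.
Proof.
have [G [GM mG sG sG' init]] := perron mu_le_mono mu_le01 mu_le_right_continuous.
exists G; split; first by apply/bounded_onP; exists 1.
  by split.
split=> x; have [G0 low high] := init x; first by rewrite G0 mu_leE.
rewrite -mu_ltE; congr (_%:E); apply/eqP; rewrite eq_le; apply/andP; split; rewrite leNgt; apply/negP => lt.
  have [y yx] := high _ lt; rewrite ltNge => /negP; apply; exact: mu_le_lt.
have [|y yx] := @mu_lt_approx x ((mu_lt x - lower_env G (0, x)) / 2); first by lra.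
have := low (x - y); rewrite subr_gt0 => /(_ yx); rewrite subKr; lra.
Qed.

End cauchy_problem.

Theorem theorem4 (R : realType) (mu0 : probability (measurableTypeR R) R) :
  exists F : R * R -> R,
    cauchy_solution mu0 F /\
    forall G : R * R -> R, cauchy_solution mu0 G ->
      forall t x : R, 0 <= t -> G (t, x) = F (t, x).
Proof.
have [F solF] := cauchy_solution_exists mu0.
exists F; split => // G solG t x t0.
have ht : halfplane (t, x) by [].
by apply: le_anti; rewrite (cauchy_solution_le solG solF ht) (cauchy_solution_le solF solG ht).
Qed.
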